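(* Let $f:\mathbb{R}^n\to(-\infty,\infty]$ be lsc, $\bar x\in\operatorname{dom}f$, $\bar x^*\in\partial f(\bar x)$ and $s\in\mathbb{R}$. The following are equivalent: (i) $f$ is variationally $s$-convex at $\bar x$ for $\bar x^*$. (ii) $f$ is prox-regular at $\bar x$ for $\bar x^*$ and there are a neighborhood $U\times V$ of $(\bar x,\bar x^* )$ and $\rho>f(\bar x)$ such that $\langle z^*,z\rangle\ge s\|z\|^2$ whenever $z^*\in\widehat D^*_f(\partial f)(x,x^* )(z)$ and $(x,x^* )\in\operatorname{gph}_\rho\partial f\cap(U\times V)$. (iii) $f$ is prox-regular at $\bar x$ for $\bar x^*$ and there are a neighborhood $U\times V$ of $(\bar x,\bar x^* )$ and $\rho>f(\bar x)$ such that $\langle z^*,z\rangle\ge s\|z\|^2$ whenever $z^*\in D^*_f(\partial f)(x,x^* )(z)$ and $(x,x^* )\in\operatorname{gph}_\rho\partial f\cap(U\times V)$. (iv) $f$ is prox-regular at $\bar x$ for $\bar x^*$ and there are a neighborhood $U\times V$ of $(\bar x,\bar x^* )$ and $\rho>f(\bar x)$ such that $\langle z^*,z\rangle\ge s\|z\|^2$ whenever $(z,z^* )\in T^f_{\operatorname{gph}\partial f}(x,x^* )$, $(x,x^* )\in\mathcal O^f_{\partial f}\cap(U\times V)$ and $f(x)<\rho$. (v) $f$ is prox-regular at $\bar x$ for $\bar x^*$ and there are a neighborhood $U\times V$ of $(\bar x,\bar x^* )$ and $\rho>f(\bar x)$ such that $\langle z^*,z\rangle\ge s\|z\|^2$ whenever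 $(z,z^* )\in L\in\mathcal S_f(\partial f)(x,x^* )$ and $(x,x^* )\in\operatorname{gph}_\rho\partial f\cap(U\times V)$. (vi) $f$ is prox-regular at $\bar x$ for $\bar x^*$ and there are a neighborhood $U\times V$ of $(\bar x,\bar x^* )$ and $\rho>f(\bar x)$ such that for every $(x,x^* )\in\operatorname{gph}_\rho\partial f\cap(U\times V)$ and every $(P,W)\in\mathcal M^f_{P,W}\partial f(x,x^* )$ the matrix $PWP-sP$ is positive semidefinite.
   Context: Open balls $\mathbb{B}_\epsilon(x)$. Regular subdifferential $\widehat\partial f(x)=\{x^*\mid\liminf_{y\to x}\frac{f(y)-f(x)-\langle x^*,y-x\rangle}{\|y-x\|}\ge0\}$; limiting subdifferential $\partial f(x)$: all $x^*$ with $x_k\to x$, $f(x_k)\to f(x)$, $x_k^*\to x^*$, $x_k^*\in\widehat\partial f(x_k)$. $\operatorname{gph}_\rho\partial f=\{(x,x^* )\in\operatorname{gph}\partial f\mid f(x)<\rho\}$. Prox-regularity of lsc $f$ at $\bar x$ for $\bar x^*\in\partial f(\bar x)$: there are $\epsilon>0$, $r\ge0$ with $f(x')\ge f(x)+\langle x^*,x'-x\rangle-\frac r2\|x'-x\|^2$ whenever $x'\in\mathbb{B}_\epsilon(\bar x)$ and $(x,x^* )\in\operatorname{gph}_{f(\bar x)+\epsilon}\partial f\cap(\mathbb{B}_\epsilon(\bar x)\times\mathbb{B}_\epsilon(\bar x^* ))$. Variational $s$-convexity of lsc $f$ at $\bar x$ for $\bar x^*$: there exist an open convex neighborhood $U\times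 V$ of $(\bar x,\bar x^* )$, an lsc function $\widehat f$ and $\rho>f(\bar x)$ such that $\widehat f-\frac s2\|\cdot\|^2$ is convex on $U$, $\widehat f\le f$ on $U$, $\operatorname{gph}_\rho\partial f\cap(U\times V)=\operatorname{gph}\partial\widehat f\cap(U\times V)$ and $f=\widehat f$ at the common elements. $f$-attentive derivatives: write $(x_k,x_k^* )\xrightarrow{f}(x,x^* )$ if $(x_k,x_k^* )\in\operatorname{gph}\partial f$, $(x_k,x_k^* )\to(x,x^* )$, $f(x_k)\to f(x)$. For $(x,x^* )\in\operatorname{gph}\partial f$: $T^f_{\operatorname{gph}\partial f}(x,x^* )=\{(u,u^* )\mid\exists t_k\downarrow0,(x_k,x_k^* )\xrightarrow{f}(x,x^* ): ((x_k,x_k^* )-(x,x^* ))/t_k\to(u,u^* )\}$; $\widehat N^f_{\operatorname{gph}\partial f}(x,x^* )$ its polar cone; $N^f_{\operatorname{gph}\partial f}(x,x^* )$ the set of limits of $v_k\in\widehat N^f_{\operatorname{gph}\partial f}(x_k,x_k^* )$ with $(x_k,x_k^* )\xrightarrow{f}(x,x^* )$; $z^*\in\widehat D^*_f(\partial f)(x,x^* )(z)$ iff $(z^*,-z)\in\widehat N^f_{\operatorname{gph}\partial f}(x,x^* )$, and $z^*\in D^*_f(\partial f)(x,x^* )(z)$ iff $(z^*,-z)\in N^f_{\operatorname{gph}\partial f}(x,x^* )$. $\mathcal Z_{nn}$: the $n$-dimensional subspaces of $\mathbb{R}^n\times\mathbb{R}^n$ with metric $d(L_1,L_2)=\|P_{L_1}-P_{L_2}\|$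 ($P_L$ orthogonal projection). $\mathcal O^f_{\partial f}$: set of $(x,x^* )\in\operatorname{gph}\partial f$ with $T^f_{\operatorname{gph}\partial f}(x,x^* )\in\mathcal Z_{nn}$. $\mathcal S_f(\partial f)(x,x^* )$: all $L\in\mathcal Z_{nn}$ such that there are $(x_k,x_k^* )\in\mathcal O^f_{\partial f}$ with $(x_k,x_k^* )\xrightarrow{f}(x,x^* )$ and $d(L,T^f_{\operatorname{gph}\partial f}(x_k,x_k^* ))\to0$. $\mathcal M^f_{P,W}\partial f(x,x^* )$: the set of pairs $(P,W)$ of symmetric $n\times n$ matrices with $P^2=P$, $W(I-P)=I-P$ and $\{(Pp,Wp)\mid p\in\mathbb{R}^n\}\in\mathcal S_f(\partial f)(x,x^* )$. *)

(* Defs.v *)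
From HB Require Import structures.
From mathcomp Require Import all_boot all_order all_algebra.
From mathcomp Require Import all_classical all_reals all_analysis.
Set Implicit Arguments. Unset Strict Implicit. Unset Printing Implicit Defensive.
Import Order.TTheory GRing.Theory Num.Theory.
Import numFieldNormedType.Exports.
Local Open Scope classical_set_scope.
Local Open Scope ring_scope.

Definition dotv (R : realType) (m : nat) (u v : 'rV[R]_m) : R :=
  \sum_(i < m) u 0 i * v 0 i.

Definition enorm (R : realType) (m : nat) (u : 'rV[R]_m) : R :=
  Num.sqrt (dotv u u).

Definition eball (R : realType) (m : nat) (x : 'rV[R]_m) (e : R) : set 'rV[R]_m :=
  [set y | enorm (y - x) < e].

Definition dotp (R : realType) (n : nat) (w w' : 'rV[R]_n * 'rV[R]_n) : R :=
  dotv w.1 w'.1 + dotv w.2 w'.2.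

(** Regular subdifferential: xs in \hat\partial f(x) iff f(x) is finite and
    liminf_{y->x} (f(y)-f(x)-<xs,y-x>)/|y-x| >= 0, written out in eps-delta form. *)
Definition rsubdiff (R : realType) (n : nat) (f : 'rV[R]_n -> \bar R)
    (x xs : 'rV[R]_n) : Prop :=
  f x \is a fin_num /\
  forall e : R, 0 < e -> exists2 d : R, 0 < d &
    forall y : 'rV[R]_n, enorm (y - x) < d ->
      (f x + (dotv xs (y - x) - e * enorm (y - x))%:E <= f y)%E.

Definition lsubdiff (R : realType) (n : nat) (f : 'rV[R]_n -> \bar R)
    (x xs : 'rV[R]_n) : Prop :=
  f x \is a fin_num /\
  exists (xk xsk : nat -> 'rV[R]_n),
    [/\ xk k @[k --> \oo] --> x,
        f (xk k) @[k --> \oo] --> f x,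
        xsk k @[k --> \oo] --> xs &
        forall k, rsubdiff f (xk k) (xsk k)].

Definition gph (R : realType) (n : nat) (f : 'rV[R]_n -> \bar R)
  : set ('rV[R]_n * 'rV[R]_n) := [set z | lsubdiff f z.1 z.2].

Definition gph_rho (R : realType) (n : nat) (f : 'rV[R]_n -> \bar R) (rho : R)
  : set ('rV[R]_n * 'rV[R]_n) := [set z | lsubdiff f z.1 z.2 /\ (f z.1 < rho%:E)%E].

Definition prox_regular (R : realType) (n : nat) (f : 'rV[R]_n -> \bar R)
    (xb xbs : 'rV[R]_n) : Prop :=
  exists (e r : R), [/\ 0 < e, 0 <= r &
    forall x' x xs : 'rV[R]_n,
      eball xb e x' -> lsubdiff f x xs -> (f x < f xb + e%:E)%E ->
      eball xb e x -> eball xbs e xs ->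
      (f x + (dotv xs (x' - x) - r / 2 * enorm (x' - x) ^+ 2)%:E <= f x')%E].

Definition convex_set_rV (R : realType) (n : nat) (U : set 'rV[R]_n) : Prop :=
  forall (a b : 'rV[R]_n) (l : R), U a -> U b -> 0 <= l <= 1 ->
    U (l *: a + (1 - l) *: b).

(** Convexity of an extended-real-valued function (never -oo) on a set U. *)
Definition convex_fun_on (R : realType) (n : nat) (U : set 'rV[R]_n)
    (g : 'rV[R]_n -> \bar R) : Prop :=
  forall (a b : 'rV[R]_n) (l : R), U a -> U b -> 0 <= l <= 1 ->
    (g (l *: a + (1 - l) *: b)%R <= l%:E * g a + (1 - l)%R%:E * g b)%E.

Definition var_sconvex (R : realType) (n : nat) (f : 'rV[R]_n -> \bar R)
    (xb xbs : 'rV[R]_n) (s : R) : Prop :=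
  exists (U V : set 'rV[R]_n) (fh : 'rV[R]_n -> \bar R) (rho : R),
    [/\ open U /\ open V, convex_set_rV U /\ convex_set_rV V, U xb /\ V xbs,
        (forall x, fh x != -oo%E) /\ lower_semicontinuous fh & (f xb < rho%:E)%E]
    /\
    [/\ convex_fun_on U (fun x => fh x - (s / 2 * enorm x ^+ 2)%:E)%E,
        (forall x, U x -> (fh x <= f x)%E),
        (forall x xs, U x -> V xs -> (gph_rho f rho (x, xs) <-> gph fh (x, xs))) &
        (forall x xs, U x -> V xs -> gph_rho f rho (x, xs) -> gph fh (x, xs) ->
           f x = fh x)].

Definition fattentive (R : realType) (n : nat) (f : 'rV[R]_n -> \bar R)
    (zk : nat -> 'rV[R]_n * 'rV[R]_n) (z : 'rV[R]_n * 'rV[R]_n) : Prop :=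
  [/\ forall k, gph f (zk k),
      (zk k).1 @[k --> \oo] --> z.1,
      (zk k).2 @[k --> \oo] --> z.2 &
      f (zk k).1 @[k --> \oo] --> f z.1].

Definition ftangent (R : realType) (n : nat) (f : 'rV[R]_n -> \bar R)
    (z : 'rV[R]_n * 'rV[R]_n) : set ('rV[R]_n * 'rV[R]_n) :=
  [set w | exists (t : nat -> R) (zk : nat -> 'rV[R]_n * 'rV[R]_n),
     [/\ (forall k, 0 < t k), t k @[k --> \oo] --> (0 : R),
         fattentive f zk z,
         (t k)^-1 *: ((zk k).1 - z.1) @[k --> \oo] --> w.1 &
         (t k)^-1 *: ((zk k).2 - z.2) @[k --> \oo] --> w.2]].

Definition fnormal_reg (R : realType) (n : nat) (f : 'rV[R]_n -> \bar R)
    (z : 'rV[R]_n * 'rV[R]_n) : set ('rV[R]_n * 'rV[R]_n) :=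
  [set v | forall w, ftangent f z w -> dotp v w <= 0].

Definition fnormal_lim (R : realType) (n : nat) (f : 'rV[R]_n -> \bar R)
    (z : 'rV[R]_n * 'rV[R]_n) : set ('rV[R]_n * 'rV[R]_n) :=
  [set v | exists (zk vk : nat -> 'rV[R]_n * 'rV[R]_n),
     [/\ fattentive f zk z,
         (forall k, fnormal_reg f (zk k) (vk k)),
         (vk k).1 @[k --> \oo] --> v.1 &
         (vk k).2 @[k --> \oo] --> v.2]].

Definition coderiv_reg (R : realType) (n : nat) (f : 'rV[R]_n -> \bar R)
    (x xs z zs : 'rV[R]_n) : Prop := fnormal_reg f (x, xs) (zs, - z).

Definition coderiv_lim (R : realType) (n : nat) (f : 'rV[R]_n -> \bar R)
    (x xs z zs : 'rV[R]_n) : Prop := fnormal_lim f (x, xs) (zs, - z).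

Definition pair_row (R : realType) (n : nat) (z : 'rV[R]_n * 'rV[R]_n) : 'rV[R]_(n + n) :=
  row_mx z.1 z.2.

Definition Znn (R : realType) (n : nat) (L : set ('rV[R]_n * 'rV[R]_n)) : Prop :=
  exists B : 'M[R]_(n, n + n),
    \rank B = n /\ L = [set z | (pair_row z <= B)%MS].

Definition is_orth_proj (R : realType) (n : nat) (L : set ('rV[R]_n * 'rV[R]_n))
    (P : 'M[R]_(n + n)) : Prop :=
  [/\ P^T = P, P *m P = P & forall z, L z <-> (pair_row z <= P)%MS].

(** P_L (well defined for L in Z_nn). *)
Definition oproj (R : realType) (n : nat) (L : set ('rV[R]_n * 'rV[R]_n))
  : 'M[R]_(n + n) := xget 0 [set P | is_orth_proj L P].

Definition opnorm (R : realType) (m : nat) (A : 'M[R]_m) : R :=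
  sup [set enorm (u *m A) | u in [set u : 'rV[R]_m | enorm u = 1]].

Definition subdist (R : realType) (n : nat) (L1 L2 : set ('rV[R]_n * 'rV[R]_n)) : R :=
  opnorm (oproj L1 - oproj L2).

Definition Of_set (R : realType) (n : nat) (f : 'rV[R]_n -> \bar R)
  : set ('rV[R]_n * 'rV[R]_n) := [set z | gph f z /\ Znn (ftangent f z)].

Definition Sf (R : realType) (n : nat) (f : 'rV[R]_n -> \bar R)
    (z : 'rV[R]_n * 'rV[R]_n) : set (set ('rV[R]_n * 'rV[R]_n)) :=
  [set L | Znn L /\ exists zk : nat -> 'rV[R]_n * 'rV[R]_n,
     [/\ (forall k, Of_set f (zk k)), fattentive f zk z &
         subdist L (ftangent f (zk k)) @[k --> \oo] --> (0 : R)]].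

Definition MPW (R : realType) (n : nat) (f : 'rV[R]_n -> \bar R)
    (z : 'rV[R]_n * 'rV[R]_n) : set ('M[R]_n * 'M[R]_n) :=
  [set PW | [/\ PW.1^T = PW.1, PW.2^T = PW.2, PW.1 *m PW.1 = PW.1,
               PW.2 *m (1%:M - PW.1) = 1%:M - PW.1 &
               Sf f z [set ((PW.1 *m p)^T, (PW.2 *m p)^T) | p in [set: 'cV[R]_n]]]].

Definition psd (R : realType) (n : nat) (M : 'M[R]_n) : Prop :=
  forall u : 'cV[R]_n, 0 <= (u^T *m M *m u) 0 0.

(* Main.v *)
Require Import Defs.
From HB Require Import structures.
From mathcomp Require Import all_boot all_order all_algebra.
From mathcomp Require Import all_classical all_reals all_analysis.
From mathcomp Require Import ring lra.
Set Implicit Arguments. Unset Strict Implicit. Unset Printing Implicit Defensive.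
Import Order.TTheory GRing.Theory Num.Theory.
Import numFieldNormedType.Exports.
Local Open Scope classical_set_scope.
Local Open Scope ring_scope.

(** Prox-regularity makes the localized resolvent [P = (1 + lam ∂f)^-1] single-valued and
    2-Lipschitz near [xb + lam xbs], so the attentive graph of [∂f] is there the Lipschitz
    image of [u |-> (P u, (u - P u) / lam)]; for smooth points [u] of [P] its tangent cone
    is the subspace [{(A w, (w - A w) / lam)}] with [A = DP(u)], which is symmetric since
    [P] is the subgradient of a convex potential.  Variational s-convexity amounts to the
    subgradient inequality with modulus [s] on the localized graph: the supremum of the
    quadratic minorants is the required [s]-convex function.  All second-order conditions
    are weaker consequences of that inequality, and the weakest, (vi), gives
    [(1 + lam s) |A w|^2 <= <A w, w>] at every smooth point.  By Rademacher's theorem and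
    Tonelli, this integrates along lines to the [(1 + lam s)^-1]-bound on increments of
    [P], and the resulting upper quadratic bound on the potential dualizes to the
    subgradient inequality with modulus [s]. *)

(** * Euclidean norm *)

(** The parameter [lam] obeys two smallness conditions: [lam * r <= 2^-1] gives uniqueness and the
    Lipschitz constant 2 of the resolvent, and [0 < 1 + lam * s] makes [c = 1 + lam * s] a
    legitimate divisor for every sign of [s]. Symmetry of [A] is indispensable: (vi) concerns
    symmetric pairs [(P, W)] only, and says nothing at a smooth point until the tangent space there
    is known to come from such a pair. The bound [c |A w|^2 <= <A w, w>] is quadratic in [A] and
    cannot be integrated along a line; the square of [c A w - w] turns it into
    [c <A w, w> <= |w|^2], which is linear in [A]. Tangents and normals are exchanged in (ii) and in
    the step from (iii) to (iv) by one device: the tangent inequality says that [1 - 2 c A] is a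
    contraction, and a matrix and its transpose are contractions together. In Rademacher's theorem
    the obstacle is that partial derivatives at a point do not make a total derivative; the slopes
    of the distances to countably many closed sets of well-approximated points bridge the gap. *)

Section euclid.
Variables (R : realType) (n : nat).
Implicit Types (u v w x y : 'rV[R]_n) (a : R).

Lemma dotvC u v : dotv u v = dotv v u.
Proof. by apply: eq_bigr => i _; rewrite mulrC. Qed.

Lemma dotvDl u v w : dotv (u + v) w = dotv u w + dotv v w.
Proof. by rewrite -big_split; apply: eq_bigr => i _; rewrite mxE mulrDl. Qed.

Lemma dotvZl a u w : dotv (a *: u) w = a * dotv u w.
Proof. by rewrite mulr_sumr; apply: eq_bigr => i _; rewrite mxE mulrA. Qed.

Lemma dotvNl u w : dotv (- u) w = - dotv u w.
Proof. by rewrite -scaleN1r dotvZl mulN1r. Qed.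

Lemma dotvDr u v w : dotv u (v + w) = dotv u v + dotv u w.
Proof. by rewrite dotvC dotvDl !(dotvC u). Qed.

Lemma dotvZr a u w : dotv u (a *: w) = a * dotv u w.
Proof. by rewrite dotvC dotvZl dotvC. Qed.

Lemma dotvNr u w : dotv u (- w) = - dotv u w.
Proof. by rewrite dotvC dotvNl dotvC. Qed.

Lemma dotv0l u : dotv 0 u = 0.
Proof. by rewrite -(scale0r 0) dotvZl mul0r. Qed.

Lemma dotv0r u : dotv u 0 = 0.
Proof. by rewrite dotvC dotv0l. Qed.

Definition dotvE := (dotvDl, dotvDr, dotvNl, dotvNr, dotvZl, dotvZr).

Lemma dotvv_ge0 u : 0 <= dotv u u.
Proof. by apply: sumr_ge0 => i _; rewrite -expr2 sqr_ge0. Qed.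

Lemma dotvv_eq0 u : dotv u u = 0 -> u = 0.
Proof.
move/eqP; rewrite psumr_eq0; last by move=> i _; rewrite -expr2 sqr_ge0.
move/allP => h; apply/rowP => i; rewrite mxE; apply/eqP.
by have := h i (mem_index_enum i); rewrite /= mulf_eq0 orbb.
Qed.

Lemma enorm_ge0 u : 0 <= enorm u.
Proof. exact: sqrtr_ge0. Qed.

Lemma sqr_enorm u : enorm u ^+ 2 = dotv u u.
Proof. by rewrite sqr_sqrtr// dotvv_ge0. Qed.

Lemma enormN u : enorm (- u) = enorm u.
Proof. by rewrite /enorm dotvNl dotvNr opprK. Qed.

Lemma enormB u v : enorm (u - v) = enorm (v - u).
Proof. by rewrite -enormN opprB. Qed.

Lemma enorm0 : enorm (0 : 'rV[R]_n) = 0.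
Proof. by rewrite /enorm dotv0l sqrtr0. Qed.

Lemma enorm_eq0 u : enorm u = 0 -> u = 0.
Proof. by move=> h; apply: dotvv_eq0; rewrite -sqr_enorm h expr0n. Qed.

Lemma enormZ a u : enorm (a *: u) = `|a| * enorm u.
Proof.
by rewrite /enorm dotvZl dotvZr mulrA -expr2 sqrtrM ?sqr_ge0// sqrtr_sqr.
Qed.

Lemma ler_dotv u v : dotv u v <= enorm u * enorm v.
Proof.
have [u0|u0] := eqVneq (enorm u) 0.
  by rewrite (enorm_eq0 u0) dotv0l enorm0 mul0r.
have [v0|v0] := eqVneq (enorm v) 0.
  by rewrite (enorm_eq0 v0) dotv0r enorm0 mulr0.
have up : 0 < enorm u by rewrite lt_def u0 enorm_ge0.
have vp : 0 < enorm v by rewrite lt_def v0 enorm_ge0.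
have := dotvv_ge0 (enorm v *: u - enorm u *: v).
rewrite !dotvE (dotvC v u) -!sqr_enorm.
set a := enorm u in up *; set b := enorm v in vp *; set c := dotv u v.
rewrite [X in 0 <= X](_ : _ = 2 * (a * b) * (a * b - c)); last by ring.
by rewrite pmulr_rge0 ?subr_ge0// !mulr_gt0.
Qed.

Lemma ler_norm_dotv u v : `|dotv u v| <= enorm u * enorm v.
Proof.
by rewrite ler_norml ler_dotv andbT lerNl -dotvNl -(enormN u) ler_dotv.
Qed.

Lemma ler_enormD u v : enorm (u + v) <= enorm u + enorm v.
Proof.
rewrite -ler_sqr ?nnegrE ?addr_ge0 ?enorm_ge0// sqrrD !sqr_enorm.
rewrite !dotvE (dotvC v u); have := ler_dotv u v; lra.
Qed.

Lemma ler_enormB u v w : enorm (u - w) <= enorm (u - v) + enorm (v - w).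
Proof. by rewrite (le_trans _ (ler_enormD _ _))// addrA subrK. Qed.

Lemma norm_coord_le u (i : 'I_n) : `|u 0 i| <= `|u|.
Proof.
rewrite [leRHS]/Num.norm /= mx_normrE; apply/bigmax_geP; right => /=.
by exists (0, i).
Qed.

Lemma norm_row_le u a : 0 <= a -> (forall i, `|u 0 i| <= a) -> `|u| <= a.
Proof.
move=> a0 ua; rewrite [leLHS]/Num.norm /= mx_normrE; apply/bigmax_leP.
by split=> // -[i j] _ /=; rewrite ord1.
Qed.

(** Limits and neighborhoods refer to the sup norm of row vectors, the theorem to [enorm]; this
    bound and [enorm_le_norm] allow passing between them. *)
Lemma norm_le_enorm u : `|u| <= enorm u.
Proof.
apply: norm_row_le (enorm_ge0 u) _ => i.
rewrite -ler_sqr ?nnegrE ?enorm_ge0// sqr_enorm real_normK ?num_real//.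
rewrite /dotv (bigD1 i)//= -expr2 lerDl sumr_ge0// => j _.
by rewrite -expr2 sqr_ge0.
Qed.

Lemma enorm_le_norm u : enorm u <= n%:R * `|u|.
Proof.
rewrite -ler_sqr ?nnegrE ?enorm_ge0 ?mulr_ge0 ?ler0n// sqr_enorm.
apply: (@le_trans _ _ (\sum_(i < n) `|u| ^+ 2)).
  apply: ler_sum => i _; rewrite -expr2 -real_normK ?num_real//.
  by rewrite ler_sqr ?nnegrE// norm_coord_le.
rewrite sumr_const card_ord exprMn -[leLHS]mulr_natl ler_wpM2r ?sqr_ge0//.
by rewrite -natrX ler_nat; case: (n) => // k; rewrite leq_pmulr.
Qed.

End euclid.

Lemma le_enorm_dotv (R : realType) n m (u : 'rV[R]_n) (v : 'rV[R]_m) :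
  (enorm u <= enorm v) = (dotv u u <= dotv v v).
Proof. by rewrite -!sqr_enorm ler_sqr ?nnegrE ?enorm_ge0. Qed.

Section euclid_topology.
Variables (R : realType) (n : nat).
Implicit Types (x y : 'rV[R]_n).

Lemma nbhs_eballP x (U : set 'rV[R]_n) :
  nbhs x U <-> exists2 e, 0 < e & eball x e `<=` U.
Proof.
split.
  move/nbhs_ballP => [e /= e0 eU]; exists e => // y /= ye; apply: eU.
  rewrite -ball_normE /= distrC; exact: le_lt_trans (norm_le_enorm _) ye.
(* Dividing by [n.+1] instead of [n] keeps the radius positive when [n = 0]. *)
move=> [e e0 eU]; apply/nbhs_ballP; exists (e / n.+1%:R) => /=.
  by rewrite divr_gt0.
move=> y; rewrite -ball_normE /= distrC => yx; apply: eU => /=.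
apply: le_lt_trans (enorm_le_norm _) _.
apply: (@le_lt_trans _ _ (n.+1%:R * `|y - x|)).
  by rewrite ler_wpM2r// ler_nat.
by rewrite mulrC -ltr_pdivlMr.
Qed.

Lemma open_eball x (e : R) : open (eball x e).
Proof.
rewrite openE => y /= yx; apply/nbhs_eballP; exists (e - enorm (y - x)).
  by rewrite subr_gt0.
move=> z /= zy; apply: le_lt_trans (ler_enormB z y x) _.
by rewrite -ltrBrDr.
Qed.

Lemma convex_eball x (e : R) : convex_set_rV (eball x e).
Proof.
move=> a b l /= ax bx /andP[l0 l1].
rewrite /eball /= (_ : _ - x = l *: (a - x) + (1 - l) *: (b - x)); last first.
  by apply/rowP => i; rewrite !mxE; ring.
apply: le_lt_trans (ler_enormD _ _) _; rewrite !enormZ !ger0_norm ?subr_ge0//.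
have [->|l1'] := eqVneq l 1; first by rewrite mul1r subrr mul0r addr0.
have l1s : 0 < 1 - l by rewrite subr_gt0 lt_neqAle l1' l1.
apply: (@lt_le_trans _ _ (l * e + (1 - l) * e)); last by rewrite -mulrDl subrKC mul1r.
by rewrite ler_ltD ?ler_wpM2l ?(ltW ax)// ltr_pM2l.
Qed.

Lemma cvg_enormP (u : nat -> 'rV[R]_n) x :
  (u k @[k --> \oo] --> x) <->
  forall e, 0 < e -> \forall k \near \oo, enorm (u k - x) < e.
Proof.
split.
  move=> ux e e0; apply: (ux (eball x e)).
  by apply/nbhs_eballP; exists e.
move=> h U /nbhs_eballP[e e0 eU].
by have := h e e0; apply: filterS => k; exact: eU.
Qed.

Lemma cvg_enorm0 (u : nat -> 'rV[R]_n) x (b : nat -> R) :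
  (forall k, enorm (u k - x) <= b k) -> b k @[k --> \oo] --> (0 : R) ->
  u k @[k --> \oo] --> x.
Proof.
move=> ub /cvgrPdist_lt b0; apply/cvg_enormP => e e0.
have := b0 e e0; apply: filterS => k; rewrite sub0r normrN.
by apply: le_lt_trans; apply: le_trans (ub k) (ler_norm _).
Qed.

Lemma cvg_coordP (T : Type) (F : set_system T) {FF : Filter F} (u : T -> 'rV[R]_n) x :
  u k @[k --> F] --> x -> forall i, u k 0 i @[k --> F] --> x 0 i.
Proof.
move=> ux i; apply: (cvg_comp u (fun v : 'rV[R]_n => v 0 i) ux).
exact: coord_continuous.
Qed.

Lemma cvg_dotv (T : Type) (F : set_system T) {FF : Filter F} (u v : T -> 'rV[R]_n) x y :
  u k @[k --> F] --> x -> v k @[k --> F] --> y ->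
  dotv (u k) (v k) @[k --> F] --> dotv x y.
Proof.
move=> ux vy; apply: cvg_big => [|i _]; first exact: add_continuous.
by apply: cvgM; exact: cvg_coordP.
Qed.

Lemma cvg_enorm (u : nat -> 'rV[R]_n) x :
  u k @[k --> \oo] --> x -> enorm (u k) @[k --> \oo] --> enorm x.
Proof.
move=> ux; have uu : dotv (u k) (u k) @[k --> \oo] --> dotv x x by exact: (cvg_dotv ux ux).
exact: (cvg_comp _ _ uu (@sqrt_continuous R (dotv x x))).
Qed.

End euclid_topology.

Lemma cvg_near_le (R : realType) (u : nat -> R) (l c : R) :
  u k @[k --> \oo] --> l -> (\forall k \near \oo, u k <= c) -> l <= c.
Proof.
move=> ul uc; rewrite -(cvg_lim (@Rhausdorff R) ul).
by apply: limr_le => //; apply/cvg_ex; exists l.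
Qed.

Lemma cvg_near_ge (R : realType) (u : nat -> R) (l c : R) :
  u k @[k --> \oo] --> l -> (\forall k \near \oo, c <= u k) -> c <= l.
Proof.
move=> ul uc; rewrite -(cvg_lim (@Rhausdorff R) ul).
by apply: limr_ge => //; apply/cvg_ex; exists l.
Qed.

(** On row vectors this is the sup norm. No sign is imposed on [L], whence the factors [|L|] and
    [|L| + 1] in later estimates. *)
Definition lipschitz_map (R : realType) (V W : normedModType R) (L : R) (F : V -> W) :=
  forall x y, `|F x - F y| <= L * `|x - y|.

Lemma lipschitz_map_continuous (R : realType) (V W : normedModType R) L (F : V -> W) :
  lipschitz_map L F -> continuous F.
Proof.
move=> FL x; apply/cvgrPdist_lt => e e0.
apply/nbhs_ballP; exists (e / (`|L| + 1)) => /=.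
  by rewrite divr_gt0// ltr_wpDl.
move=> y; rewrite -ball_normE /= => xy.
apply: le_lt_trans (FL x y) _.
apply: (@le_lt_trans _ _ ((`|L| + 1) * `|x - y|)).
  by rewrite ler_wpM2r// (le_trans (ler_norm _))// lerDl.
by rewrite mulrC -ltr_pdivlMr// ltr_wpDl.
Qed.

(** * Lipschitz maps and Rademacher's theorem *)

Section one_dimensional.
Variable R : realType.
Local Notation leb := (@lebesgue_measure R).

Lemma cumulative_of (h : R -> R) : nondecreasing h -> continuous h ->
  exists c : cumulative R R, (c : R -> R) = h.
Proof.
move=> hnd hc.
pose hm := isCumulative.Build R _ R h hnd (right_continuousW hc).
pose c : cumulative R R := HB.pack h hm.
by exists c.
Qed.

Lemma lebesgue_stieltjes_itvoc (c : cumulative R R) (a b : R) : a <= b ->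
  lebesgue_stieltjes_measure c `]a, b]%classic = (c b - c a)%:E.
Proof.
move=> ab; rewrite /lebesgue_stieltjes_measure/= /measure_extension.
rewrite measurable_mu_extE/=; last exact: is_ocitv.
by rewrite wlength_itv_bnd.
Qed.

(** Both sides agree on half-open intervals because [h + k] is the identity, and Lebesgue measure is
    determined by these values. Hence each Stieltjes measure vanishes on Lebesgue null sets. *)
Lemma lebesgue_stieltjes_split (h k : cumulative R R) (A : set (measurableTypeR R)) :
  (forall x, h x + k x = x) -> measurable A -> leb A =
  (lebesgue_stieltjes_measure h A + lebesgue_stieltjes_measure k A)%E.
Proof.
move=> hk mA.
pose m1 : {measure set (measurableTypeR R) -> \bar R} := lebesgue_stieltjes_measure h.
pose m2 : {measure set (measurableTypeR R) -> \bar R} := lebesgue_stieltjes_measure k.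
transitivity (measure_add m1 m2 A); last exact: measure_addE.
apply: lebesgue_measure_unique mA => X /ocitvP[->|[[a b] /= ab ->]].
  by rewrite !measure0.
transitivity (m1 `]a, b]%classic + m2 `]a, b]%classic)%E; last first.
  by rewrite -measure_addE.
rewrite lebesgue_measure_itv/= lte_fin ab /m1 /m2/=.
rewrite !lebesgue_stieltjes_itvoc ?(ltW ab)// -!EFinD -{1}(hk a) -{1}(hk b).
by congr (_%:E); ring.
Qed.

(* With [h = (g + id) / 2] and [k = (id - g) / 2] both nondecreasing, the Stieltjes
   measures of [h] and [k] add up to Lebesgue measure, so that [h] has a density. *)
Lemma lipschitz1_primitive (g : R -> R) (a b : R) : lipschitz_map 1 g -> a < b ->
  exists d : R -> R, [/\ leb.-integrable [set: R] (EFin \o d) &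
    forall x, a <= x <= b ->
      g x - g a = 2 * (\int[leb]_(t in `]a, x]) d t)%R - (x - a)].
Proof.
move=> g1 ab.
have gc : continuous g := lipschitz_map_continuous g1.
have [h hE] : exists c : cumulative R R, (c : R -> R) = fun x => (g x + x) / 2.
  apply: cumulative_of.
    move=> x y xy; rewrite ler_pM2r ?invr_gt0//.
    have := g1 x y; rewrite (ler0_norm (x := x - y)) ?subr_le0// mul1r ler_norml.
    by move=> /andP[? ?]; lra.
  by move=> x; apply: cvgMl; apply: cvgD; [exact: gc|exact: cvg_id].
have [k kE] : exists c : cumulative R R, (c : R -> R) = fun x => (x - g x) / 2.
  apply: cumulative_of.
    move=> x y xy; rewrite ler_pM2r ?invr_gt0//.
    have := g1 x y; rewrite (ler0_norm (x := x - y)) ?subr_le0// mul1r ler_norml.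
    by move=> /andP[? ?]; lra.
  by move=> x; apply: cvgMl; apply: cvgB; [exact: cvg_id|exact: gc].
have hk x : h x + k x = x by rewrite hE kE; field.
have mD : @measurable _ (measurableTypeR R) `]a, b]%classic by exact: measurable_itv.
have hD : (lebesgue_stieltjes_measure h `]a, b]%classic < +oo)%E.
  by rewrite lebesgue_stieltjes_itvoc ?ltry// ltW.
(* Cutting down to []a, b]] makes the Stieltjes measure of [h] finite, so that the Radon-Nikodym
   theorem applies. *)
pose nu : {finite_measure set (measurableTypeR R) -> \bar R} := mfrestr mD hD.
have nuE A : nu A = lebesgue_stieltjes_measure h (A `&` `]a, b]%classic) by [].
have nuleb : nu `<< leb.
  apply/null_content_dominatesP => A mA A0; rewrite nuE.
  have := lebesgue_stieltjes_split hk mA; rewrite A0 => /esym/eqP.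
  rewrite padde_eq0// => /andP[/eqP hA _].
  apply/eqP; rewrite eq_le measure_ge0 andbT -hA le_measure// inE//.
  exact: measurableI.
have [d [d0 dfin di dE]] := radon_nikodym_sigma_finite nuleb.
exists (fine \o d); split.
  by rewrite (_ : EFin \o _ = d)//; apply/funext => x /=; rewrite fineK.
move=> x /andP[ax xb].
have mx : @measurable _ (measurableTypeR R) `]a, x]%classic by exact: measurable_itv.
have := dE _ mx; rewrite nuE (_ : _ `&` _ = `]a, x]%classic); last first.
  apply/seteqP; split => [t []//|t /=]; rewrite !in_itv/= => /andP[at_ tx].
  by rewrite at_ tx/= (le_trans tx xb).
rewrite lebesgue_stieltjes_itvoc// => /(congr1 fine) /= hxE.
rewrite /Rintegral (_ : (fun x => _) = d); last first.
  by apply/funext => t /=; rewrite fineK.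
by rewrite -hxE hE; field.
Qed.

(** Differentiability as a relation: a bound on slopes can be asked of every [p], without choosing a
    derivative. *)
Definition has_slope (g : R -> R) (t p : R) :=
  forall e, 0 < e -> exists2 d, 0 < d & forall tau, `|tau| < d ->
    `|g (t + tau) - g t - tau * p| <= e * `|tau|.

Lemma derivable_has_slope (g : R -> R) t :
  derivable g t 1 -> has_slope g t (derive1 g t).
Proof.
move=> gt e e0.
have : h^-1 *: (g (h + t) - g t) @[h --> 0^'] --> derive1 g t.
  move: gt; rewrite /derivable derive1E /derive.
  by under [X in cvg (X @ _) -> _]eq_fun do rewrite [_ *: 1]mulr1;
     under [X in _ -> _ --> lim (X @ _)]eq_fun do rewrite [_ *: 1]mulr1.
move=> /cvgrPdist_le /(_ e e0) /nbhs_ballP[d /= d0 dP]; exists d => // tau taud.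
have [->|tau0] := eqVneq tau 0; first by rewrite addr0 subrr mul0r subrr normr0 mulr0.
have := dP tau; rewrite -ball_normE /= sub0r normrN => /(_ taud tau0).
rewrite -(ler_pM2r (x := `|tau|)) ?normr_gt0// -normrM.
congr (_ <= _); rewrite -normrN; congr `|_|.
rewrite /GRing.scale /= (addrC tau t); set A := (X in X * tau).
by rewrite (_ : A = derive1 g t - tau^-1 * (g (t + tau) - g t)) //; field.
Qed.

(** By Lebesgue differentiation the primitive of [d] has slope [d t] at almost every [t], and [g] is
    twice this primitive minus the identity, up to a constant. *)
Lemma lipschitz1_slope_ae (g : R -> R) (a b : R) : lipschitz_map 1 g -> a < b ->
  exists d : R -> R, [/\ leb.-integrable [set: R] (EFin \o d),
    g b - g a = 2 * (\int[leb]_(t in `]a, b]) d t)%R - (b - a) &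
    {ae leb, forall t, a < t < b -> has_slope g t (2 * d t - 1)}].
Proof.
move=> g1 ab; have [d [di dE]] := lipschitz1_primitive g1 ab; exists d; split => //.
  by apply: dE; rewrite lexx (ltW ab).
have dl : locally_integrable [set: R] d.
  exact: open_integrable_locally openT di.
have di' y : leb.-integrable [set` Interval (BRight a) (BRight y)] (EFin \o d).
  by apply: integrableS di => //; exact: measurable_itv.
apply: (@filterS _ _ (ae_filter_ringOfSetsType leb) _ _ _ (FTC1 di' dl)) => t /= Ft /andP[at_ tb].
have [|Fd Fd'] := Ft; first exact: at_.
have := derivable_has_slope Fd; rewrite Fd' => Fs e e0.
have [|m m0 mP] := Fs (e / 2); first by rewrite divr_gt0.
(* The minimum keeps [t + tau] in [[a, b]], where the formula for [g] holds. *)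
exists (Num.min m (Num.min (t - a) (b - t))).
  by rewrite !lt_min m0 !subr_gt0 at_.
move=> tau; rewrite !lt_min => /and3P[taum taua taub].
pose F x := (\int[leb]_(t in `]a, x]) d t)%R.
have : `|F (t + tau) - F t - tau * d t| <= e / 2 * `|tau| := mP _ taum.
have gE x : a <= x <= b -> g x = 2 * F x - (x - a) + g a.
  by move=> /dE /(canRL (subrK _)).
have tab : a <= t <= b by rewrite (ltW at_) (ltW tb).
have ttab : a <= t + tau <= b.
  by move: taua taub; rewrite !ltr_norml => /andP[? ?] /andP[? ?]; apply/andP; split; lra.
rewrite (gE _ ttab) (gE _ tab).
move=> h.
rewrite [X in `|X|](_ : _ = 2 * (F (t + tau) - F t - tau * d t)); last by ring.
by rewrite normrM ger0_norm//; lra.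
Qed.

(** A bound [K] on the slope [2 * d t - 1] is a bound [(K + 1) / 2] on the density, and it is the
    density that is integrated. *)
Lemma lipschitz1_growth (g : R -> R) (K a b : R) : lipschitz_map 1 g -> a < b ->
  {ae leb, forall t, a < t < b -> forall p, has_slope g t p -> p <= K} ->
  g b - g a <= K * (b - a).
Proof.
move=> g1 ab gK; have [d [di dE /= ds]] := lipschitz1_slope_ae g1 ab.
have : {ae leb, forall t, a < t < b -> d t <= (K + 1) / 2}.
  apply: (@filterS2 _ _ (ae_filter_ringOfSetsType leb) _ _ _ _ gK ds) => t {}gK {}ds tab.
  have := gK tab _ (ds tab); lra.
move=> [N [mN N0 NP]].
have mD : @measurable _ (measurableTypeR R) `]a, b]%classic by exact: measurable_itv.
(* Slopes are controlled on the open interval only, so the end point [b] of the domain of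
   integration joins the null set. *)
pose N' := N `|` [set b].
have mb : @measurable _ (measurableTypeR R) [set b] by exact: measurable_set1.
have mN' : @measurable _ (measurableTypeR R) N' by exact: measurableU.
have N'0 : leb N' = 0%E.
  by apply/eqP; rewrite -measure_le0 (le_trans (measureU2 _ _ _))//=
    N0 lebesgue_measure_set1 adde0.
have mDN : @measurable _ (measurableTypeR R) (`]a, b]%classic `\` N') by exact: measurableD.
have lD : leb `]a, b]%classic = (b - a)%:E.
  by rewrite lebesgue_measure_itv/= lte_fin ab.
have lDN : leb (`]a, b]%classic `\` N') = (b - a)%:E.
  have DI : leb `]a, b]%classic = (leb (`]a, b]%classic `\` N') +
    leb (`]a, b]%classic `&` N'))%E := measureDI leb mD mN'.
  rewrite -lD DI [X in (_ + X)%E](_ : _ = 0%E) ?adde0//; apply/eqP.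
  by rewrite -measure_le0 -N'0 le_measure ?inE//; exact: measurableI.
have lDNoo : (leb (`]a, b]%classic `\` N') < +oo)%E by rewrite lDN ltry.
have : \int[leb]_(t in `]a, b]) d t <= (K + 1) / 2 * (b - a).
  rewrite /Rintegral (negligible_integral mN' mD _ N'0); last first.
    by apply: integrableS di.
  rewrite -[leRHS](_ : \int[leb]_(t in `]a, b]%classic `\` N') ((K + 1) / 2) = _).
    apply: le_Rintegral => //.
    - exact: integrableS di.
    - apply: measurable_bounded_integrable => //.
      by exists `|(K + 1) / 2|; split => // M KM t _ /=; exact: ltW.
    move=> t /= [tab tN]; rewrite leNgt; apply/negP => dt.
    apply: tN; have [->|tb] := eqVneq t b; [by right|left; apply: NP => /= h].
    move: tab; rewrite in_itv/= => /andP[at_ tb']; move: dt; rewrite ltNge h//.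
    by rewrite at_ lt_neqAle tb.
  by rewrite Rintegral_cst//; congr (_ * _); exact: (congr1 fine lDN).
rewrite dE; move: (Rintegral _ _ _) (b - a) => I w Iw.
rewrite (_ : K * w = 2 * ((K + 1) / 2 * w) - w); last by field.
by rewrite lerD2r ler_pM2l.
Qed.

Lemma has_slopeZ (g : R -> R) (c t p : R) :
  has_slope g t p -> has_slope (fun x => c * g x) t (c * p).
Proof.
move=> gp e e0; have [|d d0 dP] := gp (e / (`|c| + 1)).
  by rewrite divr_gt0// ltr_wpDl.
exists d => // tau /dP h.
rewrite [X in `|X|](_ : _ = c * (g (t + tau) - g t - tau * p)); last by ring.
rewrite normrM (le_trans (ler_wpM2l _ h))// mulrA ler_wpM2r//.
rewrite mulrCA ler_piMr ?(ltW e0)// ler_pdivrMr ?ltr_wpDl// mul1r.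
by rewrite lerDl.
Qed.

Lemma lipschitz_scale (g : R -> R) (L : R) : lipschitz_map L g ->
  lipschitz_map 1 (fun x => (`|L| + 1)^-1 * g x).
Proof.
have L1 : 0 < `|L| + 1 by rewrite ltr_wpDl.
move=> gL x y; rewrite -mulrBr normrM gtr0_norm ?invr_gt0// mul1r.
rewrite mulrC ler_pdivrMr// (le_trans (gL x y))// mulrC ler_wpM2l//.
by rewrite (le_trans (ler_norm _))// lerDl.
Qed.

Lemma lipschitz_slope_ae (g : R -> R) (L : R) : lipschitz_map L g ->
  {ae leb, forall t, exists p, has_slope g t p}.
Proof.
move=> gL; have g1 := lipschitz_scale gL; set c := `|L| + 1 in g1.
have c0 : c != 0 by rewrite gt_eqF// ltr_wpDl.
have : forall k : nat, {ae leb, forall t, - k.+1%:R < t < k.+1%:R ->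
    exists p, has_slope g t p}.
  move=> k; have [|d [_ _ ds]] := @lipschitz1_slope_ae _ (- k.+1%:R) k.+1%:R g1.
    by rewrite gtrN.
  apply: (@filterS _ _ (ae_filter_ringOfSetsType leb) _ _ _ ds) => t h /h /(has_slopeZ c).
  rewrite (_ : (fun x => _) = g); first by move=> ?; eexists; eassumption.
  by apply/funext => x; rewrite mulrA divff// mul1r.
move=> /ae_foralln; apply: (@filterS _ _ (ae_filter_ringOfSetsType leb)) => t h.
apply: (h (Num.truncn `|t|)); rewrite -ltr_norml.
exact: truncnS_gt.
Qed.

Lemma lipschitz_growth (g : R -> R) (L K a b : R) : lipschitz_map L g -> a < b ->
  {ae leb, forall t, a < t < b -> forall p, has_slope g t p -> p <= K} ->
  g b - g a <= K * (b - a).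
Proof.
move=> gL ab gK; have g1 := lipschitz_scale gL; set c := `|L| + 1 in g1.
have c0 : 0 < c by rewrite ltr_wpDl.
have : c^-1 * g b - c^-1 * g a <= c^-1 * K * (b - a).
  apply: (lipschitz1_growth g1 ab).
  apply: (@filterS _ _ (ae_filter_ringOfSetsType leb) _ _ _ gK) => t h tab p /(has_slopeZ c).
  rewrite (_ : (fun x => _) = g); first by move=> /(h tab); rewrite ler_pdivlMl.
  by apply/funext => x; rewrite mulrA divff ?mul1r// gt_eqF.
by rewrite -mulrBr -mulrA ler_pM2l ?invr_gt0.
Qed.

End one_dimensional.

(** * Derivatives of maps on row vectors and their countable description *)

Lemma norm_mulmx_le (R : realType) (p m : nat) (h : 'rV[R]_p) (A : 'M[R]_(p, m)) :
  `|h *m A| <= p%:R * `|A| * `|h|.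
Proof.
apply: norm_row_le => [|i]; first by rewrite !mulr_ge0.
rewrite mxE (le_trans (ler_norm_sum _ _ _))//.
apply: (@le_trans _ _ (\sum_(j < p) `|A| * `|h|)).
  apply: ler_sum => j _; rewrite normrM mulrC ler_pM ?norm_coord_le//.
  rewrite [leRHS]/Num.norm /= mx_normrE; apply/bigmax_geP; right => /=.
  by exists (j, i).
by rewrite sumr_const card_ord -[leLHS]mulr_natl mulrA.
Qed.

Lemma lipschitz_mapW (R : realType) (V W : normedModType R) L (F : V -> W) :
  lipschitz_map L F -> lipschitz_map `|L| F.
Proof. by move=> FL x y; rewrite (le_trans (FL x y))// ler_wpM2r// ler_norm. Qed.

Lemma le_matrix_norm (R : realType) (p m : nat) (A : 'M[R]_(p, m)) (c : R) :
  (forall h : 'rV_p, `|h *m A| <= c * `|h|) -> forall i j, `|A i j| <= c.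
Proof.
move=> hA i j; have := hA (delta_mx 0 i); rewrite -rowE.
have -> : `|delta_mx 0 i : 'rV[R]_p| = 1.
  apply/eqP; rewrite eq_le; apply/andP; split.
    apply: norm_row_le => // k; rewrite mxE /=.
    by case: eqP => _; rewrite ?normr1 ?normr0.
  rewrite -{1}(normr1 R); have := norm_coord_le (delta_mx 0 i : 'rV[R]_p) i.
  by rewrite mxE !eqxx.
rewrite mulr1; apply: le_trans.
by have := norm_coord_le (row i A) j; rewrite mxE.
Qed.

(* Fréchet differentiability for [J = 1%:M], a directional derivative for a one-row [J]. *)
Definition fdiff (R : realType) (p n m : nat) (J : 'M[R]_(p, n))
    (F : 'rV[R]_n -> 'rV[R]_m) (x : 'rV[R]_n) (A : 'M[R]_(p, m)) :=
  forall e, 0 < e -> exists2 d, 0 < d & forall h : 'rV_p, `|h| < d ->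
    `|F (x + h *m J) - F x - h *m A| <= e * `|h|.

Notation frechet := (fdiff 1%:M).

Section approximate_derivatives.
Variables (R : realType) (p n m : nat) (J : 'M[R]_(p, n)) (F : 'rV[R]_n -> 'rV[R]_m).

(** Accuracy, radius and candidate derivative all range over countable sets, and each set is closed
    when [F] is continuous. Countable unions and intersections of them describe differentiability,
    which makes it a measurable property. *)
Definition approx_diff (j k : nat) (M : 'M[rat]_(p, m)) : set 'rV[R]_n :=
  [set x | forall h : 'rV_p, `|h| < k.+1%:R^-1 ->
    `|F (x + h *m J) - F x - h *m map_mx ratr M| <= j.+1%:R^-1 * `|h|].

Lemma continuous_increment (h : 'rV[R]_p) (c : 'rV[R]_m) : continuous F ->
  continuous (fun x : 'rV[R]_n => `|F (x + h *m J) - F x - c| : R).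
Proof.
move=> Fc x.
have c0 : y + h *m J @[y --> x] --> x + h *m J.
  have idx : y @[y --> x] --> x by exact: cvg_id.
  exact: cvgD idx (cvg_cst (h *m J)).
have c1 : F (y + h *m J) @[y --> x] --> F (x + h *m J) by exact: (cvg_comp _ _ c0 (Fc _)).
have c2 : F y @[y --> x] --> F x by exact: Fc.
exact: cvg_norm (cvgB (cvgB c1 c2) (cvg_cst c)).
Qed.

Lemma closed_approx_diff j k M : continuous F -> closed (approx_diff j k M).
Proof.
move=> Fc; rewrite (_ : approx_diff j k M =
  \bigcap_(h in [set h : 'rV[R]_p | `|h| < k.+1%:R^-1])
  [set x | `|F (x + h *m J) - F x - h *m map_mx ratr M| <= j.+1%:R^-1 * `|h|]).
  apply: closed_bigI => h _.
  have : closed ((fun x : 'rV[R]_n => `|F (x + h *m J) - F x - h *m map_mx ratr M| : R)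
    @^-1` [set y : R | y <= j.+1%:R^-1 * `|h|]); last by [].
  apply: preimage_closed; last exact: closed_le.
  by move=> x _; exact: continuous_increment.
by apply/seteqP; split => x /= hx h; exact: hx.
Qed.

Lemma rat_matrix_approx (A : 'M[R]_(p, m)) (e : R) : 0 < e ->
  exists M : 'M[rat]_(p, m), `|A - map_mx ratr M| <= e.
Proof.
move=> e0.
have h i j : exists q : rat, `|A i j - ratr q| <= e.
  have [|q] := @rat_in_itvoo R (A i j) (A i j + e); first by rewrite ltrDl.
  rewrite in_itv/= => /andP[qa qe]; exists q.
  by rewrite distrC ger0_norm ?subr_ge0 ?(ltW qa)// lerBlDl (ltW qe).
exists (\matrix_(i, j) xget 0 [set q : rat | `|A i j - ratr q| <= e]).
rewrite [leLHS]/Num.norm /= mx_normrE; apply/bigmax_leP; split; first exact: ltW.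
move=> [i j] _ /=; rewrite !mxE.
by case: xgetP => [q -> //|/(_ _)]; have [q hq] := h i j => /(_ q).
Qed.

Lemma fdiff_approx x A : fdiff J F x A -> forall j, exists k M, approx_diff j k M x.
Proof.
(* Half of the accuracy is spent on the derivative, half on its approximation by a rational
   matrix. *)
move=> FA j; pose e : R := (2 * j.+1%:R)^-1.
have e0 : 0 < e by rewrite invr_gt0 mulr_gt0.
have [|M hM] := @rat_matrix_approx A (e / p.+1%:R); first by rewrite divr_gt0.
have [d d0 dP] := FA _ e0.
exists (Num.truncn d^-1), M => h hd.
have {}hd : `|h| < d.
  apply: lt_trans hd _; rewrite invf_plt ?posrE//.
  exact: truncnS_gt.
have -> : j.+1%:R^-1 = e + e.
  by rewrite /e invfM; set a := _^-1; lra.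
rewrite (_ : _ - _ = (F (x + h *m J) - F x - h *m A) + h *m (A - map_mx ratr M)); last first.
  by rewrite mulmxBr addrA subrK.
rewrite mulrDl (le_trans (ler_normD _ _))// lerD ?dP//.
rewrite (le_trans (norm_mulmx_le _ _))// ler_wpM2r//.
have := ler_wpM2l (ler0n R p) hM => /le_trans; apply.
rewrite mulrCA ler_piMr ?(ltW e0)// ler_pdivrMr// mul1r ler_nat.
exact: leqnSn.
Qed.

(** The matrices for increasing accuracy form a Cauchy sequence, since two of them are compared
    through the same increment of [F]; the limit is the derivative. *)
Lemma approx_fdiff x : (forall j, exists k M, approx_diff j k M x) ->
  exists A, fdiff J F x A.
Proof.
move=> /(_ _)/cid-/all_sig[k] /(_ _)/cid-/all_sig[M] kM.
pose B j : 'M[R]_(p, m) := map_mx ratr (M j).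
have BB i j (h : 'rV_p) : `|h *m (B i - B j)| <= (i.+1%:R^-1 + j.+1%:R^-1) * `|h|.
  have [->|h0] := eqVneq h 0; first by rewrite mul0mx !normr0 mulr0.
  (* By homogeneity it suffices to compare the two matrices on a multiple of [h] lying within both
     radii. *)
  pose c := Num.min (k i).+1%:R^-1 (k j).+1%:R^-1 / (2 * `|h|).
  have c0 : 0 < c by rewrite divr_gt0// ?mulr_gt0 ?normr_gt0// lt_min !invr_gt0 !ltr0Sn.
  have ch : `|c *: h| < Num.min (k i).+1%:R^-1 (k j).+1%:R^-1.
    rewrite normrZ gtr0_norm// /c invfM mulrA mulfVK ?normr_eq0//.
    by rewrite gtr_pMr ?invf_lt1 ?ltr1n// lt_min !invr_gt0 !ltr0Sn.
  move: ch; rewrite lt_min => /andP[hi hj].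
  have := ler_normB (F (x + (c *: h) *m J) - F x - (c *: h) *m B j)
                    (F (x + (c *: h) *m J) - F x - (c *: h) *m B i).
  rewrite opprB [X in `|X|]addrC addrA subrK -mulmxBr.
  rewrite -[(c *: h) *m (B i - B j)]scalemxAl [in leLHS]normrZ gtr0_norm// => hB.
  rewrite -(ler_pM2l c0); apply: le_trans hB _.
  have := lerD (kM j _ hj) (kM i _ hi); rewrite -/(B i) -/(B j) normrZ gtr0_norm//.
  by move=> /le_trans; apply; rewrite le_eqVlt; apply/orP; left; apply/eqP; ring.
have Bij i j a b : `|B i a b - B j a b| <= i.+1%:R^-1 + j.+1%:R^-1.
  by have := le_matrix_norm (BB i j) a b; rewrite !mxE.
have Bcvg a b : cvg (B j a b @[j --> \oo]).
  apply/cauchy_cvgP/cauchy_ballP => e e0; near_simpl.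
  have e20 : 0 < e / 2 by rewrite divr_gt0.
  have S := near_infty_natSinv_lt (PosNum e20).
  exists ([set i | i.+1%:R^-1 < e / 2], [set i | i.+1%:R^-1 < e / 2]) => //.
  move=> [i j] /= [ie je]; rewrite -ball_normE /=.
  by apply: le_lt_trans (Bij i j a b) _; rewrite (splitr e) ltrD.
exists (\matrix_(a, b) lim (B j a b @[j --> \oo])); set A := (X in fdiff _ _ _ X).
have AB j a b : `|B j a b - A a b| <= j.+1%:R^-1.
  rewrite (_ : A a b = lim (B j a b @[j --> \oo])); last by rewrite mxE.
  have h : `|B j a b - B i a b| - i.+1%:R^-1 @[i --> \oo] -->
      `|B j a b - lim (B j a b @[j --> \oo])| - 0.
    apply: cvgB; last exact: cvg_harmonic.
    by apply: cvg_norm; apply: cvgB; [exact: cvg_cst|exact: Bcvg].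
  have := @cvg_near_le R _ _ j.+1%:R^-1 h; rewrite subr0; apply; apply: nearW => i.
  by rewrite lerBlDr; exact: Bij.
move=> e e0.
have c0 : 0 < e / (p.+1%:R + 1) by rewrite divr_gt0// ltr_wpDl.
have [j _ jP] := near_infty_natSinv_lt (PosNum c0).
have {}jP : j.+1%:R^-1 < e / (p.+1%:R + 1) by exact: jP (leqnn j).
exists (k j).+1%:R^-1; first by rewrite invr_gt0.
move=> h hk; have := kM j h hk; rewrite -/(B j) => hB.
rewrite (_ : _ - _ = (F (x + h *m J) - F x - h *m B j) + h *m (B j - A)); last first.
  by rewrite mulmxBr addrA subrK.
rewrite (le_trans (ler_normD _ _))// (le_trans (lerD hB (norm_mulmx_le _ _)))//.
rewrite -mulrDl ler_wpM2r//.
have BA : `|B j - A| <= j.+1%:R^-1.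
  rewrite [leLHS]/Num.norm /= mx_normrE; apply/bigmax_leP; split.
    by rewrite invr_ge0.
  by move=> [a b] _ /=; rewrite [X in `|X|]mxE [X in _ + X]mxE; exact: AB.
rewrite (le_trans (lerD (lexx _) (ler_wpM2l (ler0n R p) BA)))//.
rewrite -{1}(mul1r j.+1%:R^-1) -mulrDl (le_trans (ler_wpM2l _ (ltW jP)))// ?addr_ge0//.
rewrite mulrCA ler_piMr ?(ltW e0)// ler_pdivrMr ?ltr_wpDl// mul1r addrC lerD2r.
by rewrite ler_nat.
Qed.

Lemma fdiffP x : (exists A, fdiff J F x A) <->
  forall j, exists k M, approx_diff j k M x.
Proof.
by split=> [[A FA]|]; [exact: fdiff_approx FA|exact: approx_fdiff].
Qed.

End approximate_derivatives.

Section distance.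
Variables (R : realType) (V : normedModType R).
Implicit Types (E : set V) (x y : V).

(* The distance to the empty set is 0, by the convention on [inf]. *)
Definition set_dist E x : R := inf [set `|x - y| | y in E].

Let has_lbound_dist E x : has_lbound [set `|x - y| | y in E].
Proof. by exists 0 => _ [y _ <-]. Qed.

Lemma set_dist_ge0 E x : 0 <= set_dist E x.
Proof.
have [->|/set0P[y Ey]] := eqVneq E set0; first by rewrite /set_dist image_set0 inf0.
by apply: lb_le_inf => [|_ [z _ <-]//]; exists `|x - y|, y.
Qed.

Lemma set_dist_le E x y : E y -> set_dist E x <= `|x - y|.
Proof. by move=> Ey; apply: (ge_inf (has_lbound_dist E x)); exists y. Qed.

Lemma set_dist0 E x : E x -> set_dist E x = 0.
Proof.
move=> Ex; apply/eqP; rewrite eq_le set_dist_ge0 andbT.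
by rewrite (le_trans (set_dist_le x Ex))// subrr normr0.
Qed.

Lemma set_dist_lt E x y r : E y -> set_dist E x < r ->
  exists2 z, E z & `|x - z| < r.
Proof.
move=> Ey /inf_lt[|_ [z Ez <-] zr]; last by exists z.
by exists `|x - y|, y.
Qed.

Lemma set_dist_lipschitz E x y : `|set_dist E x - set_dist E y| <= `|x - y|.
Proof.
have [->|/set0P[z Ez]] := eqVneq E set0.
  by rewrite /set_dist !image_set0 inf0 subrr normr0.
wlog: x y / set_dist E y <= set_dist E x.
  by move=> h; have [/h//|/ltW/h] := leP (set_dist E y) (set_dist E x);
    rewrite distrC (distrC y).
move=> yx; rewrite ger0_norm ?subr_ge0//.
rewrite lerBlDr -lerBlDl; apply: lb_le_inf; first by exists `|y - z|, z.
move=> _ [w Ew <-]; rewrite lerBlDl (le_trans (set_dist_le x Ew))//.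
by rewrite (le_trans _ (ler_normD _ _))// addrA subrK.
Qed.

End distance.

Section row_mx_norm.
Variable R : realType.

Lemma norm_row_mx_le p n (a : 'rV[R]_p) (b : 'rV[R]_n) c :
  `|a| <= c -> `|b| <= c -> `|row_mx a b| <= c.
Proof.
move=> ac bc; apply: norm_row_le; first exact: le_trans ac.
move=> i; case: (split_ordP i) => j ->; rewrite ?row_mxEl ?row_mxEr.
  exact: le_trans (norm_coord_le _ _) ac.
exact: le_trans (norm_coord_le _ _) bc.
Qed.

Lemma norm_row_mxl p n (a : 'rV[R]_p) (b : 'rV[R]_n) : `|a| <= `|row_mx a b|.
Proof.
apply: norm_row_le => [|i]; first exact: normr_ge0.
have := norm_coord_le (row_mx a b) (lshift n i).
by rewrite row_mxEl.
Qed.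

Lemma norm_row_mxr p n (a : 'rV[R]_p) (b : 'rV[R]_n) : `|b| <= `|row_mx a b|.
Proof.
apply: norm_row_le => [|i]; first exact: normr_ge0.
have := norm_coord_le (row_mx a b) (rshift p i).
by rewrite row_mxEr.
Qed.

Lemma norm_scalar1 (t : R) : `|t%:M : 'rV[R]_1| = `|t|.
Proof.
apply/eqP; rewrite eq_le norm_row_le//=; last first.
  by move=> i; rewrite ord1 mxE eqxx mulr1n.
by have := norm_coord_le (t%:M : 'rV[R]_1) 0; rewrite mxE eqxx mulr1n.
Qed.

End row_mx_norm.

(** * Null sets in product spaces *)

Section tonelli_null_sets.
Variables (R : realType) (d1 d2 : measure_display) (T1 : measurableType d1).
Variables (T2 : measurableType d2) (m1 : {sigma_finite_measure set T1 -> \bar R}).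
Variables (m2 : {sigma_finite_measure set T2 -> \bar R}).
Local Open Scope ereal_scope.

Lemma product_null_xsection (N : set (T1 * T2)) : measurable N ->
  (forall x, m2.-negligible [set y | N (x, y)]) -> (m1 \x m2).-negligible N.
Proof.
move=> mN N0; apply/negligibleP => //; rewrite /product_measure1/=.
apply: integral0_eq => x _ /=; apply/negligibleP; first exact: measurable_xsection.
by apply: negligibleS (N0 x) => y; rewrite /xsection /= inE.
Qed.

Lemma product_measure12 (N : set (T1 * T2)) : measurable N ->
  (m1 \x m2) N = \int[m2]_y m1 (ysection N y).
Proof.
move=> mN.
by rewrite (product_measure_unique (m' := m1 \x^ m2))// => A B mA mB;
  exact: product_measure2E.
Qed.

Lemma product_null_ysection (N : set (T1 * T2)) : measurable N ->
  (forall y, m1.-negligible [set x | N (x, y)]) -> (m1 \x m2).-negligible N.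
Proof.
move=> mN N0; apply/negligibleP => //; rewrite [LHS](product_measure12 mN).
apply: integral0_eq => y _ /=; apply/negligibleP; first exact: measurable_ysection.
by apply: negligibleS (N0 y) => x; rewrite /ysection /= inE.
Qed.

(** The measure of the sections is a nonnegative function with zero integral, hence zero almost
    everywhere. *)
Lemma product_null_ae_ysection (N : set (T1 * T2)) : (m1 \x m2).-negligible N ->
  {ae m2, forall y, m1.-negligible [set x | N (x, y)]}.
Proof.
move=> [M [mM M0 NM]].
have mf := measurable_fun_ysection m1 mM.
have : ae_eq m2 [set: T2] (m1 \o ysection M) (cst 0).
  apply/(ae_eq_integral_abs m2 measurableT mf).
  rewrite -[RHS]M0 [RHS](product_measure12 mM).
  by apply: eq_integral => y _ /=; rewrite gee0_abs.
apply: (@filterS _ _ (ae_filter_ringOfSetsType m2)) => y /(_ I) /= My.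
apply: (@negligibleS _ _ _ _ (ysection M y)).
  by move=> x /NM; rewrite /ysection /= inE.
by apply/negligibleP => //; exact: measurable_ysection.
Qed.

End tonelli_null_sets.

(** * Rademacher's theorem by induction on the dimension *)

Section rademacher_step.
Variables (R : realType) (n : nat).

Definition dir1 : 'M[R]_(1, 1 + n) := row_mx 1%:M 0.
Definition dir2 : 'M[R]_(n, 1 + n) := row_mx 0 1%:M.

Lemma add_dir1 (a h : 'rV[R]_1) (y : 'rV[R]_n) :
  row_mx a y + h *m dir1 = row_mx (a + h) y.
Proof. by rewrite /dir1 mul_mx_row mulmx1 mulmx0 add_row_mx addr0. Qed.

Lemma add_dir2 (a : 'rV[R]_1) (h y : 'rV[R]_n) :
  row_mx a y + h *m dir2 = row_mx a (y + h).
Proof. by rewrite /dir2 mul_mx_row mulmx1 mulmx0 add_row_mx addr0. Qed.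

Section partial_derivatives.
Variables (m : nat) (F : 'rV[R]_(1 + n) -> 'rV[R]_m) (L : R).
Hypothesis FL : lipschitz_map L F.

Lemma lipschitz_coord1 (y : 'rV[R]_n) (i : 'I_m) :
  lipschitz_map `|L| (fun t : R => F (row_mx t%:M y) 0 i).
Proof.
move=> t u; have := norm_coord_le (F (row_mx t%:M y) - F (row_mx u%:M y)) i.
rewrite !mxE => /le_trans; apply.
rewrite (le_trans (lipschitz_mapW FL _ _))// ler_wpM2l//.
rewrite opp_row_mx add_row_mx subrr -raddfB.
by apply: norm_row_mx_le; rewrite ?norm_scalar1// normr0.
Qed.

Lemma lipschitz_coord2 (a : 'rV[R]_1) :
  lipschitz_map `|L| (fun y : 'rV[R]_n => F (row_mx a y)).
Proof.
move=> y z; rewrite (le_trans (lipschitz_mapW FL _ _))// ler_wpM2l//.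
rewrite opp_row_mx add_row_mx subrr.
by apply: norm_row_mx_le; rewrite ?normr0.
Qed.

Lemma slope_fdiff (y : 'rV[R]_n) (t : R) (p : 'rV[R]_m) :
  (forall i, has_slope (fun t => F (row_mx t%:M y) 0 i) t (p 0 i)) ->
  fdiff dir1 F (row_mx t%:M y) p.
Proof.
move=> Fp e e0.
have /filter_forall : forall i, \forall tau \near (0 : R),
    `|F (row_mx (t + tau)%:M y) 0 i - F (row_mx t%:M y) 0 i - tau * p 0 i|
      <= e * `|tau|.
  move=> i; have [d d0 dP] := Fp i e e0.
  apply/nbhs_ballP; exists d => //= tau; rewrite -ball_normE /= sub0r normrN.
  exact: dP.
move=> /nbhs_ballP[d /= d0 dP]; exists d => // h.
rewrite [h]mx11_scalar norm_scalar1 => hd; rewrite add_dir1 -raddfD.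
apply: norm_row_le => [|i]; first by rewrite mulr_ge0 ?(ltW e0).
have := dP (h 0 0); rewrite -ball_normE /= sub0r normrN => /(_ hd i).
by rewrite !mxE big_ord1 !mxE mulr1n.
Qed.

Lemma fdiff2_frechet (a : 'rV[R]_1) (y : 'rV[R]_n) A :
  frechet (fun y => F (row_mx a y)) y A <-> fdiff dir2 F (row_mx a y) A.
Proof.
by split=> h e /h[d d0 dP]; exists d => // k /dP; rewrite add_dir2 mulmx1.
Qed.

End partial_derivatives.

Section model.
Variables (d : measure_display) (T : measurableType d).
Variables (mu : {sigma_finite_measure set T -> \bar R}) (phi : T -> 'rV[R]_n).
Local Notation leb := (@lebesgue_measure R).

Definition extend_param (z : measurableTypeR R * T) : 'rV[R]_(1 + n) :=
  row_mx (z.1 : R)%:M (phi z.2).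

Hypothesis mphi : forall O : set 'rV[R]_n, open O -> measurable (phi @^-1` O).

Lemma open_box (O : set 'rV[R]_(1 + n)) (t : R) (y : 'rV[R]_n) : open O ->
  O (row_mx t%:M y) -> exists2 r : R, 0 < r & forall s z, `|s - t| < r -> `|z - y| < r ->
  O (row_mx s%:M z).
Proof.
rewrite openE => /[apply] /nbhs_ballP[r /= r0 rO]; exists (r / 2); first by rewrite divr_gt0.
move=> s z st zy; apply: rO; rewrite -ball_normE /= distrC.
rewrite opp_row_mx add_row_mx -raddfB; apply: (@le_lt_trans _ _ (r / 2)).
  by apply: norm_row_mx_le; rewrite ?norm_scalar1 ltW.
by rewrite ltr_pdivrMr// ltr_pMr// ltr1n.
Qed.

(** An open set is a countable union of boxes with rational first side. [W p q] asks for a whole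
    ball around [y] over which the strip []p, q[] stays in [O]; this uniformity makes it open, so
    that [mphi] applies. *)
Lemma measurable_extend_param O : open O -> measurable (extend_param @^-1` O).
Proof.
move=> oO.
pose W (p q : rat) := [set y : 'rV[R]_n | exists2 r, 0 < r & forall z (t : R),
   `|z - y| < r -> ratr p < t < ratr q -> O (row_mx t%:M z)].
have oW p q : open (W p q).
  rewrite openE => y [r r0 rW]; apply/nbhs_ballP; exists (r / 2) => /=.
    by rewrite divr_gt0.
  move=> z; rewrite -ball_normE /= => yz; exists (r / 2); first by rewrite divr_gt0.
  move=> w t wz; apply: rW; rewrite (splitr r) -(subrK z w) -addrA.
  by rewrite (le_lt_trans (ler_normD _ _))// ltrD// distrC.
rewrite (_ : _ @^-1` _ = \bigcup_p \bigcup_q (`]ratr p, ratr q[%classic `*`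
    phi @^-1` W p q)).
  apply: bigcupT_measurable_rat => p; apply: bigcupT_measurable_rat => q.
  by apply: measurableX; [exact: measurable_itv|exact: mphi].
apply/seteqP; split => [[t y] /= Oty|[t y] /= [p _ [q _ [/=]]]].
  have [r r0 rO] := open_box oO Oty.
  have [|p] := @rat_in_itvoo R (t - r) t; first by rewrite gtrBl.
  rewrite in_itv/= => /andP[pr pt].
  have [|q] := @rat_in_itvoo R t (t + r); first by rewrite ltrDl.
  rewrite in_itv/= => /andP[qt qr].
  exists p => //; exists q => //; split => /=; first by rewrite in_itv/= pt qt.
  exists r => // z s zy /andP[ps sq]; apply: rO => //.
  rewrite ltr_norml; apply/andP; split.
    by rewrite ltrBrDl; exact: lt_trans pr ps.
  by rewrite ltrBlDl; exact: lt_trans sq qr.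
rewrite in_itv/= => tpq [r r0 rW]; apply: rW => //.
by rewrite subrr normr0.
Qed.

Lemma extend_param_open_gt0 :
  (forall O : set 'rV[R]_n, open O -> O !=set0 -> (0 < mu (phi @^-1` O))%E) ->
  forall O : set 'rV[R]_(1 + n), open O -> O !=set0 ->
  (0 < (leb \x mu)%E (extend_param @^-1` O))%E.
Proof.
move=> mu0 O oO [x Ox].
have [t [y xE]] : exists t : R, exists y : 'rV[R]_n, x = row_mx t%:M y.
  exists (lsubmx x 0 0), (rsubmx x); rewrite -mx11_scalar; exact/esym/hsubmxK.
rewrite xE in Ox; have [r r0 rO] := open_box oO Ox.
have oB : open (ball y r) by exact: ball_open.
pose I : set (measurableTypeR R) := `]t - r, t + r[%classic.
have lI : (0 < leb I)%E.
  rewrite /I lebesgue_measure_itv/= lte_fin ifT; last lra.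
  by rewrite -EFinB lte_fin; lra.
have mI : measurable I by exact: measurable_itv.
apply: (@lt_le_trans _ _ ((leb \x mu)%E (I `*` phi @^-1` ball y r))).
  rewrite product_measure1E//; last exact: mphi.
  apply: mule_gt0; first exact: lI.
  apply: mu0 => //; exists y; exact: ballxx.
apply: le_measure; rewrite ?inE.
- by apply: measurableX => //; exact: mphi.
- exact: measurable_extend_param.
move=> [s u] /= []; rewrite /I /= in_itv/= -ball_normE /= => /andP[s1 s2] yu.
apply: rO; last by rewrite distrC.
rewrite ltr_norml; apply/andP; split.
  by rewrite ltrBrDl; exact: s1.
by rewrite ltrBlDl; exact: s2.
Qed.

Lemma measurable_nfdiff p m (J : 'M[R]_(p, 1 + n)) (F : 'rV[R]_(1 + n) -> 'rV[R]_m) :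
  continuous F ->
  measurable [set z | ~ exists A, fdiff J F (extend_param z) A].
Proof.
move=> Fc.
(* The rational matrix is enumerated through its code [i]. A code of no matrix contributes the
   complement of [set0], which is harmless in an intersection. *)
rewrite (_ : mkset _ = \bigcup_j \bigcap_k \bigcap_i
    (extend_param @^-1` ~` (if unpickle i is Some M then approx_diff J F j k M else set0))).
  apply: bigcupT_measurable => j; apply: bigcapT_measurable => k.
  apply: bigcapT_measurable => i; apply: measurable_extend_param.
  apply: closed_openC; case: unpickle => [M|]; last exact: closed0.
  exact: closed_approx_diff.
apply/seteqP; split => z /=.
  move=> nA; apply: contrapT => nB; apply: nA; apply/fdiffP => j.
  apply: contrapT => nk; apply: nB; exists j => // k _ i _ /=.
  case: unpickle => [M|//] zM; by apply: nk; exists k, M.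
move=> [j _ jP] /fdiffP/(_ j)[k [M kM]].
by have := jP k I (pickle M) I; rewrite /= pickleK.
Qed.

(** On each line parallel to the first axis the one-dimensional theorem holds in every coordinate of
    [F]. The exceptional set is measurable, so its null sections make it null. *)
Lemma partial1_ae m (F : 'rV[R]_(1 + n) -> 'rV[R]_m) L : lipschitz_map L F ->
  {ae (leb \x mu)%E, forall z, exists A, fdiff dir1 F (extend_param z) A}.
Proof.
move=> FL; apply: product_null_ysection.
  by apply: measurable_nfdiff; exact: lipschitz_map_continuous FL.
move=> y.
have aei i := lipschitz_slope_ae (lipschitz_coord1 FL (phi y) i).
have := @filter_forall _ _ _ _ (ae_filter_ringOfSetsType leb) aei.
apply: (@filterS _ _ (ae_filter_ringOfSetsType leb)) => t tP.
have /(_ _)/cid-/all_sig[p pP] := tP.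
exists (\row_i p i); apply: slope_fdiff => i; rewrite mxE; exact: pP.
Qed.

Hypothesis dphi : forall m (F : 'rV[R]_n -> 'rV[R]_m) L, lipschitz_map L F ->
  {ae mu, forall y, exists A, frechet F (phi y) A}.

(** With the first coordinate frozen, [dphi] (the induction hypothesis) applies to each slice. *)
Lemma partial2_ae m (F : 'rV[R]_(1 + n) -> 'rV[R]_m) L : lipschitz_map L F ->
  {ae (leb \x mu)%E, forall z, exists A, fdiff dir2 F (extend_param z) A}.
Proof.
move=> FL; apply: product_null_xsection.
  by apply: measurable_nfdiff; exact: lipschitz_map_continuous FL.
move=> t; have := dphi (lipschitz_coord2 FL (t : R)%:M).
apply: (@filterS _ _ (ae_filter_ringOfSetsType mu)) => y [A] /fdiff2_frechet yA.
by exists A.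
Qed.

End model.
End rademacher_step.

Section frechet_of_partials.
Variables (R : realType) (n m : nat) (F : 'rV[R]_(1 + n) -> 'rV[R]_m) (L : R).
Hypothesis FL : lipschitz_map L F.

(** The distance as a vector-valued map, so that [partial1_ae] applies to it. *)
Definition dist_row (E : set 'rV[R]_(1 + n)) (x : 'rV[R]_(1 + n)) : 'rV[R]_1 :=
  (set_dist E x)%:M.

Lemma lipschitz_dist_row E : lipschitz_map 1 (dist_row E).
Proof.
by move=> x y; rewrite /dist_row -raddfB norm_scalar1 mul1r set_dist_lipschitz.
Qed.

(* A nonnegative function vanishing at a point has zero slope there. *)
Lemma dist_row_slope E x c : E x -> fdiff (dir1 R n) (dist_row E) x c ->
  forall e, 0 < e -> exists2 d, 0 < d & forall h : 'rV_1, `|h| < d ->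
    set_dist E (x + h *m dir1 R n) <= e * `|h|.
Proof.
move=> Ex Ec e e0; have [|d d0 dP] := Ec (e / 2); first by rewrite divr_gt0.
have key (h : 'rV_1) : `|h| < d ->
    `|set_dist E (x + h *m dir1 R n) - (h *m c) 0 0| <= e / 2 * `|h|.
  move=> /dP; apply: le_trans.
  apply: le_trans (norm_coord_le _ 0); rewrite /dist_row (set_dist0 Ex).
  by rewrite [X in _ <= `|X|]mxE [X in _ <= `|X + _|]mxE !mxE eqxx !mulr1n subr0.
have negE (h : 'rV_1) : ((- h) *m c) 0 0 = - (h *m c) 0 0 by rewrite mulNmx mxE.
exists d => // h hd; have := key _ hd; have := key (- h).
rewrite normrN negE opprK => /(_ hd).
have := set_dist_ge0 E (x + (- h) *m dir1 R n).
rewrite !ler_norml => a0 /andP[_ h1] /andP[_ h2]; lra.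
Qed.

Lemma norm_sum5_le (u1 u2 u3 u4 a b c : 'rV[R]_m) (t1 t2 t3 t4 t5 : R) :
  `|u1 - u2| <= t1 -> `|u2 - u3 - c| <= t2 -> `|u3 - u4| <= t3 ->
  `|u4 - a| <= t4 -> `|c - b| <= t5 ->
  `|u1 - (a + b)| <= t1 + t2 + t3 + t4 + t5.
Proof.
move=> h1 h2 h3 h4 h5.
rewrite (_ : _ - _ = (u1 - u2) + (u2 - u3 - c) + (u3 - u4) + (u4 - a) + (c - b)).
  do 4 (rewrite (le_trans (ler_normD _ _))// lerD//).
by apply/rowP => i; rewrite !mxE; ring.
Qed.

(** The partial derivative [B] at [x] does not control increments in the second block at the shifted
    point [y]. Since the distance to the set [E] of well-approximated points has slope zero at [x],
    some [x'] of [E] lies within [o(|a|)] of [y]. At [x'] the same matrix [M] and the same radius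
    serve as at [x], and Lipschitz continuity carries the estimate back to [y]. *)
Lemma frechet_of_partials x A B :
  fdiff (dir1 R n) F x A -> fdiff (dir2 R n) F x B ->
  (forall j k M, exists c, fdiff (dir1 R n) (dist_row (approx_diff (dir2 R n) F j k M)) x c) ->
  frechet F x (col_mx A B).
Proof.
move=> FA FB dd e e0.
pose L' := `|L|; have L'0 : 0 <= L' by exact: normr_ge0.
(* The five errors below add up to [4 * (L' + 1) * e'] times the norm of [h]. *)
pose e' := e / (4 * (L' + 1)).
have e'0 : 0 < e' by rewrite divr_gt0// mulr_gt0// ltr_wpDl.
have [j _ /(_ j (leqnn j)) /= je] := near_infty_natSinv_lt (PosNum e'0).
have [k [M xM]] := fdiff_approx FB j.
pose E := approx_diff (dir2 R n) F j k M.
have [c xc] := dd j k M.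
have [d1 d10 d1P] := dist_row_slope xM xc e'0.
have [d2 d20 d2P] := FA e' e'0.
have [d3 d30 d3P] := FB e' e'0.
exists (Num.min (Num.min d1 d2) (Num.min d3 k.+1%:R^-1)).
  by rewrite !lt_min d10 d20 d30 invr_gt0 ltr0Sn.
move=> h; rewrite mulmx1 -[h]hsubmxK.
set a := lsubmx h; set b := rsubmx h.
rewrite !lt_min => /andP[/andP[hd1 hd2] /andP[hd3 hk]].
have aN := norm_row_mxl a b; have bN := norm_row_mxr a b.
rewrite mul_row_col.
set N := `|row_mx a b| in hd1 hd2 hd3 hk aN bN *.
have -> : x + row_mx a b = x + a *m dir1 R n + b *m dir2 R n.
  by rewrite -addrA !mul_mx_row !mulmx1 !mulmx0 add_row_mx addr0 add0r.
pose y := x + a *m dir1 R n; rewrite -/y.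
(* The infimum is approached only up to a factor, hence the 2; for [a = 0] there is no such room,
   and [x] itself is taken. *)
have [x' Ex' yx'] : exists2 x', E x' & `|y - x'| <= 2 * e' * `|a|.
  have [a0|a0] := eqVneq a 0.
    by exists x => //; rewrite /y a0 mul0mx addr0 subrr !normr0 mulr0.
  have a0' : 0 < `|a| by rewrite normr_gt0.
  have := d1P a (le_lt_trans aN hd1); rewrite -/y -/E => yE.
  have [|z Ez yz] := @set_dist_lt _ _ E y x (2 * e' * `|a|) xM.
    by apply: le_lt_trans yE _; rewrite ltr_pM2r// ltr_pMl// ltr1n.
  by exists z => //; exact: ltW.
have bk := le_lt_trans bN hk.
have t1 : `|F (y + b *m dir2 R n) - F (x' + b *m dir2 R n)| <= L' * (2 * e' * `|a|).
  rewrite (le_trans (lipschitz_mapW FL _ _))// ler_wpM2l//.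
  by rewrite opprD addrACA subrr addr0.
have t2 : `|F (x' + b *m dir2 R n) - F x' - b *m map_mx ratr M| <= e' * `|b|.
  by rewrite (le_trans (Ex' b bk))// ler_wpM2r// ltW.
have t3 : `|F x' - F y| <= L' * (2 * e' * `|a|).
  by rewrite distrC (le_trans (lipschitz_mapW FL _ _))// ler_wpM2l.
have t4 : `|F y - F x - a *m A| <= e' * `|a| := d2P a (le_lt_trans aN hd2).
have t5 : `|b *m map_mx ratr M - b *m B| <= 2 * e' * `|b|.
  have h1 := d3P b (le_lt_trans bN hd3).
  have h2 : `|F (x + b *m dir2 R n) - F x - b *m map_mx ratr M| <= e' * `|b|.
    by rewrite (le_trans (xM b bk))// ler_wpM2r// ltW.
  rewrite (_ : _ - _ = (F (x + b *m dir2 R n) - F x - b *m B) -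
    (F (x + b *m dir2 R n) - F x - b *m map_mx ratr M)).
    rewrite (le_trans (ler_normB _ _))// -mulrA mulr_natl mulr2n.
    exact: lerD.
  by rewrite opprB [RHS]addrC addrA subrK.
have := @norm_sum5_le (F (y + b *m dir2 R n) - F x) (F (x' + b *m dir2 R n) - F x)
  (F x' - F x) (F y - F x) (a *m A) (b *m B) (b *m map_mx ratr M) _ _ _ _ _ .
have sub2 (u v w : 'rV[R]_m) : u - w - (v - w) = u - v.
  by rewrite opprB addrA subrK.
rewrite !sub2 => /(_ _ _ _ _ _ t1 t2 t3 t4 t5) /le_trans; apply.
have -> : e * N = L' * (2 * e' * N) + e' * N + L' * (2 * e' * N) + e' * N + 2 * e' * N.
  have l1 : L' + 1 != 0 by rewrite gt_eqF// ltr_wpDl.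
  by rewrite /e'; field.
have e'W := ltW e'0.
have q1 : L' * (2 * e' * `|a|) <= L' * (2 * e' * N).
  by apply: ler_wpM2l => //; apply: ler_wpM2l => //; exact: mulr_ge0.
have q2 : e' * `|a| <= e' * N by exact: ler_wpM2l.
have q3 : e' * `|b| <= e' * N by exact: ler_wpM2l.
have q4 : 2 * e' * `|b| <= 2 * e' * N by apply: ler_wpM2l => //; exact: mulr_ge0.
exact: lerD (lerD (lerD (lerD q1 q3) q1) q2) q4.
Qed.

End frechet_of_partials.

(* The canonical structure on [m1 \x m2] in the library only covers
   subprobabilities. *)
Lemma product_sigma_finite_measure (R : realType) d1 d2 (T1 : measurableType d1)
    (T2 : measurableType d2) (m1 : {sigma_finite_measure set T1 -> \bar R})
    (m2 : {sigma_finite_measure set T2 -> \bar R}) :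
  exists mm : {sigma_finite_measure set (T1 * T2)%type -> \bar R},
    mm = (m1 \x m2)%E :> (set (T1 * T2) -> \bar R).
Proof.
have sf : sigma_finite setT (m1 \x m2)%E.
  have /sigma_finiteP[A [AT Ai Afin]] := sigma_finiteT m1.
  have /sigma_finiteP[B [BT Bi Bfin]] := sigma_finiteT m2.
  exists (fun k => A k `*` B k).
    apply/seteqP; split => // -[x y] _.
    have [i _ Aix] : (\bigcup_k A k) x by rewrite -AT.
    have [j _ Bjy] : (\bigcup_k B k) y by rewrite -BT.
    exists (maxn i j) => //; split => /=.
      by move: x Aix; apply/subsetPset/Ai/leq_maxl.
    by move: y Bjy; apply/subsetPset/Bi/leq_maxr.
  move=> k; have [mA Ak] := Afin k; have [mB Bk] := Bfin k.
  split; first exact: measurableX.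
  by rewrite product_measure1E// lte_mul_pinfty// ge0_fin_numE.
pose mix := Measure_isSigmaFinite.Build _ _ R (m1 \x m2)%E sf.
pose mm : {sigma_finite_measure set (T1 * T2)%type -> \bar R} :=
  HB.pack (m1 \x m2)%E (Measure.on (m1 \x m2)%E) mix.
by exists mm.
Qed.

Section rademacher.
Variable R : realType.
Local Notation leb := (@lebesgue_measure R).

(* A measure space parametrizing ['rV_n]; it is an iterated product of copies of
   the real line. *)
Definition rademacher_space (n : nat) (d : measure_display) (T : measurableType d)
    (mu : set T -> \bar R) (phi : T -> 'rV[R]_n) :=
  [/\ forall O : set 'rV[R]_n, open O -> measurable (phi @^-1` O),
      forall O : set 'rV[R]_n, open O -> O !=set0 -> (0 < mu (phi @^-1` O))%E &
      forall m (F : 'rV[R]_n -> 'rV[R]_m) L, lipschitz_map L F ->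
        {ae mu, forall y, exists A, frechet F (phi y) A}].

Lemma rademacher_extend n d (T : measurableType d)
    (mu : {sigma_finite_measure set T -> \bar R}) (phi : T -> 'rV[R]_n) :
  rademacher_space mu phi ->
  rademacher_space (leb \x mu)%E
    (extend_param phi).
Proof.
move=> [mphi pphi dphi]; split.
- by move=> O oO; exact: measurable_extend_param.
- by move=> O oO O0; exact: extend_param_open_gt0.
move=> m F L FL.
pose FF := ae_filter_ringOfSetsType (leb \x mu)%E.
have h1 := @partial1_ae R n d T mu phi mphi m F L FL.
have h2 := @partial2_ae R n d T mu phi mphi dphi m F L FL.
(* One null set serves the distance functions for all [j], [k] and [M], because these are countably
   many. *)
have h3 : {ae (leb \x mu)%E, forall z, forall j k i : nat,
    if unpickle i is Some M then exists c, fdiff (dir1 R n)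
      (dist_row (approx_diff (dir2 R n) F j k M)) (extend_param phi z) c else True}.
  apply: ae_foralln => j; apply: ae_foralln => k; apply: ae_foralln => i.
  case: unpickle => [M|]; last exact: aeW.
  exact: partial1_ae mphi _ _ _ (lipschitz_dist_row _).
apply: (@filterS3 _ _ FF _ _ _ _ _ h1 h2 h3) => z [A zA] [B zB] zE.
exists (col_mx A B); apply: (frechet_of_partials FL) => // j k M.
by have := zE j k (pickle M); rewrite pickleK.
Qed.

Lemma rademacher_space0 :
  rademacher_space (@dirac _ unit tt R)
    (fun=> 0 : 'rV[R]_0).
Proof.
split => //.
- move=> O _ [x Ox]; rewrite /= /dirac/= indicE mem_set ?lte_fin//=.
  by rewrite [0](_ : _ = x)//; apply/rowP => -[].
- move=> m F L FL; apply: aeW => y; exists 0 => e e0; exists 1 => // h _.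
  rewrite [h](_ : _ = 0); last by apply/rowP => -[].
  by rewrite !mul0mx addr0 !subrr !normr0 mulr0.
Qed.

Lemma rademacher_space_exists n : exists d (T : measurableType d)
  (mu : {sigma_finite_measure set T -> \bar R}) (phi : T -> 'rV[R]_n),
  rademacher_space mu phi.
Proof.
elim: n => [|n [d [T [mu [phi h]]]]].
  exists _, unit, (@dirac _ unit tt R : {sigma_finite_measure set unit -> \bar R}).
  by exists (fun=> 0); exact: rademacher_space0.
have [mm mmE] := product_sigma_finite_measure leb mu.
exists _, (measurableTypeR R * T)%type, mm, (extend_param phi).
by rewrite mmE; exact: rademacher_extend h.
Qed.

End rademacher.

(** * From derivative bounds to bounds on increments *)

Lemma lipschitz_map_comp (R : realType) (V W X : normedModType R) L M
    (F : V -> W) (G : W -> X) : 0 <= M -> lipschitz_map L F -> lipschitz_map M G ->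
  lipschitz_map (M * L) (G \o F).
Proof.
move=> M0 FL GM x y; rewrite (le_trans (GM _ _))// -mulrA ler_wpM2l//.
Qed.

Lemma lipschitz_mulmx (R : realType) p n (Q : 'M[R]_(p, n)) (u : 'rV[R]_n) :
  lipschitz_map (p%:R * `|Q|) (fun w : 'rV[R]_p => u + w *m Q).
Proof.
by move=> x y; rewrite opprD addrACA subrr add0r -mulmxBl norm_mulmx_le.
Qed.

Lemma has_slope_uniq (R : realType) (g : R -> R) t p q :
  has_slope g t p -> has_slope g t q -> p = q.
Proof.
move=> gp gq; apply/eqP/negPn/negP => pq.
have e0 : 0 < `|p - q| / 4 by rewrite divr_gt0// normr_gt0 subr_eq0.
have [d1 d10 d1P] := gp _ e0; have [d2 d20 d2P] := gq _ e0.
pose tau := Num.min d1 d2 / 2.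
have m0 : 0 < Num.min d1 d2 by rewrite lt_min d10.
have tau0 : 0 < tau by rewrite divr_gt0.
have tm : tau < Num.min d1 d2 by rewrite ltr_pdivrMr// ltr_pMr// ltr1n.
have tn : `|tau| = tau by rewrite gtr0_norm.
move: tm; rewrite lt_min -{1}tn -{2}tn => /andP[/d1P h1 /d2P h2].
have := ler_normB (g (t + tau) - g t - tau * q) (g (t + tau) - g t - tau * p).
rewrite (_ : _ - _ - (_ - _) = tau * (p - q)); last by ring.
rewrite normrM => h3; have := le_trans h3 (lerD h2 h1); rewrite tn.
rewrite -mulrDl mulrC ler_pM2r// => h4.
have : `|p - q| <= 0 by lra.
by rewrite normr_le0 subr_eq0; apply/negP.
Qed.

Lemma ler_norm_dotv_norm (R : realType) n (a b : 'rV[R]_n) :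
  `|dotv a b| <= n%:R * enorm b * `|a|.
Proof.
rewrite (le_trans (ler_norm_dotv _ _))// mulrAC ler_wpM2r ?enorm_ge0//.
exact: enorm_le_norm.
Qed.

Lemma fdiff_dotv_slope (R : realType) n m (G : 'rV[R]_(1 + n) -> 'rV[R]_m)
    (t : R) (y : 'rV[R]_n) A (d : 'rV[R]_m) :
  frechet G (row_mx t%:M y) A ->
  has_slope (fun t => dotv (G (row_mx t%:M y)) d) t (dotv (dir1 R n *m A) d).
Proof.
move=> GA e e0; pose c := m%:R * enorm d + 1.
have c0 : 0 < c by rewrite ltr_wpDl// mulr_ge0// enorm_ge0.
have [|r r0 rP] := GA (e / c); first by rewrite divr_gt0.
exists r => // tau tr.
have tn : `|tau *: dir1 R n| <= `|tau|.
  rewrite normrZ ler_piMr// /dir1; apply: norm_row_mx_le; last by rewrite normr0.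
  by rewrite norm_scalar1 normr1.
have := rP (tau *: dir1 R n) (le_lt_trans tn tr).
have -> : row_mx t%:M y + tau *: dir1 R n *m 1%:M = row_mx (t + tau)%:M y.
  by rewrite mulmx1 scale_row_mx add_row_mx scaler0 addr0 scalemx1 -raddfD.
set B := _ - _ - _ => hB.
rewrite (_ : _ - _ = dotv B d).
  rewrite (le_trans (ler_norm_dotv_norm _ _))//.
  rewrite (le_trans (ler_wpM2l _ hB)) ?mulr_ge0 ?enorm_ge0//.
  apply: (@le_trans _ _ (c * (e / c * `|tau|))).
    rewrite ler_pM ?mulr_ge0 ?enorm_ge0 ?lerDl ?(ltW e0) ?invr_ge0 ?(ltW c0)//.
    by rewrite ler_wpM2l// divr_ge0 ?(ltW e0) ?(ltW c0).
  by rewrite mulrA mulrCA divff ?gt_eqF// mulr1.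
by rewrite /B -scalemxAl !dotvE.
Qed.

Lemma frechet_change_var (R : realType) n m (F : 'rV[R]_n -> 'rV[R]_m) (Q : 'M[R]_n)
    (u w : 'rV[R]_n) A : Q \in unitmx ->
  frechet (fun w => F (u + w *m Q)) w A -> frechet F (u + w *m Q) (invmx Q *m A).
Proof.
move=> uQ GA e e0; pose c := n%:R * `|invmx Q| + 1.
have c0 : 0 < c by rewrite ltr_wpDl// mulr_ge0.
have [|r r0 rP] := GA (e / c); first by rewrite divr_gt0.
have hc (h : 'rV[R]_n) : `|h *m invmx Q| <= c * `|h|.
  by rewrite (le_trans (norm_mulmx_le _ _))// ler_wpM2r// lerDl.
exists (r / c); first by rewrite divr_gt0.
move=> h hr; have hr' : `|h *m invmx Q| < r.
  by rewrite (le_lt_trans (hc h))// mulrC -ltr_pdivlMr.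
have := rP _ hr'; rewrite mulmx1 mulmxDl mulmxKV// addrA mulmx1 -mulmxA.
move=> /le_trans; apply; rewrite -mulrA ler_wpM2l ?(ltW e0)//.
by rewrite ler_pdivrMl.
Qed.

(** For a nonzero row the left factor of the rank factorization is a nonzero scalar, so a multiple
    of [row_ebase d] has [d] as its first row. *)
Lemma unitmx_first_row (R : realType) n (d : 'rV[R]_(1 + n)) : d != 0 ->
  exists2 Q : 'M[R]_(1 + n), Q \in unitmx & dir1 R n *m Q = d.
Proof.
move=> d0; have rd : \rank d = 1%N by rewrite rank_rV d0.
pose c := col_ebase d 0 0.
have cE : col_ebase d = c%:M by rewrite [LHS]mx11_scalar.
have c0 : c != 0.
  by have := col_ebase_unit d; rewrite cE unitmxE det_scalar1 unitfE.
exists (c *: row_ebase d); first by rewrite unitmxZ ?unitfE ?row_ebase_unit.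
rewrite -[RHS]mulmx_ebase rd cE /dir1 -(pid_mx_row _ n).
by rewrite -scalemxAr mul_scalar_mx -scalemxAl.
Qed.

Lemma lipschitz_fun_dotv (R : realType) n m (G : 'rV[R]_n -> 'rV[R]_m) L (d : 'rV[R]_m) :
  lipschitz_map L G ->
  lipschitz_map (m%:R * enorm d * `|L|) (fun x => dotv (G x) d).
Proof.
move=> GL x y; rewrite -dotvNl -dotvDl (le_trans (ler_norm_dotv_norm _ _))//.
by rewrite -[leRHS]mulrA ler_wpM2l ?mulr_ge0 ?enorm_ge0// lipschitz_mapW.
Qed.

Lemma lipschitz_row_mx (R : realType) n (a : 'rV[R]_1) :
  lipschitz_map 1 (fun y : 'rV[R]_n => row_mx a y).
Proof.
move=> y z; rewrite opp_row_mx add_row_mx subrr mul1r.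
by apply: norm_row_mx_le; rewrite ?normr0.
Qed.

Lemma lipschitz_scalar_row (R : realType) n (y : 'rV[R]_n) :
  lipschitz_map 1 (fun t : R => row_mx t%:M y : 'rV[R]_(1 + n)).
Proof.
move=> t u; rewrite opp_row_mx add_row_mx subrr mul1r -raddfB.
by apply: norm_row_mx_le; rewrite ?norm_scalar1 ?normr0.
Qed.

Section derivative_bound.
Variables (R : realType) (n : nat).
Local Notation leb := (@lebesgue_measure R).

(* Change variables so that [d] becomes the first basis vector. By Tonelli, on
   almost every line parallel to [d] the map is differentiable almost everywhere. *)
Lemma lipschitz_derivative_bound (F : 'rV[R]_n -> 'rV[R]_n) (L K : R)
    (U : set 'rV[R]_n) (d u : 'rV[R]_n) :
  lipschitz_map L F -> open U -> convex_set_rV U -> d != 0 ->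
  (forall x A, U x -> frechet F x A -> dotv (d *m A) d <= K) ->
  U u -> U (u + d) -> dotv (F (u + d) - F u) d <= K.
Proof.
case: n F U d u => [F U d u _ _ _ /negP[]|n' F U d u FL oU cU d0 FK Uu Uud].
  by apply/eqP/rowP => -[].
(* By continuity a violation persists on all nearby segments parallel to [d], a family of positive
   measure. One of them therefore lies on a line where the map is differentiable almost
   everywhere. *)
rewrite leNgt; apply/negP => Kd.
have [Q uQ dQ] := @unitmx_first_row R n' d d0.
pose X (w : 'rV[R]_(1 + n')) : 'rV[R]_n'.+1 := u + w *m Q.
pose G (w : 'rV[R]_(1 + n')) : 'rV[R]_n'.+1 := F (X w).
have XL := lipschitz_mulmx Q u.
have [M GL] : exists M, lipschitz_map M G.
  by exists (`|L| * ((1 + n')%:R * `|Q|)); apply: lipschitz_map_comp (lipschitz_mapW FL).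
have [dd [T [mu [phi rad]]]] := rademacher_space_exists R n'.
have [_ _ radG] := rademacher_extend rad; have [mphi pphi _] := rad.
have aey := product_null_ae_ysection (radG _ _ _ GL).
have X0 : X (row_mx (0 : R)%:M 0) = u by rewrite /X raddf0 row_mx0 mul0mx addr0.
have X1 : X (row_mx (1 : R)%:M 0) = u + d by rewrite /X dQ.
have XC t : continuous (fun y : 'rV[R]_n' => X (row_mx (t : R)%:M y)).
  apply: lipschitz_map_continuous.
  by apply: (lipschitz_map_comp _ (@lipschitz_row_mx R n' t%:M) XL); rewrite mulr_ge0.
pose H (y : 'rV[R]_n') :=
  dotv (G (row_mx (1 : R)%:M y)) d - dotv (G (row_mx (0 : R)%:M y)) d.
have HC : continuous H.
  have GC t : continuous (fun y : 'rV[R]_n' => dotv (G (row_mx (t : R)%:M y)) d).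
    apply: lipschitz_map_continuous; apply: lipschitz_map_comp (lipschitz_fun_dotv d GL).
      by rewrite !mulr_ge0// enorm_ge0.
    exact: lipschitz_row_mx.
  by move=> y; exact: cvgB (GC 1 y) (GC 0 y).
have : \forall y \near (0 : 'rV[R]_n'), [/\ U (X (row_mx (0 : R)%:M y)),
    U (X (row_mx (1 : R)%:M y)) & K < H y].
  have n0 : \forall y \near (0 : 'rV[R]_n'), U (X (row_mx (0 : R)%:M y)).
    by apply: (XC 0 0); apply: open_nbhs_nbhs; split => //; rewrite X0.
  have n1 : \forall y \near (0 : 'rV[R]_n'), U (X (row_mx (1 : R)%:M y)).
    by apply: (XC 1 0); apply: open_nbhs_nbhs; split => //; rewrite X1.
  have n2 : \forall y \near (0 : 'rV[R]_n'), K < H y.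
    have : nbhs (H 0) [set x | K < x].
      apply: open_nbhs_nbhs; split; first exact: open_gt.
      by rewrite /H /G X0 X1 -dotvNl -dotvDl.
    exact: HC.
  by near=> y; split; near: y.
move=> /nbhs_ballP[r /= r0 rP].
pose B0 : set 'rV[R]_n' := ball 0 r.
have Bphi : (0 < mu (phi @^-1` B0))%E.
  by apply: pphi; [exact: ball_open|exists 0; exact: ballxx].
have [y [yr yN]] : exists y, B0 (phi y) /\
    leb.-negligible [set t | ~ exists A, frechet G (extend_param phi (t, y)) A].
  apply: contrapT => none; move: Bphi; apply/negP; rewrite -leNgt.
  rewrite measure_le0; apply/eqP/negligibleP; first by apply: mphi; exact: ball_open.
  apply: negligibleS aey => y /= yr yN; apply: none; exists y; split => //.
have {rP} [U0 U1 KH] := rP _ yr.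
have gL := lipschitz_map_comp (_ : 0 <= n'.+1%:R * enorm d * `|M|)
  (lipschitz_scalar_row (phi y)) (lipschitz_fun_dotv d GL).
have {}gL := gL (mulr_ge0 (mulr_ge0 (ler0n _ _) (enorm_ge0 _)) (normr_ge0 _)).
have : dotv (G (row_mx (1 : R)%:M (phi y))) d - dotv (G (row_mx (0 : R)%:M (phi y))) d
    <= K * (1 - 0).
  apply: (lipschitz_growth gL ltr01).
  apply: negligibleS yN => t /= tK [A tA]; apply: tK => /andP[t0 t1] p tp.
  rewrite (has_slope_uniq tp (fdiff_dotv_slope d tA)).
  have := frechet_change_var uQ tA; rewrite -/(X _) => /FK.
  rewrite mulmxA -{1}dQ mulmxK//; apply.
  have -> : X (row_mx t%:M (phi y)) =
      t *: X (row_mx 1%:M (phi y)) + (1 - t) *: X (row_mx (0 : R)%:M (phi y)).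
    rewrite /X !scalerDr addrACA -scalerDl subrKC scale1r; congr (_ + _).
    rewrite !scalemxAl -mulmxDl; congr (_ *m _).
    rewrite !scale_row_mx add_row_mx -scalerDl subrKC scale1r raddf0 scaler0 addr0.
    by rewrite scalemx1.
  by apply: cU => //; rewrite (ltW t0) (ltW t1).
by rewrite subr0 mulr1 leNgt; apply/negP/negPn.
Unshelve. all: by end_near. Qed.

End derivative_bound.

(** * Localized resolvents *)

Section semicontinuity.
Variables (R : realType) (V : topologicalType).
Implicit Types (f : V -> \bar R) (q : V -> R).

Lemma lower_semicontinuousD f q : (forall x, f x != -oo%E) ->
  lower_semicontinuous f -> continuous q ->
  lower_semicontinuous (fun x => f x + (q x)%:E)%E.
Proof.
move=> fNy fl qc x a axf.
have [b bf ab] : exists2 b : R, (b%:E < f x)%E & a - b < q x.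
  move: (fNy x) axf; case: (f x) => [c _|_ _|//].
    rewrite -EFinD lte_fin => h; exists (c - (c + q x - a) / 2); last by lra.
    by rewrite lte_fin; lra.
  by exists (a - q x + 1); [rewrite ltry|lra].
have [W xW Wb] := fl x b bf.
have qW : \forall y \near x, a - b < q y.
  have : nbhs (q x) [set z | a - b < z].
    by apply: open_nbhs_nbhs; split => //; exact: open_gt.
  exact: qc.
exists (W `&` [set y | a - b < q y]); first exact: filterI.
move=> y [Wy] /= qy; case: (f y) (Wb y Wy) => [c| |] //=.
  by rewrite -EFinD !lte_fin; lra.
by move=> _; exact: ltry.
Qed.

(** The strict sublevel sets above the infimum generate a proper filter on [K]; by lower
    semicontinuity its cluster point attains the infimum. *)
Lemma lower_semicontinuous_min f (K : set V) (x0 : V) :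
  lower_semicontinuous f -> compact K -> K x0 -> (f x0 < +oo)%E ->
  exists2 x, K x & forall y, K y -> (f x <= f y)%E.
Proof.
move=> fl cK Kx0 fx0.
pose I := ereal_inf (f @` K).
have If y : K y -> (I <= f y)%E by move=> Ky; apply: ereal_inf_lbound; exists y.
pose D := [set a : R | (I < a%:E)%E].
pose B (a : R) := [set x | K x /\ (f x < a%:E)%E].
have pF : ProperFilter (filter_from D B).
  apply: filter_from_proper; last first.
    by move=> a /ereal_inf_lt[_ [x Kx <-]] fa; exists x.
  apply: filter_from_filter.
    move: fx0 (If _ Kx0); case: (f x0) => [c _ Ic|//|_]; last first.
      by rewrite leeNy_eq => /eqP IE; exists 0; rewrite /D /= IE ltNyr.
    by exists (c + 1); apply: le_lt_trans Ic _; rewrite lte_fin ltrDl.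
  move=> a b /= Ia Ib; exists (Num.min a b).
    by rewrite /D /=; have [_|_] := leP a b.
  move=> x [Kx]; rewrite EFin_min lt_min => /andP[fa fb].
  by split.
have FK : filter_from D B K.
  have [a Da] : D !=set0.
    move: fx0 (If _ Kx0); case: (f x0) => [c _ Ic|//|_]; last first.
      by rewrite leeNy_eq => /eqP IE; exists 0; rewrite /D /= IE ltNyr.
    by exists (c + 1); apply: le_lt_trans Ic _; rewrite lte_fin ltrDl.
  by exists a => // x [].
have [x [Kx xcl]] := cK _ pF FK.
exists x => // y Ky; apply: le_trans (If y Ky).
rewrite leNgt; apply/negP => Ix.
have [a Ia ax] : exists2 a : R, (I < a%:E)%E & (a%:E < f x)%E.
  move: Ix {If D B pF FK xcl}; move: I (f x) => [i| |] [c| |] //.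
  - rewrite lte_fin => ic; exists ((i + c) / 2); rewrite lte_fin; lra.
  - by move=> _; exists (i + 1); rewrite ?ltry// lte_fin; lra.
  - by move=> _; exists (c - 1); rewrite ?ltNyr// lte_fin; lra.
  - by move=> _; exists 0; rewrite ?ltry ?ltNyr.
have [W xW Wa] := fl x a ax.
have [z [[Kz fz] Wz]] := xcl (B a) W (ex_intro2 _ _ a Ia (fun _ h => h)) xW.
by have := lt_trans fz (Wa z Wz); rewrite ltxx.
Qed.

End semicontinuity.

Section euclid_more.
Variables (R : realType) (n : nat).
Implicit Types (x y u : 'rV[R]_n).

Lemma sqr_enormB_polar x y u :
  enorm (y - u) ^+ 2 = enorm (x - u) ^+ 2 - 2 * dotv (u - x) (y - x) + enorm (y - x) ^+ 2.
Proof.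
rewrite !sqr_enorm !dotvE (dotvC u x) (dotvC u y) (dotvC y x); ring.
Qed.

Lemma compact_closed_eball x (r : R) : compact [set y | enorm (y - x) <= r].
Proof.
apply: bounded_closed_compact.
  exists (enorm x + r); split; first exact: num_real.
  move=> M hM y /= yr; apply: le_trans (ltW hM).
  apply: le_trans (norm_le_enorm _) _; rewrite -(subrK x y) addrC.
  by rewrite (le_trans (ler_enormD _ _))// lerD2l.
rewrite -openC openE => y /= /negP; rewrite -ltNge => yr.
apply/nbhs_eballP; exists (enorm (y - x) - r); first by rewrite subr_gt0.
move=> z zy; have {}zy : enorm (z - y) < enorm (y - x) - r by exact: zy.
apply/negP; rewrite -ltNge.
by have := ler_enormB y z x; rewrite (enormB y z); lra.
Qed.

Lemma continuous_sqr_enormB u (c : R) :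
  continuous (fun y : 'rV[R]_n => c * enorm (y - u) ^+ 2).
Proof.
move=> x; have h : dotv (y - u) (y - u) @[y --> x] --> dotv (x - u) (x - u).
  have yu : y - u @[y --> x] --> x - u.
    have idx : y @[y --> x] --> x by exact: cvg_id.
    exact: cvgB idx (cvg_cst u).
  exact: (cvg_dotv yu yu).
have -> : (fun y => c * enorm (y - u) ^+ 2) = (fun y => c * dotv (y - u) (y - u)).
  by apply/funext => y; rewrite sqr_enorm.
exact: (cvgM (cvg_cst c) h).
Qed.

End euclid_more.

Section local_graph.
Variables (R : realType) (n : nat) (f : 'rV[R]_n -> \bar R) (xb xbs : 'rV[R]_n).
Implicit Types (x y u : 'rV[R]_n) (e r : R).

(** A single radius governs point, subgradient and value, so that one parameter shrinks the whole
    attentive localization. *)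
Definition local_gph e x xs :=
  [/\ lsubdiff f x xs, (f x < f xb + e%:E)%E, eball xb e x & eball xbs e xs].

(* The inequality defining prox-regularity, with a parameter [r] of any sign: it is
   prox-regularity for [0 <= r] and characterizes variational s-convexity for [r = - s]. *)
Definition local_minorant e r :=
  forall x' x xs, eball xb e x' -> local_gph e x xs ->
    (f x + (dotv xs (x' - x) - r / 2 * enorm (x' - x) ^+ 2)%:E <= f x')%E.

Lemma prox_regularP : prox_regular f xb xbs <->
  exists e r, [/\ 0 < e, 0 <= r & local_minorant e r].
Proof.
split=> -[e [r [e0 r0 h]]]; exists e, r; split => //.
  by move=> x' x xs x'e [xxs fx xe xse]; exact: h.
by move=> x' x xs x'e xxs fx xe xse; exact: h.
Qed.

Lemma eballW e e' x y : e <= e' -> eball x e y -> eball x e' y.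
Proof. by move=> ee' h; exact: lt_le_trans ee'. Qed.

Lemma local_gphW e e' x xs : e <= e' -> f xb \is a fin_num ->
  local_gph e x xs -> local_gph e' x xs.
Proof.
move=> ee' fb [xxs fx xe xse]; split => //; [|exact: eballW xe|exact: eballW xse].
by apply: lt_le_trans fx _; rewrite leeD2l// lee_fin.
Qed.

Lemma local_minorantW e e' r r' : e' <= e -> r <= r' -> f xb \is a fin_num ->
  local_minorant e r -> local_minorant e' r'.
Proof.
move=> ee rr fb h x' x xs x'e /(local_gphW ee fb) xg.
apply: le_trans (h x' x xs (eballW ee x'e) xg).
by rewrite leeD2l// lee_fin lerD2l lerN2 ler_wpM2r ?sqr_ge0// ler_pM2r.
Qed.

Lemma rsubdiff_lsubdiff x xs : rsubdiff f x xs -> lsubdiff f x xs.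
Proof.
move=> fx; split; first by case: fx.
by exists (fun=> x), (fun=> xs); split => //; exact: cvg_cst.
Qed.

Lemma local_gph_center e : 0 < e -> lsubdiff f xb xbs -> f xb \is a fin_num ->
  local_gph e xb xbs.
Proof.
move=> e0 h fb; split => //.
- by rewrite lteDl// lte_fin.
- by rewrite /eball /= subrr enorm0.
- by rewrite /eball /= subrr enorm0.
Qed.

(** Sum of the two minorants with their points exchanged; each contributes half of [r]. *)
Lemma local_minorant_monotone e r x1 x1s x2 x2s : local_minorant e r ->
  local_gph e x1 x1s -> local_gph e x2 x2s ->
  - r * enorm (x1 - x2) ^+ 2 <= dotv (x1s - x2s) (x1 - x2).
Proof.
move=> h g1 g2; have [l1 _ b1 _] := g1; have [l2 _ b2 _] := g2.
have := h x2 x1 x1s b2 g1; have := h x1 x2 x2s b1 g2.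
have [f1 _] := l1; have [f2 _] := l2.
rewrite -(fineK f1) -(fineK f2) -!EFinD !lee_fin.
rewrite (enormB x2 x1) -(opprB x1 x2) !dotvNr dotvDl dotvNl.
set N := enorm _ ^+ 2; lra.
Qed.

Section resolvent.
Variables (e r lam : R).
Hypotheses (fNy : forall x, f x != -oo%E) (fl : lower_semicontinuous f).
Hypotheses (fb : f xb \is a fin_num) (xbE : lsubdiff f xb xbs).
Hypotheses (e0 : 0 < e) (h : local_minorant e r) (lam0 : 0 < lam) (lamr : lam * r <= 2^-1).

Local Notation ub := (xb + lam *: xbs).

(** Fermat's rule for the proximal problem at an interior minimizer. Expanding the square around [x]
    leaves the remainder [|y - x|^2 / (2 lam)], which the radius [2 * lam * ep] makes negligible. *)
Lemma local_min_rsubdiff (rho : R) x u : f x \is a fin_num -> enorm (x - xb) < rho ->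
  (forall y, enorm (y - xb) <= rho ->
    (f x + ((2 * lam)^-1 * enorm (x - u) ^+ 2)%:E <=
     f y + ((2 * lam)^-1 * enorm (y - u) ^+ 2)%:E)%E) ->
  rsubdiff f x (lam^-1 *: (u - x)).
Proof.
move=> fx xr hmin; split => // ep ep0.
exists (Num.min (rho - enorm (x - xb)) (2 * lam * ep)).
  by rewrite lt_min subr_gt0 xr !mulr_gt0.
move=> y; rewrite lt_min => /andP[yr yep].
have yK : enorm (y - xb) <= rho.
  by rewrite (le_trans (ler_enormB y x xb))// -lerBrDr ltW.
have := hmin y yK; rewrite -(fineK fx); move: (fNy y); case: (f y) => [b _|_ _|//].
  rewrite -!EFinD !lee_fin (sqr_enormB_polar x y u) dotvZl.
  have yx : (2 * lam)^-1 * enorm (y - x) ^+ 2 <= ep * enorm (y - x).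
    rewrite expr2 mulrA ler_wpM2r ?enorm_ge0// ler_pdivrMl ?mulr_gt0//.
    exact: ltW.
  have -> : lam^-1 = 2 * (2 * lam)^-1 by rewrite invfM mulVKf.
  move: yx; set I := (2 * lam)^-1; set A := dotv _ _; set B := enorm (x - u) ^+ 2.
  set N := enorm (y - x) ^+ 2; set E := ep * _; lra.
by rewrite leey.
Qed.

(** The competitor is [xb], and the minorant at [(xb, xbs)] bounds [f x] from below. Because of
    [lam * r <= 2^-1], half of the square of [enorm (x - xb)] survives, which produces the factor
    4. *)
Lemma local_minimizer_bound x u : f x \is a fin_num -> eball xb e x ->
  (f x + ((2 * lam)^-1 * enorm (x - u) ^+ 2)%:E <=
     f xb + ((2 * lam)^-1 * enorm (xb - u) ^+ 2)%:E)%E ->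
  enorm (x - xb) <= 4 * enorm (u - ub) /\
  (f x <= f xb + (4 * (enorm xbs + lam^-1 * enorm (u - ub)) * enorm (u - ub))%:E)%E.
Proof.
move=> fx xe hm.
have := h xe (local_gph_center e0 xbE fb); move: hm.
rewrite -(fineK fx) -(fineK fb) -!EFinD !lee_fin.
set a := fine _; set b := fine _.
rewrite (sqr_enormB_polar xb x u) (_ : u - xb = (u - ub) + lam *: xbs); last first.
  by rewrite opprD addrA subrK.
set w := u - ub; set D := x - xb; rewrite dotvDl dotvZl.
set B := enorm (xb - u) ^+ 2; set p := dotv w D; set q := dotv xbs D => h1 h2.
have pw : p <= enorm w * enorm D := ler_dotv _ _.
have qw : q <= enorm xbs * enorm D := ler_dotv _ _.
set W := enorm w in pw *; set N := enorm D in pw qw h1 h2 *.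
have N0 : 0 <= N := enorm_ge0 _; have W0 : 0 <= W := enorm_ge0 _.
have Q0 : 0 <= enorm xbs := enorm_ge0 _.
have l0 : lam != 0 by rewrite gt_eqF.
have h3 : a <= b + q + lam^-1 * p - (2 * lam)^-1 * N ^+ 2.
  have -> : lam^-1 * p = (2 * lam)^-1 * (2 * p) by field.
  have -> : q = (2 * lam)^-1 * (2 * (lam * q)) by field.
  move: h1; set I := (2 * lam)^-1; lra.
have h4 : N ^+ 2 <= 4 * (W * N).
  have : (2 * lam)^-1 * N ^+ 2 <= lam^-1 * p + r / 2 * N ^+ 2 by lra.
  rewrite -(ler_pM2l (x := 2 * lam)) ?mulr_gt0// => h5.
  have {}h5 : N ^+ 2 <= 2 * p + (lam * r) * N ^+ 2.
    by apply: le_trans (le_trans _ h5) _; rewrite le_eqVlt; apply/orP; left; apply/eqP; field.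
  have : lam * r * N ^+ 2 <= 2^-1 * N ^+ 2 by rewrite ler_wpM2r// sqr_ge0.
  lra.
have h5 : N <= 4 * W.
  have [->|N1] := eqVneq N 0; first by rewrite mulr_ge0.
  have Np : 0 < N by rewrite lt_def N1.
  by rewrite -(ler_pM2r Np) -expr2 -mulrA.
split=> //.
have : lam^-1 * p <= lam^-1 * (W * N) by rewrite ler_wpM2l// invr_ge0 ltW.
have : 0 <= (2 * lam)^-1 * N ^+ 2 by rewrite mulr_ge0 ?sqr_ge0// invr_ge0 mulr_ge0// ltW.
have : (enorm xbs + lam^-1 * W) * N <= (enorm xbs + lam^-1 * W) * (4 * W).
  by rewrite ler_wpM2l// addr_ge0// mulr_ge0// invr_ge0 ltW.
lra.
Qed.

(** The proximal function is minimized over a closed ball, as nothing is known of [f] far from [xb].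
    For [u] near [xb + lam *: xbs] the minimizer is interior, and its value and subgradient are
    close to those at the center. *)
Lemma resolvent_exists eta : 0 < eta -> exists2 d, 0 < d & forall u, eball ub d u ->
  exists x, local_gph eta x (lam^-1 *: (u - x)).
Proof.
move=> eta0; pose rho := Num.min e eta / 2.
have m0 : 0 < Num.min e eta by rewrite lt_min e0.
have rho0 : 0 < rho by rewrite divr_gt0.
have rhom : rho < Num.min e eta by rewrite ltr_pdivrMr// ltr_pMr// ltr1n.
have /andP[rhoe rhoeta] : (rho < e) && (rho < eta) by rewrite -lt_min.
have li0 : 0 < lam^-1 by rewrite invr_gt0.
have xbs0 := enorm_ge0 xbs.
(* The summands are the factors by which [enorm (u - ub)] controls the point, the subgradient and
   the value; the bound 1 on the radius makes the quadratic part of the last one linear. *)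
pose C := 4 + 5 * lam^-1 + 4 * (enorm xbs + lam^-1) + 1.
have C0 : 0 < C by rewrite /C; lra.
exists (Num.min 1 (rho / C)); first by rewrite lt_min ltr01 divr_gt0.
move=> u; rewrite /eball /= lt_min => /andP[u1 uC].
pose m y := (f y + ((2 * lam)^-1 * enorm (y - u) ^+ 2)%:E)%E.
have ml : lower_semicontinuous m.
  by apply: lower_semicontinuousD => //; exact: continuous_sqr_enormB.
have [||x xK xmin] := @lower_semicontinuous_min _ _ m [set y | enorm (y - xb) <= rho] xb ml
  (@compact_closed_eball R n xb rho).
- by rewrite /= subrr enorm0 ltW.
- by rewrite /m -(fineK fb) -EFinD ltry.
rewrite /= in xK.
have mxb := xmin xb; rewrite /= subrr enorm0 in mxb.
have {}mxb : (m x <= m xb)%E by apply: mxb; exact: ltW.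
have fx : f x \is a fin_num.
  move: mxb (fNy x); rewrite /m -(fineK fb) -EFinD.
  by case: (f x) => [c| |]//.
have xe : eball xb e x by rewrite /eball /= (le_lt_trans xK).
have [xw fxw] := local_minimizer_bound fx xe mxb.
set W := enorm (u - ub) in u1 uC xw fxw.
have W0 : 0 <= W := enorm_ge0 _.
have CW : C * W < rho by rewrite mulrC -ltr_pdivlMr.
have li0W : 0 <= lam^-1 * W by rewrite mulr_ge0// ltW.
have qW : 0 <= enorm xbs * W by rewrite mulr_ge0.
have CWE : C * W = 4 * W + 5 * (lam^-1 * W) + 4 * (enorm xbs * W) + 4 * (lam^-1 * W) + W.
  by rewrite /C; ring.
have xrho : enorm (x - xb) < rho by lra.
exists x; split.
- by apply: rsubdiff_lsubdiff; apply: (local_min_rsubdiff fx xrho) => y yK; exact: xmin.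
- apply: le_lt_trans fxw _; rewrite lteD2lE// lte_fin.
  have : lam^-1 * W * W <= lam^-1 * W by rewrite ler_piMr// ltW.
  by rewrite !mulrDr !mulrDl; lra.
- by rewrite /eball /=; lra.
- rewrite /eball /= (_ : _ - xbs = lam^-1 *: ((u - ub) - (x - xb))); last first.
    have -> : xbs = lam^-1 *: (lam *: xbs) by rewrite scalerK// gt_eqF.
    rewrite -scalerBr scalerK ?gt_eqF//; congr (_ *: _).
    by apply/rowP => i; rewrite !mxE; ring.
  rewrite enormZ gtr0_norm//.
  have : enorm (u - ub - (x - xb)) <= W + 4 * W.
    by rewrite (le_trans (ler_enormD _ _))// enormN lerD.
  move=> /(ler_wpM2l (ltW li0)); lra.
Qed.

(** Pair the difference of the two points [x + lam *: xs] with [x1 - x2]: hypomonotonicity and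
    [lam * r <= 2^-1] leave at least half of the square of [enorm (x1 - x2)]. *)
Lemma local_gph_lipschitz x1 x1s x2 x2s : local_gph e x1 x1s -> local_gph e x2 x2s ->
  enorm (x1 - x2) <= 2 * enorm ((x1 + lam *: x1s) - (x2 + lam *: x2s)).
Proof.
move=> g1 g2; have := local_minorant_monotone h g1 g2.
set u := _ + _ *: x1s - _.
have -> : u = (x1 - x2) + lam *: (x1s - x2s).
  by rewrite /u scalerBr; apply/rowP => i; rewrite !mxE; ring.
set D := x1 - x2; set S := x1s - x2s => hm.
have := ler_dotv (D + lam *: S) D; rewrite dotvDl dotvZl -sqr_enorm.
set N := enorm D in hm *; set W := enorm (_ + _) => h1.
have N0 : 0 <= N := enorm_ge0 _; have W0 : 0 <= W := enorm_ge0 _.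
have h2 : lam * (- r * N ^+ 2) <= lam * dotv S D by rewrite ler_wpM2l// ltW.
have h3 : lam * r * N ^+ 2 <= 2^-1 * N ^+ 2 by rewrite ler_wpM2r// sqr_ge0.
have h4 : N ^+ 2 <= 2 * W * N by lra.
have [->|N1] := eqVneq N 0; first by rewrite mulr_ge0.
have Np : 0 < N by rewrite lt_def N1.
by rewrite -(ler_pM2r Np) -expr2.
Qed.

(** The solution is unique by [local_gph_lipschitz]; the default 0 is taken where none exists. *)
Definition resolvent u := xget 0 [set x | local_gph e x (lam^-1 *: (u - x))].

Lemma resolvent_local_gph x xs : local_gph e x xs -> resolvent (x + lam *: xs) = x.
Proof.
move=> g; rewrite /resolvent.
have l0 : lam != 0 by rewrite gt_eqF.
have xE y : y + lam *: (lam^-1 *: (x + lam *: xs - y)) = x + lam *: xs.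
  by rewrite scalerA mulfV// scale1r subrKC.
case: xgetP => [y _ /= gy|/(_ x)/=].
  have := local_gph_lipschitz gy g; rewrite xE subrr enorm0 mulr0 => yx.
  by apply/eqP; rewrite -subr_eq0; apply/eqP/enorm_eq0/eqP; rewrite eq_le yx enorm_ge0.
by rewrite addrAC subrr add0r scalerK.
Qed.

(** [resolvent] selects in the localization of size [e]; by uniqueness its value is the solution
    found in the smaller one. Hypotheses known only very near the center thus apply to it. *)
Lemma local_gph_resolvent eta : 0 < eta -> eta <= e -> exists2 d, 0 < d &
  forall u, eball ub d u -> local_gph eta (resolvent u) (lam^-1 *: (u - resolvent u)).
Proof.
move=> eta0 etae; have [d d0 dP] := resolvent_exists eta0; exists d => // u /dP[x gx].
have := resolvent_local_gph (local_gphW etae fb gx).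
by rewrite scalerA mulfV ?gt_eqF// scale1r subrKC => ->.
Qed.

End resolvent.

End local_graph.

(** * Attentive tangent cones and derivatives of the resolvent *)

Section tangent.
Variables (R : realType) (n : nat) (f : 'rV[R]_n -> \bar R) (xb xbs : 'rV[R]_n).

Lemma ereal_cvg_lt (u : nat -> \bar R) (l c : \bar R) :
  u k @[k --> \oo] --> l -> (l < c)%E -> \forall k \near \oo, (u k < c)%E.
Proof.
move=> ul lc; have : nbhs l [set y | (y < c)%E].
  by apply: open_nbhs_nbhs; split => //; exact: open_ereal_lt_ereal.
exact: ul.
Qed.

Lemma cvg_eball (u : nat -> 'rV[R]_n) (x y : 'rV[R]_n) e :
  u k @[k --> \oo] --> x -> eball y e x -> \forall k \near \oo, eball y e (u k).
Proof.
by move=> ux yx; apply: ux; apply: open_nbhs_nbhs; split => //; exact: open_eball.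
Qed.

Lemma cvg_scaled_enormB (C : R) (u : nat -> 'rV[R]_n) (x : 'rV[R]_n) :
  u k @[k --> \oo] --> x -> C * enorm (u k - x) @[k --> \oo] --> (0 : R).
Proof.
move=> ux; have c0 : u k - x @[k --> \oo] --> x - x by exact: (cvgB ux (cvg_cst x)).
have c1 : C * enorm (u k - x) @[k --> \oo] --> C * enorm (x - x).
  exact: (cvgM (cvg_cst C) (cvg_enorm c0)).
by rewrite subrr enorm0 mulr0 in c1.
Qed.

(** Convergence of the values is what preserves the bound on [f] in [local_gph]. *)
Lemma fattentive_local_gph e zk z : local_gph f xb xbs e z.1 z.2 -> fattentive f zk z ->
  \forall k \near \oo, local_gph f xb xbs e (zk k).1 (zk k).2.
Proof.
move=> [_ fz z1 z2] [zg c1 c2 cf].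
have h1 := cvg_eball c1 z1; have h2 := cvg_eball c2 z2.
have h3 := ereal_cvg_lt cf fz.
near=> k; split; first exact: zg.
- by near: k.
- by near: k.
- by near: k.
Unshelve. all: by end_near. Qed.

Lemma fattentive_cst z : gph f z -> fattentive f (fun=> z) z.
Proof. by move=> gz; split => //; exact: cvg_cst. Qed.

(** Hypomonotonicity between [zk k] and [z], divided by [t k ^+ 2], passes to the limit. *)
Lemma ftangent_monotone e sigma z w : local_minorant f xb xbs e sigma ->
  local_gph f xb xbs e z.1 z.2 -> ftangent f z w ->
  - sigma * enorm w.1 ^+ 2 <= dotv w.2 w.1.
Proof.
move=> hm gz [t [zk [t0 _ zkz c1 c2]]].
have gk := fattentive_local_gph gz zkz.
pose q1 k := (t k)^-1 *: ((zk k).1 - z.1); pose q2 k := (t k)^-1 *: ((zk k).2 - z.2).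
have cc : dotv (q2 k) (q1 k) - - sigma * dotv (q1 k) (q1 k) @[k --> \oo] -->
    dotv w.2 w.1 - - sigma * dotv w.1 w.1.
  exact: (cvgB (cvg_dotv c2 c1) (cvgM (cvg_cst (- sigma)) (cvg_dotv c1 c1))).
rewrite sqr_enorm -subr_ge0; have := @cvg_near_ge R _ _ 0 cc; apply.
near=> k.
have gkk : local_gph f xb xbs e (zk k).1 (zk k).2 by near: k.
have := local_minorant_monotone hm gkk gz.
rewrite /q1 /q2 sqr_enorm !dotvE.
have tk := t0 k; set i := (t k)^-1.
have i2 : 0 <= i ^+ 2 by exact: sqr_ge0.
rewrite -subr_ge0 => /(mulr_ge0 i2) => hh; apply: le_trans hh _.
by rewrite le_eqVlt; apply/orP; left; apply/eqP; ring.
Unshelve. all: by end_near. Qed.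

Section resolvent_tangent.
Variables (e r lam d : R).
Hypotheses (fb : f xb \is a fin_num) (e0 : 0 < e).
Hypotheses (hm : local_minorant f xb xbs e r) (lam0 : 0 < lam) (lamr : lam * r <= 2^-1).
Local Notation ub := (xb + lam *: xbs).
Local Notation P := (resolvent f xb xbs e lam).
Local Notation Q u := (lam^-1 *: (u - P u)).
Hypothesis (Pd : forall u, eball ub d u -> local_gph f xb xbs e (P u) (Q u)).

Lemma resolventK u : P u + lam *: Q u = u.
Proof. by rewrite scalerA mulfV ?gt_eqF// scale1r subrKC. Qed.

Lemma resolvent_lipschitz u v : eball ub d u -> eball ub d v ->
  enorm (P u - P v) <= 2 * enorm (u - v).
Proof.
move=> ud vd; have := local_gph_lipschitz hm lam0 lamr (Pd ud) (Pd vd).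
by rewrite !resolventK.
Qed.

(** Although [f] is merely lower semicontinuous, its values along the resolvent are Lipschitz: the
    minorant at [P u] is evaluated at [P v]. This makes convergence of resolvent points
    attentive. *)
Lemma resolvent_value_le : exists2 C, 0 <= C & forall u v, eball ub d u -> eball ub d v ->
  fine (f (P u)) <= fine (f (P v)) + C * enorm (u - v).
Proof.
exists (2 * (enorm xbs + e + `|r| * e)).
  by rewrite mulr_ge0// !addr_ge0 ?enorm_ge0 ?mulr_ge0 ?(ltW e0).
move=> u v ud vd; have gu := Pd ud; have gv := Pd vd.
have [lu _ bu su] := gu; have [lv _ bv _] := gv.
have := hm bv gu.
have [fu _] := lu; have [fv _] := lv; rewrite -(fineK fu) -(fineK fv) -EFinD lee_fin.
have := resolvent_lipschitz ud vd; rewrite (enormB (P v)).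
set a := fine _; set b := fine _; set D := enorm (P u - P v); set W := enorm (u - v).
move=> DW h1.
have D0 : 0 <= D := enorm_ge0 _.
have De : D <= 2 * e.
  rewrite /D (le_trans (ler_enormB _ xb _))// mulr_natl mulr2n (enormB xb).
  by rewrite lerD// ltW.
have h2 : - ((enorm xbs + e) * D) <= dotv (Q u) (P v - P u).
  rewrite lerNl -dotvNr opprB (le_trans (ler_dotv _ _))// ler_wpM2r//.
  rewrite -(subrK xbs (Q u)) (le_trans (ler_enormD _ _))// addrC lerD2l.
  exact: ltW su.
have h3 : r / 2 * D ^+ 2 <= `|r| * e * D.
  rewrite (le_trans (y := `|r| / 2 * D ^+ 2))//.
    by rewrite ler_wpM2r ?sqr_ge0// ler_pM2r// ler_norm.
  rewrite expr2 mulrA ler_wpM2r// -!mulrA ler_wpM2l//.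
  by rewrite ler_pdivrMl.
have h4 : (enorm xbs + e + `|r| * e) * D <= (enorm xbs + e + `|r| * e) * (2 * W).
  by rewrite ler_wpM2l// !addr_ge0 ?enorm_ge0 ?mulr_ge0 ?(ltW e0).
rewrite /=; lra.
Qed.

Lemma resolvent_fattentive (uk : nat -> 'rV[R]_n) u : (forall k, eball ub d (uk k)) ->
  eball ub d u -> uk k @[k --> \oo] --> u ->
  fattentive f (fun k => (P (uk k), Q (uk k))) (P u, Q u).
Proof.
move=> ukd ud uku.
have nu0 := cvg_scaled_enormB 2 uku.
have c1 : P (uk k) @[k --> \oo] --> P u.
  by apply: cvg_enorm0 nu0 => k; exact: resolvent_lipschitz.
split => //=.
- by move=> k; have [] := Pd (ukd k).
- by apply: cvgZ; [exact: cvg_cst|exact: (cvgB uku c1)].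
have fP v : eball ub d v -> f (P v) \is a fin_num by move=> /Pd[[]].
rewrite -(fineK (fP _ ud)); apply: cvg_EFin.
  by apply: nearW => k; exact: fP.
have [C C0 hC] := resolvent_value_le.
have Cu0 := cvg_scaled_enormB C uku.
apply/cvgrPdist_lt => ep ep0; have /cvgrPdist_lt/(_ ep ep0) := Cu0.
apply: filterS => k; rewrite sub0r normrN ger0_norm ?mulr_ge0 ?enorm_ge0//.
move=> hk; have := hC _ _ ud (ukd k); have := hC _ _ (ukd k) ud.
rewrite (enormB u (uk k)) ltr_norml /= => h1 h2; apply/andP; split; lra.
Qed.

Lemma resolvent_ftangent (t : nat -> R) (uk : nat -> 'rV[R]_n) (u a w : 'rV[R]_n) :
  (forall k, 0 < t k) -> t k @[k --> \oo] --> (0 : R) ->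
  (forall k, eball ub d (uk k)) -> eball ub d u -> uk k @[k --> \oo] --> u ->
  (t k)^-1 *: (P (uk k) - P u) @[k --> \oo] --> a ->
  (t k)^-1 *: (uk k - u) @[k --> \oo] --> w ->
  ftangent f (P u, Q u) (a, lam^-1 *: (w - a)).
Proof.
move=> t0 tc ukd ud uku ca cw.
exists t, (fun k => (P (uk k), Q (uk k))); split => //=.
  exact: resolvent_fattentive.
have -> : (fun k => (t k)^-1 *: (Q (uk k) - Q u)) =
  (fun k => lam^-1 *: ((t k)^-1 *: (uk k - u) - (t k)^-1 *: (P (uk k) - P u))).
  apply/funext => k; rewrite -!scalerBr scalerA mulrC -scalerA; congr (_ *: (_ *: _)).
  by apply/rowP => i; rewrite !mxE; ring.
by apply: cvgZ; [exact: cvg_cst|exact: (cvgB cw ca)].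
Qed.

Lemma eball_dir u w : eball ub d u -> exists2 tau, 0 < tau & forall t, 0 <= t < tau ->
  eball ub d (u + t *: w).
Proof.
rewrite /eball /= => ud; exists ((d - enorm (u - ub)) / (enorm w + 1)).
  by rewrite divr_gt0 ?subr_gt0// ltr_wpDl ?enorm_ge0.
have w1 : 0 < enorm w + 1 by rewrite ltr_wpDl ?enorm_ge0.
move=> t /andP[t0]; rewrite ltr_pdivlMr// => tw.
rewrite addrAC (le_lt_trans (ler_enormD _ _))// enormZ ger0_norm//.
have : t * enorm w <= t * (enorm w + 1) by rewrite ler_wpM2l// lerDl.
lra.
Qed.

(** [P] need not have a directional derivative at [u]: its quotients along [w] are bounded by the
    Lipschitz constant, and a cluster point supplies the tangent vector. *)
Lemma resolvent_ftangent_exists (u w : 'rV[R]_n) : eball ub d u ->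
  exists a, ftangent f (P u, Q u) (a, lam^-1 *: (w - a)).
Proof.
move=> ud; have [tau tau0 htau] := eball_dir w ud.
pose q t := t^-1 *: (P (u + t *: w) - P u).
have qb t : 0 < t < tau -> enorm (q t) <= 2 * enorm w.
  move=> /andP[t0 tt]; rewrite enormZ gtr0_norm ?invr_gt0// ler_pdivrMl//.
  have := resolvent_lipschitz (htau t _) ud; rewrite (ltW t0) tt => /(_ isT).
  by rewrite addrAC subrr add0r enormZ gtr0_norm// mulrCA.
pose F := q @ 0^'+.
have n0 (c : R) : 0 < c -> \forall t \near 0^'+, 0 < t /\ t < c.
  move=> c0; near=> t0; split; first by near: t0; exact: nbhs_right_gt.
  by near: t0; exact: nbhs_right_lt.
have FK : F [set y | enorm (y - 0) <= 2 * enorm w].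
  by apply: filterS (n0 _ tau0) => t tt; rewrite /= subr0; apply/qb/andP.
have [a [_ acl]] := @compact_closed_eball R n 0 (2 * enorm w) F _ FK.
have /(_ _)/cid-/all_sig[t tP] : forall k : nat, exists t, [/\ 0 < t, t < tau, t < k.+1%:R^-1 &
    enorm (q t - a) < k.+1%:R^-1].
  move=> k; have k0 : 0 < k.+1%:R^-1 :> R by rewrite invr_gt0.
  have /acl : F [set q t | t in [set t | [/\ 0 < t, t < tau & t < k.+1%:R^-1]]].
    by apply: filterS2 (n0 _ tau0) (n0 _ k0) => t [t0 tt] [_ tk]; exists t.
  have ab : nbhs a (eball a k.+1%:R^-1) by apply/nbhs_eballP; exists k.+1%:R^-1.
  by move=> /(_ _ ab)[_ [[t [t0 tt tk] <-] qt]]; exists t.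
exists a.
have h0 : k.+1%:R^-1 @[k --> \oo] --> (0 : R) := cvg_harmonic.
have tc : t k @[k --> \oo] --> (0 : R).
  apply: (squeeze_cvgr _ (cvg_cst 0) h0); apply: nearW => k.
  by have [t0 _ tk _] := tP k; rewrite (ltW t0) ltW.
apply: (resolvent_ftangent (t := t) (uk := fun k => u + t k *: w)) => //.
- by move=> k; have [] := tP k.
- by move=> k; have [t0 tt _ _] := tP k; apply: htau; rewrite (ltW t0).
- have : u + t k *: w @[k --> \oo] --> u + (0 : R) *: w.
    exact: (cvgD (cvg_cst u) (cvgZ tc (cvg_cst w))).
  by rewrite scale0r addr0.
- by apply: (cvg_enorm0 (b := fun k => k.+1%:R^-1)) => // k; have [_ _ _ /ltW] := tP k.
rewrite (_ : (fun k => _) = (fun=> w)); first exact: cvg_cst.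
apply/funext => k; have [t0 _ _ _] := tP k.
by rewrite addrAC subrr add0r scalerA mulVf ?gt_eqF// scale1r.
Unshelve. all: by end_near. Qed.

Lemma resolvent_ftangent_frechet u A : eball ub d u -> frechet P u A ->
  ftangent f (P u, Q u) = [set z | exists p : 'rV[R]_n, z = (p *m A, lam^-1 *: (p - p *m A))].
Proof.
move=> ud PA; apply/seteqP; split.
  move=> [w1 w2] [t [zk [t0 tc zkz c1 c2]]]; rewrite /= in c1 c2.
  have gk := fattentive_local_gph (z := (P u, Q u)) (Pd ud) zkz.
  (* Eventually every point of an attentive sequence is the resolvent point of [uk k], so arbitrary
     tangent sequences reduce to quotients of [P]. *)
  pose uk k := (zk k).1 + lam *: (zk k).2.
  pose p := w1 + lam *: w2.
  have cp : (t k)^-1 *: (uk k - u) @[k --> \oo] --> p.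
    have : (t k)^-1 *: ((zk k).1 - P u) + lam *: ((t k)^-1 *: ((zk k).2 - Q u))
        @[k --> \oo] --> p by exact: (cvgD c1 (cvgZ (cvg_cst lam) c2)).
    rewrite (_ : (fun k => _ + _) = (fun k => (t k)^-1 *: (uk k - u)))//.
    apply/funext => k; rewrite -[u in RHS]resolventK /uk scalerA mulrC -scalerA.
    by rewrite -scalerDr; congr (_ *: _); apply/rowP => i; rewrite !mxE; ring.
  exists p.
  have w1A : w1 = p *m A.
    apply/eqP; rewrite -subr_eq0 -normr_le0 leNgt; apply/negP => N0.
    set N := `|w1 - p *m A| in N0.
    (* With this accuracy the limit of the quotients gives [N <= N * |p| / (|p| + 1)], absurd for
       positive [N]. *)
    have ep0 : 0 < N / (`|p| + 1) by rewrite divr_gt0// ltr_wpDl.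
    have [dl dl0 dlP] := PA _ ep0.
    have uku : uk k - u @[k --> \oo] --> (0 : 'rV[R]_n).
      have : t k *: ((t k)^-1 *: (uk k - u)) @[k --> \oo] --> (0 : R) *: p.
        exact: (cvgZ tc cp).
      rewrite scale0r (_ : (fun k => t k *: _) = (fun k => uk k - u))//.
      by apply/funext => k; rewrite scalerA mulfV ?gt_eqF// scale1r.
    have small : \forall k \near \oo, `|uk k - u| < dl.
      by have /cvgrPdist_lt/(_ _ dl0) := uku; apply: filterS => k; rewrite sub0r normrN.
    have cA : ((t k)^-1 *: (uk k - u)) *m A @[k --> \oo] --> p *m A.
      have := lipschitz_map_continuous (lipschitz_mulmx A 0) => /(_ p).
      by move=> /(cvg_comp _ _ cp); rewrite add0r;
        under [X in X @ _ --> _]eq_fun do rewrite /= add0r.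
    have cv : `|(t k)^-1 *: ((zk k).1 - P u) - ((t k)^-1 *: (uk k - u)) *m A| -
        N / (`|p| + 1) * `|(t k)^-1 *: (uk k - u)| @[k --> \oo] -->
        N - N / (`|p| + 1) * `|p|.
      apply: cvgB; first by apply: cvg_norm; exact: (cvgB c1 cA).
      by apply: cvgM; [exact: cvg_cst|exact: cvg_norm].
    have : N - N / (`|p| + 1) * `|p| <= 0.
      have := @cvg_near_le R _ _ 0 cv; apply; near=> k.
      have g : local_gph f xb xbs e (zk k).1 (zk k).2 by near: k.
      have uks : `|uk k - u| < dl by near: k.
      rewrite -(resolvent_local_gph hm lam0 lamr g) -/(uk k).
      have := dlP _ uks; rewrite mulmx1 subrKC -scalemxAl -scalerBr !normrZ.
      rewrite subr_le0 mulrCA ler_pM2l// normr_gt0 invr_eq0 gt_eqF//.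
    have -> : N - N / (`|p| + 1) * `|p| = N / (`|p| + 1).
      have p1 : `|p| + 1 != 0 by rewrite gt_eqF// ltr_wpDl.
      by field.
    by rewrite leNgt ep0.
  by rewrite -w1A /p addrAC subrr add0r scalerA mulVf ?gt_eqF// scale1r.
move=> [w1 w2] [p [-> ->]].
have [tau tau0 htau] := eball_dir p ud.
pose t (k : nat) : R := tau / 2 * k.+1%:R^-1.
have t0 k : 0 < t k by rewrite mulr_gt0 ?invr_gt0// divr_gt0.
have tt k : t k < tau.
  rewrite /t -mulrA gtr_pMr// -invfM invf_lt1 ?mulr_gt0//.
  have : 1 <= k.+1%:R :> R by rewrite ler1n.
  lra.
have tc : t k @[k --> \oo] --> (0 : R).
  have : t k @[k --> \oo] --> tau / 2 * 0 by exact: (cvgM (cvg_cst _) cvg_harmonic).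
  by rewrite mulr0.
apply: (resolvent_ftangent (t := t) (uk := fun k => u + t k *: p)) => //.
- by move=> k; apply: htau; rewrite (ltW (t0 k)) tt.
- have : u + t k *: p @[k --> \oo] --> u + (0 : R) *: p.
    exact: (cvgD (cvg_cst u) (cvgZ tc (cvg_cst p))).
  by rewrite scale0r addr0.
- apply/cvgrPdist_le => ep ep0.
  have p1 : 0 < `|p| + 1 by rewrite ltr_wpDl.
  have [dl dl0 dlP] := PA (ep / (`|p| + 1)) (divr_gt0 ep0 p1).
  have /cvgrPdist_lt/(_ (dl / (`|p| + 1)) (divr_gt0 dl0 p1)) := tc.
  apply: filterS => k; rewrite sub0r normrN gtr0_norm// ltr_pdivlMr// => tp.
  have tpn : `|t k *: p| < dl.
    by rewrite normrZ gtr0_norm// (le_lt_trans _ tp)// ler_wpM2l ?(ltW (t0 k))// lerDl.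
  have := dlP _ tpn; rewrite mulmx1 normrZ (gtr0_norm (t0 k)) => hk.
  rewrite (_ : _ - _ = - ((t k)^-1 *: (P (u + t k *: p) - P u - (t k *: p) *m A))).
    rewrite normrN normrZ gtr0_norm ?invr_gt0// ler_pdivrMl// (le_trans hk)//.
    rewrite mulrCA ler_pM2l// mulrAC ler_pdivrMr// ler_pM2l// lerDl//.
  by rewrite [in RHS]scalerBr opprB -scalemxAl [in RHS]scalerA mulVf ?gt_eqF// scale1r.
rewrite (_ : (fun k => _) = (fun=> p)); first exact: cvg_cst.
apply/funext => k.
by rewrite addrAC subrr add0r scalerA mulVf ?gt_eqF// scale1r.
Unshelve. all: by end_near. Qed.

End resolvent_tangent.

End tangent.

(** * Tangent subspaces *)

Section dot_matrix.
Variable R : realType.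

Lemma dotv_mxE m (u v : 'rV[R]_m) : dotv u v = (u *m v^T) 0 0.
Proof. by rewrite mxE; apply: eq_bigr => i _; rewrite mxE. Qed.

Lemma dotv_mulmxl m k (u : 'rV[R]_m) (A : 'M[R]_(m, k)) v :
  dotv (u *m A) v = dotv u (v *m A^T).
Proof. by rewrite !dotv_mxE trmx_mul trmxK mulmxA. Qed.

Lemma dotv_row_mx m k (a a' : 'rV[R]_m) (b b' : 'rV[R]_k) :
  dotv (row_mx a b) (row_mx a' b') = dotv a a' + dotv b b'.
Proof. by rewrite !dotv_mxE tr_row_mx mul_row_col mxE. Qed.

Lemma mulmx_injective_unit m (C : 'M[R]_m) :
  (forall v : 'rV_m, v *m C = 0 -> v = 0) -> C \in unitmx.
Proof.
move=> h; rewrite -row_free_unit -kermx_eq0; apply/eqP/row_matrixP => i.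
rewrite row0; apply: h; apply/sub_kermxP; exact: row_sub.
Qed.

Lemma row_free_injective m k (B : 'M[R]_(m, k)) (v : 'rV_m) :
  row_free B -> v *m B = 0 -> v = 0.
Proof. by move=> fB vB; apply: (row_free_inj fB); rewrite vB mul0mx. Qed.

Lemma injective_row_free m k (B : 'M[R]_(m, k)) :
  (forall v : 'rV_m, v *m B = 0 -> v = 0) -> row_free B.
Proof.
move=> h; rewrite -kermx_eq0; apply/eqP/row_matrixP => i.
rewrite row0; apply: h; apply/sub_kermxP; exact: row_sub.
Qed.

Lemma gram_unit m k (M : 'M[R]_(m, k)) : row_free M -> M *m M^T \in unitmx.
Proof.
move=> fM; apply: mulmx_injective_unit => v vM.
apply: (row_free_injective fM); apply: dotvv_eq0.
by rewrite dotv_mulmxl -mulmxA vM dotv0r.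
Qed.

(** Gram's formula for a matrix [M] whose rows form a basis of the row space of [B]. *)
Lemma orth_proj_exists m k (B : 'M[R]_(m, k)) : exists Pi : 'M[R]_k,
  [/\ Pi^T = Pi, Pi *m Pi = Pi & (Pi :=: B)%MS].
Proof.
have [M fM MB] : exists2 M : 'M[R]_(\rank B, k), row_free M & (M :=: B)%MS.
  by exists (row_base B); [exact: row_base_free|exact: eq_row_base].
have uG := gram_unit fM.
have GT : (M *m M^T)^T = M *m M^T by rewrite trmx_mul trmxK.
exists (M^T *m invmx (M *m M^T) *m M); split.
- by rewrite trmx_mul (trmx_mul (M^T)) trmxK trmx_inv GT mulmxA.
- by rewrite -!mulmxA (mulmxA M) (mulmxA (M *m _)) mulmxV// mul1mx.
apply/eqmxP/andP; split; first by rewrite (submx_trans (submxMl _ _))// MB.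
rewrite -MB; apply/submxP; exists M.
by rewrite !mulmxA mulmxV// mul1mx.
Qed.

End dot_matrix.

Section operator_norm.
Variables (R : realType) (m : nat).

Lemma enorm_mulmx_bounded (A : 'M[R]_m) :
  exists c, forall u : 'rV[R]_m, enorm (u *m A) <= c * enorm u.
Proof.
exists (m%:R * (m%:R * `|A|)) => u.
rewrite (le_trans (enorm_le_norm _))// -mulrA ler_wpM2l//.
rewrite (le_trans (norm_mulmx_le _ _))// ler_wpM2l ?mulr_ge0//.
exact: norm_le_enorm.
Qed.

Lemma enorm_mulmx_le (A : 'M[R]_m) u : enorm (u *m A) <= opnorm A * enorm u.
Proof.
have [u0|u0] := eqVneq (enorm u) 0; first by rewrite (enorm_eq0 u0) mul0mx enorm0 mulr0.
have up : 0 < enorm u by rewrite lt_def u0 enorm_ge0.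
have [c hc] := enorm_mulmx_bounded A.
pose v := (enorm u)^-1 *: u.
have v1 : enorm v = 1 by rewrite enormZ gtr0_norm ?invr_gt0// mulVf.
have : enorm (v *m A) <= opnorm A.
  apply: ub_le_sup; last by exists v.
  by exists c => _ [w w1 <-]; rewrite (le_trans (hc w))// w1 mulr1.
by rewrite -scalemxAl enormZ gtr0_norm ?invr_gt0// ler_pdivrMl// mulrC.
Qed.

Lemma opnorm0 : opnorm (0 : 'M[R]_m) = 0.
Proof.
(* In dimension zero there is no unit vector, and the supremum of the empty set is 0. *)
rewrite /opnorm; have [->|/set0P[u u1]] := eqVneq [set u : 'rV[R]_m | enorm u = 1] set0.
  by rewrite image_set0 sup0.
rewrite (_ : [set _ | _ in _] = [set 0]) ?sup1//.
apply/seteqP; split => [_ [v _ <-]|_ ->]; first by rewrite mulmx0 enorm0.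
by exists u => //; rewrite mulmx0 enorm0.
Qed.

End operator_norm.

Section subspaces.
Variables (R : realType) (n : nat).
Implicit Types (L : set ('rV[R]_n * 'rV[R]_n)).

Lemma oprojP L : Znn L -> is_orth_proj L (oproj L).
Proof.
move=> [B [_ ->]]; apply: (@xgetPex _ 0); have [Pi [PT PP PB]] := orth_proj_exists B.
by exists Pi; split => // z; rewrite /= PB.
Qed.

(** The projection onto [L] fixes [z], so projecting [z] onto [T k] moves it by at most
    [subdist L (T k) * enorm (pair_row z)]. *)
Lemma subdist_approx L (T : nat -> set ('rV[R]_n * 'rV[R]_n)) z :
  Znn L -> (forall k, Znn (T k)) -> subdist L (T k) @[k --> \oo] --> (0 : R) -> L z ->
  exists zk, [/\ forall k, T k (zk k), (zk k).1 @[k --> \oo] --> z.1 &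
    (zk k).2 @[k --> \oo] --> z.2].
Proof.
move=> ZL ZT LT Lz; have [_ PP PL] := oprojP ZL.
pose v := pair_row z.
have vL : v *m oproj L = v.
  by have /PL/submxP[D vD] := Lz; rewrite /v vD -mulmxA PP.
pose vk k := v *m oproj (T k).
have vk_le k : enorm (vk k - v) <= subdist L (T k) * enorm v.
  have -> : vk k - v = - (v *m (oproj L - oproj (T k))) by rewrite mulmxBr vL opprB.
  rewrite enormN.
  exact: enorm_mulmx_le.
have c0 : subdist L (T k) * enorm v @[k --> \oo] --> (0 : R).
  rewrite -(mul0r (enorm v)); exact: (cvgM LT (cvg_cst _)).
have le_parts (w : 'rV[R]_(n + n)) :
    enorm (lsubmx w) <= enorm w /\ enorm (rsubmx w) <= enorm w.
  rewrite !le_enorm_dotv -[in X in _ <= X](hsubmxK w) -[in X in _ /\ (_ <= X)](hsubmxK w).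
  by rewrite !dotv_row_mx lerDl lerDr !dotvv_ge0.
exists (fun k => (lsubmx (vk k), rsubmx (vk k))); split => /=.
- move=> k; have [_ _ PT] := oprojP (ZT k); apply/PT.
  by rewrite /pair_row hsubmxK submxMl.
- apply: cvg_enorm0 c0 => k; apply: le_trans (vk_le k).
  have -> : lsubmx (vk k) - z.1 = lsubmx (vk k - v).
    by rewrite -{1}(row_mxKl z.1 z.2); apply/rowP => i; rewrite !mxE.
  by have [] := le_parts (vk k - v).
- apply: cvg_enorm0 c0 => k; apply: le_trans (vk_le k).
  have -> : rsubmx (vk k) - z.2 = rsubmx (vk k - v).
    by rewrite -{1}(row_mxKr z.1 z.2); apply/rowP => i; rewrite !mxE.
  by have [] := le_parts (vk k - v).
Qed.

Section resolvent_form.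
Variables (lam : R).
Hypothesis lam0 : 0 < lam.

(* The subspace parametrized by the derivative [A] of a resolvent. *)
Definition resolvent_space (A : 'M[R]_n) : set ('rV[R]_n * 'rV[R]_n) :=
  [set z | exists p : 'rV[R]_n, z = (p *m A, lam^-1 *: (p - p *m A))].

Lemma Znn_resolvent_space A : Znn (resolvent_space A).
Proof.
have l0 : lam != 0 by rewrite gt_eqF.
exists (row_mx A (lam^-1 *: (1%:M - A))); split.
  apply/eqP; change (row_free (row_mx A (lam^-1 *: (1%:M - A)))).
  apply: injective_row_free => v; rewrite mul_mx_row -row_mx0 => /eq_row_mx[vA].
  rewrite -scalemxAr mulmxBr mulmx1 vA subr0 => /eqP.
  by rewrite scaler_eq0 invr_eq0 (negbTE l0) => /eqP.
have pE (p : 'rV[R]_n) : p *m row_mx A (lam^-1 *: (1%:M - A)) =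
    row_mx (p *m A) (lam^-1 *: (p - p *m A)).
  by rewrite mul_mx_row -scalemxAr mulmxBr mulmx1.
apply/seteqP; split => [z [p ->]|z /= /submxP[p]].
  by rewrite /= /pair_row /= -pE submxMl.
rewrite pE => /eq_row_mx[h1 h2]; exists p.
by rewrite -h2 -h1; case: (z).
Qed.

(** The map [z.1 + lam *: z.2] is injective on [L]: in its kernel [z.1 = - lam *: z.2], and the
    lower bound with [lam * r <= 2^-1] forces [z.2 = 0]. As [L] has dimension [n], this map is a
    coordinate [p] on [L]. *)
Lemma Znn_resolvent_form L r : lam * r <= 2^-1 -> Znn L ->
  (forall z, L z -> - r * enorm z.1 ^+ 2 <= dotv z.2 z.1) ->
  exists A, L = resolvent_space A.
Proof.
move=> lamr [B [rB LE]] Lr.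
have l0 : lam != 0 by rewrite gt_eqF.
pose B1 := lsubmx B; pose B2 := rsubmx B; have BE : B = row_mx B1 B2 by rewrite hsubmxK.
have LP (v : 'rV_n) : L (v *m B1, v *m B2).
  by rewrite LE /= /pair_row /= -mul_mx_row -BE submxMl.
pose C := B1 + lam *: B2.
have uC : C \in unitmx.
  apply: mulmx_injective_unit => v; rewrite mulmxDr -scalemxAr => /eqP.
  rewrite addr_eq0 => /eqP vB.
  have fB : row_free B by rewrite /row_free rB.
  have := Lr _ (LP v); rewrite /= vB -scaleNr enormZ dotvZr.
  rewrite -sqr_enorm exprMn real_normK ?num_real// => h.
  have b0 : v *m B2 = 0.
    apply: enorm_eq0; apply/eqP; rewrite -sqrf_eq0 eq_le sqr_ge0 andbT.
    set N := enorm _ ^+ 2 in h *; have N0 : 0 <= N := sqr_ge0 _.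
    have {}h : 0 <= lam * ((lam * r - 1) * N) by lra.
    rewrite pmulr_rge0// in h.
    have h' : (1 - lam * r) * N <= 0 by lra.
    have := ler_wpM2r N0 lamr; lra.
  apply: (row_free_injective fB); rewrite BE mul_mx_row vB b0.
  by rewrite scaler0 oppr0 row_mx0.
exists (invmx C *m B1); apply/seteqP; split => z.
  rewrite LE /= => /submxP[v]; rewrite BE mul_mx_row => /eq_row_mx[z1 z2].
  exists (v *m C); rewrite mulmxA mulmxK// -z1 mulmxDr -z1 addrAC subrr add0r.
  by rewrite -scalemxAr scalerK// -z2; case: (z).
move=> [p ->]; have := LP (p *m invmx C); congr (L (_, _)); first by rewrite mulmxA.
rewrite -[p in p - _](mulmxKV uC) [in X in X - _]mulmxDr mulmxA addrAC subrr add0r.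
by rewrite -scalemxAr scalerK.
Qed.

(* With [c = 1 + lam s], both the hypothesis and the conclusion say that [1 - 2 c A]
   is a contraction, respectively on the left and on the right. *)
Lemma resolvent_space_polar (A : 'M[R]_n) (s : R) : 0 < 1 + lam * s ->
  (forall z zs : 'rV[R]_n, (forall w, resolvent_space A w -> dotp (zs, - z) w <= 0) ->
     s * enorm z ^+ 2 <= dotv zs z) ->
  forall z, resolvent_space A z -> s * enorm z.1 ^+ 2 <= dotv z.2 z.1.
Proof.
move=> c0 hA _ [p ->] /=; have l0 : lam != 0 by rewrite gt_eqF.
set c := 1 + lam * s in c0.
have h1 (y : 'rV[R]_n) : c * dotv (y *m A^T) (y *m A^T) <= dotv y (y *m A^T).
  (* The polar contains the vectors built from [A^T] as the tangent vectors are from [A], with a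
     change of sign in the second block. *)
  have := hA (y *m A^T) (lam^-1 *: (y - y *m A^T)).
  have -> : (forall w, resolvent_space A w ->
      dotp (lam^-1 *: (y - y *m A^T), - (y *m A^T)) w <= 0) = True.
    apply/propext; split => // _ _ [q ->]; rewrite /dotp /= !dotvE.
    have yq : dotv (y *m A^T) q = dotv y (q *m A) by rewrite dotv_mulmxl trmxK.
    by rewrite le_eqVlt; apply/orP; left; apply/eqP; rewrite yq; ring.
  move=> /(_ I); rewrite sqr_enorm !dotvE -(ler_pM2l lam0).
  rewrite mulrA mulVKf// /c; lra.
pose K (q : 'rV[R]_n) := q - 2 * c *: (q *m A); pose K' (q : 'rV[R]_n) := q - 2 * c *: (q *m A^T).
have K'le q : enorm (K' q) <= enorm q.
  rewrite le_enorm_dotv /K' !dotvE (dotvC _ q).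
  have := ler_wpM2l (ltW c0) (h1 q); lra.
have Kle q : enorm (K q) <= enorm q.
  have [K0|K0] := eqVneq (enorm (K q)) 0; first by rewrite K0 enorm_ge0.
  have Kp : 0 < enorm (K q) by rewrite lt_def K0 enorm_ge0.
  rewrite -(ler_pM2r Kp) -expr2 sqr_enorm.
  have -> : dotv (K q) (K q) = dotv q (K' (K q)).
    move: {2 3}(K q) => X.
    by rewrite /K /K' dotvDl dotvNl dotvZl dotv_mulmxl dotvDr dotvNr dotvZr.
  by rewrite (le_trans (ler_dotv _ _))// ler_wpM2l ?enorm_ge0.
have := Kle p; rewrite le_enorm_dotv /K sqr_enorm !dotvE (dotvC (p *m A) p).
set X := dotv p (p *m A); set Y := dotv (p *m A) (p *m A); set Z := dotv p p => h.
have {}h : c * (c * Y) <= c * X by lra.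
rewrite ler_pM2l// in h.
by rewrite -(ler_pM2l lam0) mulVKf//; rewrite /c in h; lra.
Qed.

End resolvent_form.
End subspaces.

(** * Pairs [(P, W)] and the subspaces they parametrize *)

Section projection_pairs.
Variables (R : realType) (n : nat).
Implicit Types (A P W : 'M[R]_n).

(** The relation between [W] and [P] gives [W P = W - 1 + P], which is symmetric. So [P] and [W]
    commute, [P W P = W P], and the quadratic form at [p] is exactly the difference of the two
    sides. *)
Lemma psd_projection_pair P W (s : R) : P^T = P -> W^T = W -> P *m P = P ->
  W *m (1%:M - P) = 1%:M - P ->
  psd (P *m W *m P - s *: P) <->
  forall p : 'cV[R]_n, s * enorm ((P *m p)^T) ^+ 2 <= dotv ((W *m p)^T) ((P *m p)^T).
Proof.
move=> PT WT PP WP.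
have WPE : W *m P = W - 1%:M + P.
  by have := WP; rewrite mulmxBr mulmx1 => /eqP; rewrite subr_eq => /eqP {2}->;
    rewrite addrAC -addrA addrACA subrK; apply/matrixP => i j; rewrite !mxE; ring.
have PWP : P *m W *m P = W *m P.
  have PW : P *m W = W *m P.
    rewrite -[LHS]trmxK trmx_mul PT WT WPE !linearD linearN /= PT WT trmx1 //.
  by rewrite PW -mulmxA PP.
have sqP (p : 'cV[R]_n) : enorm ((P *m p)^T) ^+ 2 = (p^T *m P *m p) 0 0.
  by rewrite sqr_enorm dotv_mxE trmxK trmx_mul PT !mulmxA -(mulmxA p^T P P) PP.
have WPp (p : 'cV[R]_n) : dotv ((W *m p)^T) ((P *m p)^T) = (p^T *m (W *m P) *m p) 0 0.
  by rewrite dotv_mxE trmxK trmx_mul WT !mulmxA.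
have E (p : 'cV[R]_n) : (p^T *m (P *m W *m P - s *: P) *m p) 0 0 =
    dotv ((W *m p)^T) ((P *m p)^T) - s * enorm ((P *m p)^T) ^+ 2.
  rewrite WPp sqP PWP mulmxBr mulmxBl -scalemxAr -scalemxAl [LHS]mxE [X in _ + X]mxE.
  by rewrite [X in _ + - X]mxE.
by split=> h p; have := h p; rewrite E subr_ge0.
Qed.

(** [P] projects onto the range of [A], where a symmetric [A] is invertible; [S] extends this
    restriction by the identity. [W] acts as [(A^-1 - 1) / lam] on the range and as the identity on
    its orthogonal complement. *)
Lemma resolvent_space_projection_pair A (lam : R) : 0 < lam -> A^T = A ->
  exists P W, [/\ P^T = P, W^T = W, P *m P = P, W *m (1%:M - P) = 1%:M - P &
    [set ((P *m p)^T, (W *m p)^T) | p in [set: 'cV[R]_n]] = resolvent_space lam A].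
Proof.
move=> lam0 AT; have l0 : lam != 0 by rewrite gt_eqF.
have [P [PT PP PA]] := orth_proj_exists A.
have AP : A *m P = A.
  have /submxP[D AD] : (A <= P)%MS by rewrite PA.
  by rewrite AD -mulmxA PP.
have AP' : P *m A = A by rewrite -[LHS]trmxK trmx_mul AT PT AP AT.
pose S := A + (1%:M - P).
have SP : S *m P = A by rewrite mulmxDl AP mulmxBl mul1mx PP subrr addr0.
have PS : P *m S = A by rewrite mulmxDr AP' mulmxBr mulmx1 PP subrr addr0.
have ST : S^T = S by rewrite !linearD linearN /= AT PT trmx1.
have uS : S \in unitmx.
  apply: mulmx_injective_unit => x xS.
  have xA : x *m A = 0 by rewrite -SP mulmxA xS mul0mx.
  have xP : x = x *m P.
    by move/eqP: xS; rewrite mulmxDr xA add0r mulmxBr mulmx1 subr_eq0 => /eqP.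
  have /submxP[y yx] : (x <= A)%MS by rewrite -PA xP submxMl.
  by apply: dotvv_eq0; rewrite {2}yx -{1}AT -dotv_mulmxl xA dotv0l.
pose T := invmx S.
have TS : T *m S = 1%:M by exact: mulVmx.
have S_T : S *m T = 1%:M by exact: mulmxV.
have TP : T *m P = P *m T.
  by rewrite -[LHS]mulmx1 -S_T mulmxA -(mulmxA T P S) PS -SP !mulmxA TS mul1mx.
have TT : T^T = T by rewrite /T trmx_inv ST.
have TA : T *m A = P by rewrite -SP mulmxA TS mul1mx.
have AT' : A *m T = P by rewrite -PS -mulmxA S_T mulmx1.
pose W := lam^-1 *: (T *m P - P) + (1%:M - P).
have P0 : P *m (1%:M - P) = 0 by rewrite mulmxBr mulmx1 PP subrr.
have P0' : (1%:M - P) *m P = 0 by rewrite mulmxBl mul1mx PP subrr.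
have PP1 : (1%:M - P) *m (1%:M - P) = 1%:M - P.
  by rewrite mulmxBl mul1mx P0 subr0.
exists P, W; split => //.
- by rewrite /W linearD linearZ /= !linearB /= trmx1 trmx_mul TT PT TP.
- rewrite /W mulmxDl PP1 -scalemxAl mulmxBl P0 -mulmxA P0 mulmx0 subrr scaler0 add0r.
  by [].
have WE (p : 'cV[R]_n) :
    W *m p = lam^-1 *: (T *m P *m p - P *m p) + (1%:M - P) *m p.
  by rewrite /W [LHS]mulmxDl -scalemxAl [(T *m P - P) *m p]mulmxBl.
apply/seteqP; split => [_ [p _ <-]|_ [q ->]].
  (* On the range [q] inverts [A]. The complementary part is invisible to [A] and gets divided by
     [lam] in the second block, hence its factor [lam]. *)
  pose q : 'cV[R]_n := T *m P *m p + lam *: ((1%:M - P) *m p).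
  have Aq : A *m q = P *m p.
    have A0 : A *m (1%:M - P) = 0 by rewrite mulmxBr mulmx1 AP subrr.
    by rewrite /q mulmxDr -scalemxAr !mulmxA AT' PP A0 mul0mx scaler0 addr0.
  exists q^T; rewrite -{1 2}AT -trmx_mul Aq; congr (_, _).
  rewrite -linearB -linearZ /=; congr (_^T).
  by rewrite WE /q [in RHS]addrAC [in RHS]scalerDr [in RHS]scalerA mulVf// scale1r.
pose c := q^T; pose p := A *m c + lam^-1 *: ((1%:M - P) *m c).
have Pp : P *m p = A *m c.
  by rewrite /p mulmxDr -scalemxAr !mulmxA AP' P0 mul0mx scaler0 addr0.
have Wp : W *m p = lam^-1 *: (c - A *m c).
  rewrite WE -(mulmxA T) Pp !mulmxA TA.
  have -> : (1%:M - P) *m p = lam^-1 *: ((1%:M - P) *m c).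
    rewrite /p mulmxDr -scalemxAr !mulmxA PP1 -{1}AP' mulmxA P0' !mul0mx add0r.
    by [].
  by rewrite -scalerDr mulmxBl mul1mx addrC addrA subrK.
exists p => //; rewrite Pp Wp /c linearZ /= linearB /= !trmx_mul trmxK AT.
by [].
Qed.

End projection_pairs.

(** * Potentials with Lipschitz or differentiable subgradient maps *)

Lemma quadratic_increment_le (R : realType) (G : R -> R) (C : R) : 0 <= C ->
  (forall a b, 0 <= a -> a <= b -> b <= 1 -> - (C * (b - a) ^+ 2) <= G b - G a) ->
  G 0 <= G 1.
Proof.
move=> C0 hG.
(* Over [N.+1] equal steps the losses add up to at most [C / (N + 1)], which vanishes in the limit.
   This integrates along a segment without differentiating [G]. *)
have step N k : (k <= N.+1)%N ->
    - (C * N.+1%:R^-1) * (k%:R * N.+1%:R^-1) <= G (k%:R * N.+1%:R^-1) - G 0.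
  have i0 : 0 < N.+1%:R^-1 :> R by rewrite invr_gt0.
  elim: k => [_|k IH kN]; first by rewrite mul0r mulr0 subrr.
  have {}IH := IH (ltnW kN).
  have := hG (k%:R * N.+1%:R^-1) (k.+1%:R * N.+1%:R^-1).
  rewrite -mulrBl -natrB// subSnn mul1r => h.
  have : - (C * N.+1%:R^-1 ^+ 2) <= G (k.+1%:R * N.+1%:R^-1) - G (k%:R * N.+1%:R^-1).
    apply: h; first by rewrite mulr_ge0// ltW.
      by rewrite ler_wpM2r ?ler_nat// ltW.
    by rewrite ler_pdivrMr// mul1r ler_nat.
  rewrite -[k.+1]addn1 natrD mulrDl mul1r; set i := N.+1%:R^-1 in IH *; lra.
rewrite -subr_ge0.
have h : - (C * N.+1%:R^-1) @[N --> \oo] --> - (C * 0).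
  apply: cvgN; apply: cvgM; [exact: cvg_cst|exact: cvg_harmonic].
rewrite mulr0 oppr0 in h.
apply: (cvg_near_le h); apply: nearW => N.
by have := step N N.+1 (leqnn _); rewrite mulfV ?pnatr_eq0// mulr1.
Qed.

Section subgradient_map.
Variables (R : realType) (n : nat) (U : set 'rV[R]_n).
Variables (phi : 'rV[R]_n -> R) (P : 'rV[R]_n -> 'rV[R]_n).
Hypothesis cU : convex_set_rV U.
Hypothesis phiP : forall u v, U u -> U v -> phi u + dotv (P u) (v - u) <= phi v.

Lemma convex_segment u v (t : R) : U u -> U v -> 0 <= t <= 1 -> U (u + t *: (v - u)).
Proof.
move=> Uu Uv t01; have := cU Uv Uu t01; congr U.
by apply/rowP => i; rewrite !mxE; ring.
Qed.

(** The subgradient inequality at the later of two points of the segment bounds the growth of [phi]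
    by the growth of the quadratic up to a square of the step, as [quadratic_increment_le]
    requires. *)
Lemma subgradient_upper_bound (q : R) u v : U u -> U v -> 0 <= q ->
  (forall t, 0 <= t <= 1 ->
    dotv (P (u + t *: (v - u)) - P u) (t *: (v - u)) <= t ^+ 2 * q) ->
  phi v <= phi u + dotv (P u) (v - u) + q / 2.
Proof.
move=> Uu Uv q0 hq.
pose G t := t * dotv (P u) (v - u) + t ^+ 2 * (q / 2) - phi (u + t *: (v - u)).
have : G 0 <= G 1.
  apply: (@quadratic_increment_le _ _ (q / 2)); first by rewrite divr_ge0.
  move=> a b a0 ab b1.
  have b0 := le_trans a0 ab; have a1 := le_trans ab b1.
  have Ua : U (u + a *: (v - u)) by apply: convex_segment; rewrite ?a0.
  have Ub : U (u + b *: (v - u)) by apply: convex_segment; rewrite ?b0.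
  have := phiP Ub Ua.
  rewrite (_ : u + a *: (v - u) - (u + b *: (v - u)) = - ((b - a) *: (v - u))); last first.
    by apply/rowP => i; rewrite !mxE; ring.
  rewrite dotvNr dotvZr => h1.
  have h2 : dotv (P (u + b *: (v - u))) (v - u) <= dotv (P u) (v - u) + b * q.
    have [->|bn0] := eqVneq b 0; first by rewrite scale0r addr0 mul0r addr0.
    have bp : 0 < b by rewrite lt_def bn0.
    have := hq b; rewrite b0 b1 => /(_ isT).
    rewrite dotvZr expr2 -mulrA ler_pM2l// dotvDl dotvNl; lra.
  have h3 : (b - a) * dotv (P (u + b *: (v - u))) (v - u) <=
      (b - a) * (dotv (P u) (v - u) + b * q) by rewrite ler_wpM2l// subr_ge0.
  rewrite /G; set X := dotv (P u) _ in h3 *; set Y := dotv _ _ in h1 h3.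
  set pa := phi (u + a *: _) in h1 *; set pb := phi _ in h1 *; lra.
rewrite /G scale0r scale1r addr0 subrKC; lra.
Qed.

(** Integrates the first-order expansion of [P] along the segment from [u + t *: x] to [u + t *: y];
    the factor [2^-1 * (x + y)] is the mean of its points. Around a closed triangle the increments
    of [phi] cancel, which isolates the skew part of [A]. *)
Lemma subgradient_second_order u A (x y : 'rV[R]_n) (ep : R) : nbhs u U -> frechet P u A ->
  0 < ep -> exists2 T, 0 < T & forall t, 0 < t < T ->
  phi (u + t *: x) + t * dotv (P u) (y - x) +
    t ^+ 2 * (2^-1 * dotv ((x + y) *m A) (y - x) - ep) <= phi (u + t *: y).
Proof.
move=> /nbhs_ballP[rho /= rho0 rhoU] PA ep0.
pose K := n%:R * enorm (y - x); pose M := `|x| + `|y| + 1.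
have K0 : 0 <= K by rewrite mulr_ge0 ?enorm_ge0.
have M0 : 0 < M by rewrite ltr_wpDl// addr_ge0.
have K1 : 0 < K * M + 1 by rewrite ltr_wpDl// mulr_ge0// ltW.
have [dl dl0 dlP] := PA (ep / (K * M + 1)) (divr_gt0 ep0 K1).
exists (Num.min rho dl / M); first by rewrite divr_gt0// lt_min rho0.
move=> t /andP[t0]; rewrite ltr_pdivlMr// lt_min => /andP[trho tdl].
pose z a := x + a *: (y - x).
have zM a : 0 <= a <= 1 -> `|t *: z a| <= t * M.
  move=> /andP[a0 a1]; rewrite normrZ gtr0_norm// ler_pM2l//.
  rewrite (_ : z a = (1 - a) *: x + a *: y); last by apply/rowP => i; rewrite !mxE; ring.
  rewrite (le_trans (ler_normD _ _))// !normrZ !ger0_norm ?subr_ge0//.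
  have h1 : (1 - a) * `|x| <= `|x| by rewrite ler_piMl// lerBlDr lerDl.
  have h2 : a * `|y| <= `|y| by rewrite ler_piMl.
  by rewrite /M; lra.
have zU a : 0 <= a <= 1 -> U (u + t *: z a).
  move=> /zM h; apply: rhoU; rewrite -ball_normE /= opprD addrA subrr add0r normrN.
  exact: le_lt_trans h trho.
have hz a : 0 <= a <= 1 -> dotv (P u) (y - x) + t * (dotv (z a *m A) (y - x) - ep) <=
    dotv (P (u + t *: z a)) (y - x).
  move=> a01; have := dlP _ (le_lt_trans (zM a a01) tdl); rewrite mulmx1.
  set B := _ - _ - _ => hB.
  have PE : P (u + t *: z a) = P u + t *: (z a *m A) + B.
    rewrite /B -scalemxAl; move: (z a *m A) (P (u + _)) => Z W.
    by apply/rowP => i; rewrite !mxE; ring.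
  rewrite PE; clearbody B; rewrite !dotvDl dotvZl.
  have : `|dotv B (y - x)| <= t * ep.
    rewrite (le_trans (ler_norm_dotv_norm _ _))// -/K (le_trans (ler_wpM2l K0 hB))//.
    have := ler_wpM2l K0 (ler_wpM2l (ltW (divr_gt0 ep0 K1)) (zM a a01)).
    move=> /le_trans; apply.
    have -> : K * (ep / (K * M + 1) * (t * M)) = t * ep * (K * M / (K * M + 1)).
      by move: (_^-1) => c; ring.
    rewrite ler_piMr ?mulr_ge0 ?(ltW t0) ?(ltW ep0)//.
    by rewrite ler_pdivrMr// mul1r lerDl.
  by rewrite ler_norml => /andP[h _]; lra.
pose al := t * dotv (P u) (y - x) + t ^+ 2 * (dotv (x *m A) (y - x) - ep).
pose be := t ^+ 2 * dotv ((y - x) *m A) (y - x).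
(* The integrand [al + a * be] is affine in [a], so sums at left end points err by [be / 2] times
   the square of the step. *)
pose G a := phi (u + t *: z a) - a * al - a ^+ 2 * (be / 2).
have : G 0 <= G 1.
  apply: (@quadratic_increment_le _ _ (`|be| / 2)); first by rewrite divr_ge0.
  move=> a b a0 ab b1; have a1 := le_trans ab b1; have b0 := le_trans a0 ab.
  have a01 : 0 <= a <= 1 by rewrite a0.
  have b01 : 0 <= b <= 1 by rewrite b0.
  have := phiP (zU a a01) (zU b b01).
  rewrite (_ : u + t *: z b - (u + t *: z a) = ((b - a) * t) *: (y - x)); last first.
    by apply/rowP => i; rewrite !mxE; ring.
  rewrite dotvZr => h1.
  have bat : 0 <= (b - a) * t by rewrite mulr_ge0 ?subr_ge0// ltW.
  have h2 := ler_wpM2l bat (hz a a01).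
  have zA : dotv (z a *m A) (y - x) = dotv (x *m A) (y - x) + a * dotv ((y - x) *m A) (y - x).
    by rewrite /z mulmxDl -scalemxAl dotvDl dotvZl.
  rewrite zA in h2.
  have h3 : be * (b - a) ^+ 2 <= `|be| * (b - a) ^+ 2 by rewrite ler_wpM2r ?sqr_ge0// ler_norm.
  move: h1 h2 h3; rewrite /G /al /be.
  set pa := phi (u + t *: z a); set pb := phi (u + t *: z b).
  set D := dotv (P u) _; set E := dotv (P _) _; set X := dotv _ _; set Y := dotv _ _.
  set N := `|_|; lra.
rewrite /G /z !scale0r !scale1r !addr0 subrKC /al /be.
rewrite (_ : dotv ((x + y) *m A) (y - x) =
  2 * dotv (x *m A) (y - x) + dotv ((y - x) *m A) (y - x)); first by lra.
rewrite -dotvZl -dotvDl; congr dotv; rewrite scalemxAl -mulmxDl; congr mulmx.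
by apply/rowP => i; rewrite !mxE; ring.
Qed.

(** Adding the estimates along the triangle 0, [x], [y] cancels [phi] and the first-order terms and
    leaves half of [<x A, y> - <y A, x>], up to three errors [ep / 6]. *)
Lemma subgradient_derivative_symmetric u A : nbhs u U -> frechet P u A -> A^T = A.
Proof.
move=> uU PA.
have half (x y : 'rV[R]_n) : dotv (x *m A) y <= dotv (y *m A) x.
  apply/ler_addgt0Pr => ep ep0.
  have ep1 : 0 < ep / 6 by rewrite divr_gt0.
  have [T1 T10 h1] := subgradient_second_order 0 x uU PA ep1.
  have [T2 T20 h2] := subgradient_second_order x y uU PA ep1.
  have [T3 T30 h3] := subgradient_second_order y 0 uU PA ep1.
  pose T := Num.min T1 (Num.min T2 T3).
  have T0 : 0 < T by rewrite !lt_min T10 T20.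
  pose t := T / 2; have t0 : 0 < t by rewrite divr_gt0.
  have : t < T by rewrite ltr_pdivrMr// ltr_pMr// ltr1n.
  rewrite !lt_min => /and3P[tT1 tT2 tT3].
  have := h1 t; have := h2 t; have := h3 t; rewrite t0 tT1 tT2 tT3.
  move=> /(_ isT) k3 /(_ isT) k2 /(_ isT) k1.
  have : t ^+ 2 * (2^-1 * (dotv (x *m A) y - dotv (y *m A) x) - ep / 2) <= 0.
    move: k1 k2 k3; rewrite !scaler0 !addr0 !add0r !subr0.
    rewrite !mulmxDl !dotvE.
    set a := phi u; set b := phi _; set c := phi _; lra.
  rewrite pmulr_rle0 ?exprn_gt0//; lra.
apply/matrixP => i j; rewrite mxE.
have E (k l : 'I_n) : dotv (delta_mx 0 k *m A) (delta_mx 0 l) = A k l.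
  rewrite -rowE /dotv (bigD1 l)//= big1 => [|m ml].
    by rewrite !mxE !eqxx mulr1 addr0.
  by rewrite !mxE eqxx /= (negbTE ml) mulr0.
by apply/eqP; rewrite eq_le -!E !half.
Qed.

End subgradient_map.

(** * Extension of local Lipschitz maps and local increment bounds *)

Section lipschitz_extension.
Variables (R : realType) (n : nat).
Implicit Types (c u v : 'rV[R]_n).

Lemma ler_norm_max (a s t : R) : `|Num.max a s - Num.max a t| <= `|s - t|.
Proof.
wlog st : s t / s <= t.
  by move=> h; have [/h//|/ltW/h] := leP s t; rewrite distrC (distrC t).
rewrite (ler0_norm (x := s - t)) ?subr_le0//.
by case: (leP a s) => as_; case: (leP a t) => at_; rewrite ler_norml; apply/andP; split; lra.
Qed.

Lemma ler_norm_min (a s t : R) : `|Num.min a s - Num.min a t| <= `|s - t|.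
Proof.
by rewrite -[Num.min a s]opprK -[Num.min a t]opprK !oppr_min -opprD normrN
  (le_trans (ler_norm_max _ _ _))// -opprD normrN.
Qed.

Definition clip c (rho : R) u : 'rV[R]_n :=
  \row_i Num.max (c 0 i - rho) (Num.min (c 0 i + rho) (u 0 i)).

Lemma clip_lipschitz c (rho : R) : lipschitz_map 1 (clip c rho).
Proof.
move=> u v; rewrite mul1r; apply: norm_row_le => // i; rewrite !mxE.
rewrite (le_trans (ler_norm_max _ _ _))// (le_trans (ler_norm_min _ _ _))//.
by have := norm_coord_le (u - v) i; rewrite !mxE.
Qed.

Lemma clip_bound c (rho : R) u : 0 <= rho -> `|clip c rho u - c| <= rho.
Proof.
move=> rho0; apply: norm_row_le => // i; rewrite !mxE ler_norml.
case: (leP (c 0 i + rho) (u 0 i)) => h1;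
  case: (leP (c 0 i - rho) _) => h2; apply/andP; split; lra.
Qed.

Lemma clip_id c (rho : R) u : `|u - c| <= rho -> clip c rho u = u.
Proof.
move=> uc; apply/rowP => i; rewrite mxE.
have := le_trans (norm_coord_le (u - c) i) uc; rewrite !mxE ler_norml => /andP[h1 h2].
by rewrite min_r ?max_r//; lra.
Qed.

(* Composing with the retraction onto a cube inscribed in the ball. *)
Lemma lipschitz_extension (P : 'rV[R]_n -> 'rV[R]_n) c (d L : R) : 0 < d -> 0 <= L ->
  (forall u v, eball c d u -> eball c d v -> enorm (P u - P v) <= L * enorm (u - v)) ->
  exists F rho M, [/\ 0 < rho, lipschitz_map M F & forall u, eball c rho u -> F u = P u].
Proof.
move=> d0 L0 PL; pose rho := d / n.+1%:R.
have rho0 : 0 < rho by rewrite divr_gt0.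
have cd u : eball c d (clip c rho u).
  rewrite /eball /= (le_lt_trans (enorm_le_norm _))//.
  rewrite (le_lt_trans (ler_wpM2l (ler0n _ _) (clip_bound _ _ (ltW rho0))))//.
  rewrite /rho mulrCA gtr_pMr// ltr_pdivrMr// mul1r ltr_nat//.
exists (P \o clip c rho), rho, (L * n%:R); split => //.
  move=> u v; rewrite (le_trans (norm_le_enorm _))// (le_trans (PL _ _ (cd u) (cd v)))//.
  rewrite -mulrA ler_wpM2l// (le_trans (enorm_le_norm _))// ler_wpM2l//.
  by have := clip_lipschitz c rho u v; rewrite mul1r.
move=> u uc; rewrite /= clip_id// (le_trans (norm_le_enorm _))//.
exact: ltW.
Qed.

Lemma frechet_eq_on (F P : 'rV[R]_n -> 'rV[R]_n) (U : set 'rV[R]_n) u A :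
  open U -> U u -> (forall v, U v -> F v = P v) -> frechet F u A -> frechet P u A.
Proof.
rewrite openE => /[apply] /nbhs_ballP[r /= r0 rU] FP FA e e0.
have [d d0 dP] := FA e e0; exists (Num.min r d); first by rewrite lt_min r0.
move=> h; rewrite lt_min => /andP[hr hd]; rewrite -!FP.
- exact: dP.
- by apply: rU; exact: ballxx.
- by apply: rU; rewrite -ball_normE /= mulmx1 opprD addrA subrr add0r normrN.
Qed.

(** [lipschitz_derivative_bound] is about globally Lipschitz maps. The extension agrees with [P] on
    an open ball, so the two have the same derivatives there. *)
Lemma derivative_bound_monotone (P : 'rV[R]_n -> 'rV[R]_n) c (d L K : R) :
  0 < d -> 0 <= L ->
  (forall u v, eball c d u -> eball c d v -> enorm (P u - P v) <= L * enorm (u - v)) ->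
  (forall u A, eball c d u -> frechet P u A -> forall w, dotv (w *m A) w <= K * dotv w w) ->
  exists2 d', 0 < d' & forall u v, eball c d' u -> eball c d' v ->
    dotv (P v - P u) (v - u) <= K * dotv (v - u) (v - u).
Proof.
move=> d0 L0 PL PK.
have [F [rho [M [rho0 FM FP]]]] := lipschitz_extension d0 L0 PL.
exists (Num.min rho d); first by rewrite lt_min rho0.
move=> u v; have sub1 w : eball c (Num.min rho d) w -> eball c rho w.
  by apply: eballW; rewrite ge_min lexx.
have sub2 w : eball c (Num.min rho d) w -> eball c d w.
  by apply: eballW; rewrite ge_min lexx orbT.
move=> ud vd; have [->|vu] := eqVneq v u; first by rewrite !subrr dotv0r mulr0.
rewrite -(FP u (sub1 _ ud)) -(FP v (sub1 _ vd)).
rewrite -{1}(subrKC u v).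
apply: (lipschitz_derivative_bound FM (@open_eball _ _ c (Num.min rho d))) => //.
- exact: convex_eball.
- by rewrite subr_eq0.
- move=> x A xd FA; apply: PK; first exact: sub2 xd.
  exact: (frechet_eq_on (@open_eball _ _ c rho) (sub1 _ xd) FP FA).
- by rewrite subrKC.
Qed.

End lipschitz_extension.

(** * From second-order conditions to strong minorants *)

Section resolvent_potential.
Variables (R : realType) (n : nat) (f : 'rV[R]_n -> \bar R) (xb xbs : 'rV[R]_n).
Variables (e r lam d : R).
Hypotheses (fb : f xb \is a fin_num) (e0 : 0 < e).
Hypotheses (hm : local_minorant f xb xbs e r) (lam0 : 0 < lam) (lamr : lam * r <= 2^-1).
Local Notation ub := (xb + lam *: xbs).
Local Notation P := (resolvent f xb xbs e lam).
Local Notation Q u := (lam^-1 *: (u - P u)).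
Hypothesis (Pd : forall u, eball ub d u -> local_gph f xb xbs e (P u) (Q u)).

(* The conjugate-type potential [sup_x <x, u> - |x|^2 / 2 - lam f x]. *)
Definition potential u := dotv (P u) u - enorm (P u) ^+ 2 / 2 - lam * fine (f (P u)).

(** In the minorant at [P v], multiplied by [lam], completing the square leaves the slack
    [(1 - lam * r) / 2 * enorm (x - P v) ^+ 2]; so [P v] attains the supremum over the ball. *)
Lemma potential_max v x : eball ub d v -> eball xb e x -> f x \is a fin_num ->
  dotv x v - enorm x ^+ 2 / 2 - lam * fine (f x) <= potential v.
Proof.
move=> vd xe fx; have gv := Pd vd; have [[fv _] _ _ _] := gv.
have := hm xe gv; rewrite -(fineK fv) -(fineK fx) -EFinD lee_fin /=.
rewrite /potential; set a := fine _; set b := fine _.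
rewrite dotvZl !sqr_enorm !dotvE (dotvC x (P v)) (dotvC v x) (dotvC v (P v)).
set y := P v; set xy := dotv y x; set xx := dotv x x; set yy := dotv y y.
have N0 := dotvv_ge0 (x - y); rewrite !dotvE (dotvC x y) -/xy -/xx -/yy in N0.
set xv := dotv x v; set yv := dotv y v => h.
have l0 : lam != 0 by rewrite gt_eqF.
have h2 := ler_wpM2r N0 lamr.
have := mulVKf l0 (xv - yv + (- xy - - yy)).
move: h h2; rewrite -(ler_pM2l lam0); set I := lam^-1 * _; lra.
Qed.

Lemma potential_subgradient u v : eball ub d u -> eball ub d v ->
  potential u + dotv (P u) (v - u) <= potential v.
Proof.
move=> ud vd; have [[fu _] _ bu _] := Pd ud.
have := potential_max vd bu fu; rewrite [potential u]/potential dotvDr dotvNr; lra.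
Qed.

End resolvent_potential.

Section monotone_resolvent.
Variables (R : realType) (n : nat) (f : 'rV[R]_n -> \bar R) (xb xbs : 'rV[R]_n).
Variables (e r lam d s : R).
Hypotheses (fNy : forall x, f x != -oo%E) (fb : f xb \is a fin_num) (e0 : 0 < e).
Hypotheses (hm : local_minorant f xb xbs e r) (lam0 : 0 < lam) (lamr : lam * r <= 2^-1).
Hypotheses (c0 : 0 < 1 + lam * s) (d0 : 0 < d).
Local Notation ub := (xb + lam *: xbs).
Local Notation P := (resolvent f xb xbs e lam).
Local Notation Q u := (lam^-1 *: (u - P u)).
Local Notation c := (1 + lam * s).
Hypothesis (Pd : forall u, eball ub d u -> local_gph f xb xbs e (P u) (Q u)).

Lemma eball_point_lam eta x xs : eball xb eta x -> eball xbs eta xs ->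
  enorm (x + lam *: xs - ub) < (1 + lam) * eta.
Proof.
rewrite /eball /= => xe xse.
rewrite (_ : _ - _ = (x - xb) + lam *: (xs - xbs)); last first.
  by apply/rowP => i; rewrite !mxE; ring.
rewrite (le_lt_trans (ler_enormD _ _))// enormZ gtr0_norm// mulrDl mul1r.
by rewrite ltrD// ltr_pM2l.
Qed.

(** The hypothesis bounds the potential from above by a quadratic of curvature [c^-1]. By
    conjugation [lam f + |x|^2 / 2] is bounded below with curvature [c], and [(c - 1) / lam = s]. *)
Lemma local_minorant_of_monotone :
  (forall u v, eball ub d u -> eball ub d v ->
    dotv (P v - P u) (v - u) <= c^-1 * dotv (v - u) (v - u)) ->
  exists2 e', 0 < e' & local_minorant f xb xbs e' (- s).
Proof.
(* For data within [e'], the point [u] is within [(1 + lam) * e'] of the center and [v] within a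
   further [2 * c * e']. *)
move=> hP; pose C := 1 + lam + 2 * c.
have C0 : 0 < C by rewrite /C !addr_gt0// mulr_gt0.
exists (Num.min e (d / C)); first by rewrite lt_min e0 divr_gt0.
set e' := Num.min _ _; have e'e : e' <= e by rewrite /e' ge_min lexx.
have e'd : C * e' <= d by rewrite mulrC -ler_pdivlMr// /e' ge_min lexx orbT.
move=> x' x xs x'e gx; have [lx _ xe xse] := gx.
have [fx _] := lx.
have e'0 : 0 < e' by rewrite /e' lt_min e0 divr_gt0.
pose u := x + lam *: xs; have Pu : P u = x.
  exact: (resolvent_local_gph hm lam0 lamr (local_gphW e'e fb gx)).
(* This [v] maximizes the lower bound for [f x']: there the slope [x + c^-1 *: (v - u)] of the
   quadratic equals [x']. *)
pose v := u + c *: (x' - x).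
have uub := eball_point_lam xe xse; rewrite -/u in uub.
have ud : eball ub d u.
  apply: lt_le_trans uub _; apply: le_trans e'd.
  by rewrite ler_wpM2r ?(ltW e'0)// /C lerDl mulr_ge0// ltW.
have xx' : enorm (x' - x) <= 2 * e'.
  rewrite (le_trans (ler_enormB _ xb _))// (enormB xb) mulr_natl mulr2n lerD//; exact: ltW.
have vd : eball ub d v.
  rewrite /eball /= /v addrAC (le_lt_trans (ler_enormD _ _))// enormZ (gtr0_norm c0).
  have := ler_wpM2l (ltW c0) xx'; have : C * e' = (1 + lam) * e' + c * (2 * e').
    by rewrite /C; ring.
  lra.
case f'E : (f x') => [a'| |]; last 2 first.
- by rewrite leey.
- by have := fNy x'; rewrite f'E.
have vu : v - u = c *: (x' - x) by rewrite /v addrAC subrr add0r.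
have x'e' : eball xb e x' := eballW e'e x'e.
have fx' : f x' \is a fin_num by rewrite f'E.
have h1 := potential_max hm lam0 lamr Pd vd x'e' fx'.
have h2 : potential f xb xbs e lam v <= potential f xb xbs e lam u +
    dotv (P u) (v - u) + c^-1 * dotv (v - u) (v - u) / 2.
  apply: (@subgradient_upper_bound _ _ (eball ub d)) => //.
  - exact: convex_eball.
  - by move=> y z yd zd; exact: (potential_subgradient hm lam0 lamr Pd).
  - by rewrite mulr_ge0 ?dotvv_ge0// invr_ge0 ltW.
  move=> t t01; have wd : eball ub d (u + t *: (v - u)).
    by apply: convex_segment t01 => //; exact: convex_eball.
  have := hP _ _ ud wd; rewrite -/u.
  have -> : u + t *: (v - u) - u = t *: (v - u) by rewrite addrAC subrr add0r.
  move=> /le_trans; apply; rewrite dotvZl dotvZr.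
  by rewrite le_eqVlt; apply/orP; left; apply/eqP; ring.
have {h2} := le_trans h1 h2; rewrite f'E /= /potential Pu vu.
rewrite -(fineK fx) -EFinD lee_fin.
rewrite /v /u !sqr_enorm !dotvE.
rewrite (dotvC x' x) (dotvC xs x) (dotvC xs x').
move: (fine (f x)) => a; move: (dotv x x) (dotv x x') (dotv x' x') (dotv x xs) (dotv x' xs).
move=> A B D E F h.
rewrite [fine _]/= mulKf ?gt_eqF// in h.
rewrite -(ler_pM2l lam0); lra.
Qed.

End monotone_resolvent.

Section projection_pair_minorant.
Variables (R : realType) (n : nat) (f : 'rV[R]_n -> \bar R) (xb xbs : 'rV[R]_n).

Lemma small_parameter (r s : R) :
  exists lam, [/\ 0 < lam, lam * r <= 2^-1 & 0 < 1 + lam * s].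
Proof.
pose D : R := 2 * (`|r| + `|s| + 1).
have r0 := normr_ge0 r; have s0 := normr_ge0 s.
have D0 : 0 < D by rewrite /D; lra.
exists D^-1; split; first by rewrite invr_gt0.
  by have := ler_norm r; rewrite ler_pdivrMl// /D; lra.
rewrite -(mulVf (lt0r_neq0 D0)) -mulrDr mulr_gt0 ?invr_gt0//.
by have := ler_norm (- s); rewrite normrN /D; lra.
Qed.

(** At a smooth point of the resolvent, symmetry of the derivative turns the tangent space into a
    pair [(P, W)], so the hypothesis becomes a bound on the derivative, ready for integration. *)
Lemma local_minorant_of_projection_pairs (e r eta s : R) :
  (forall x, f x != -oo%E) -> lower_semicontinuous f ->
  f xb \is a fin_num -> lsubdiff f xb xbs ->
  0 < e -> local_minorant f xb xbs e r -> 0 < eta ->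
  (forall x xs P W, local_gph f xb xbs eta x xs -> MPW f (x, xs) (P, W) ->
    psd (P *m W *m P - s *: P)) ->
  exists2 e', 0 < e' & local_minorant f xb xbs e' (- s).
Proof.
move=> fNy fl fb xbE e0 hm eta0 hpsd.
have [lam [lam0 lamr c0]] := small_parameter r s.
pose et := Num.min e eta.
have et0 : 0 < et by rewrite lt_min e0.
have ete : et <= e by rewrite ge_min lexx.
have eteta : et <= eta by rewrite ge_min lexx orbT.
have [d d0 dP] := local_gph_resolvent fNy fl fb xbE e0 hm lam0 lamr et0 ete.
pose ub := xb + lam *: xbs.
have Pd u : eball ub d u ->
    local_gph f xb xbs e (resolvent f xb xbs e lam u)
      (lam^-1 *: (u - resolvent f xb xbs e lam u)).
  by move=> /dP; exact: local_gphW.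
have l0 : lam != 0 by rewrite gt_eqF.
have [|||d' d'0 hmon] := @derivative_bound_monotone _ _ (resolvent f xb xbs e lam) ub d 2
  (1 + lam * s)^-1 d0.
- by [].
- by move=> u v ud vd; exact: (resolvent_lipschitz hm lam0 lamr Pd).
- move=> u A ud PA w.
  have AT : A^T = A.
    apply: (@subgradient_derivative_symmetric _ _ (eball ub d) (potential f xb xbs e lam)
      (resolvent f xb xbs e lam) _ u A _ PA).
    + by move=> y z yd zd; exact: (potential_subgradient hm lam0 lamr Pd).
    + by apply: open_nbhs_nbhs; split => //; exact: open_eball.
  have TE := resolvent_ftangent_frechet e0 hm lam0 lamr Pd ud PA.
  rewrite -/(resolvent_space lam A) in TE.
  have [P [W [PT WT PP WP RE]]] := resolvent_space_projection_pair lam0 AT.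
  have gu := dP _ ud.
  have Lu : gph f (resolvent f xb xbs e lam u,
    lam^-1 *: (u - resolvent f xb xbs e lam u)) by have [] := gu.
  have ZA := Znn_resolvent_space lam0 A.
  have M : MPW f (resolvent f xb xbs e lam u,
      lam^-1 *: (u - resolvent f xb xbs e lam u)) (P, W).
    split => //=; rewrite RE; split => //.
    (* The tangent cone is itself a subspace here, so the constant sequence shows it to be an
       element of [Sf]. *)
    exists (fun=> (resolvent f xb xbs e lam u,
      lam^-1 *: (u - resolvent f xb xbs e lam u))); split.
    + by move=> k; split => //; rewrite TE.
    + exact: fattentive_cst.
    + by rewrite TE /subdist subrr opnorm0; exact: cvg_cst.
  have /(psd_projection_pair s PT WT PP WP) hP :=
    hpsd _ _ _ _ (local_gphW eteta fb gu) M.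
  have : resolvent_space lam A (w *m A, lam^-1 *: (w - w *m A)) by exists w.
  rewrite -RE => -[p _ [pA pW]]; have := hP p; rewrite pA pW.
  rewrite sqr_enorm dotvZl dotvDl dotvNl (dotvC w) -(ler_pM2l lam0) mulVKf//.
  (* With [c = 1 + lam * s], this square and [c * Y <= X] give [c * X <= Z], a bound linear in
     [A]. *)
  have N0 := dotvv_ge0 ((1 + lam * s) *: (w *m A) - w).
  rewrite !dotvE (dotvC w) in N0.
  set X := dotv (w *m A) w in N0 *; set Y := dotv (w *m A) (w *m A) in N0 *.
  set Z := dotv w w in N0 * => h.
  rewrite -(ler_pM2l c0) mulVKf ?gt_eqF//.
  have h' : (1 + lam * s) * ((1 + lam * s) * Y) <= (1 + lam * s) * X.
    by rewrite ler_pM2l//; lra.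
  move: h' N0; set cY := _ * (_ * Y); set cX := _ * X; lra.
have d'd : 0 < Num.min d d' by rewrite lt_min d0.
have dd1 : Num.min d d' <= d by rewrite ge_min lexx.
have dd2 : Num.min d d' <= d' by rewrite ge_min lexx orbT.
apply: (@local_minorant_of_monotone _ _ f xb xbs e r lam (Num.min d d')) => //.
  by move=> u /(eballW dd1)/Pd.
move=> u v /(eballW dd2) ud /(eballW dd2) vd; exact: hmon.
Qed.

End projection_pair_minorant.

(** * Variational convexity and the subgradient inequality with modulus *)

Section strong_subgradient.
Variables (R : realType) (n : nat) (g : 'rV[R]_n -> \bar R) (U : set 'rV[R]_n) (s : R).
Hypotheses (gNy : forall x, g x != -oo%E).
Hypothesis gU : convex_fun_on U (fun x => g x - (s / 2 * enorm x ^+ 2)%:E)%E.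

(** Convexity propagates the local estimate: it is applied at [x + t *: (x' - x)] and divided by a
    small [t]; the errors left are of order [ep]. *)
Lemma convex_rsubdiff x xs x' : U x -> U x' -> rsubdiff g x xs ->
  (g x + (dotv xs (x' - x) + s / 2 * enorm (x' - x) ^+ 2)%:E <= g x')%E.
Proof.
move=> Ux Ux' [gx gxs].
case g'E : (g x') => [a'| |]; last 2 first.
- by rewrite leey.
- by have := gNy x'; rewrite g'E.
rewrite -(fineK gx) -EFinD lee_fin; set a := fine (g x).
have [D x'E] : exists D : 'rV[R]_n, x' = x + D by exists (x' - x); rewrite subrKC.
have DE : x' - x = D by rewrite x'E addrAC subrr add0r.
rewrite DE.
have D0 : 0 <= enorm D := enorm_ge0 D.
apply/ler_addgt0Pr => ep ep0.
pose ep1 := ep / 2 / (enorm D + 1).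
have ep10 : 0 < ep1 by rewrite !divr_gt0// ltr_wpDl.
have [dl dl0 dlP] := gxs ep1 ep10.
(* The three bounds make [t] a convex weight, keep the point within [dl] of [x], and absorb the term
   [s / 2 * t ^+ 2] of the quadratic shift. *)
pose T := Num.min 1 (Num.min (dl / (enorm D + 1)) (ep / (`|s| * enorm D ^+ 2 + 1))).
have sD : 0 <= `|s| * enorm D ^+ 2 by rewrite mulr_ge0 ?sqr_ge0.
have T0 : 0 < T by rewrite !lt_min ltr01 !divr_gt0// ltr_wpDl.
pose t := T / 2; have t0 : 0 < t by rewrite divr_gt0.
have tT : t < T by rewrite ltr_pdivrMr// ltr_pMr// ltr1n.
move: (tT); rewrite !lt_min !ltr_pdivlMr ?ltr_wpDl// => /and3P[t1 t2 t3].
have xt : enorm (x + t *: D - x) < dl.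
  rewrite addrAC subrr add0r enormZ gtr0_norm// (le_lt_trans _ t2)//.
  by rewrite ler_pM2l// lerDl.
have := dlP _ xt; rewrite -(fineK gx) -/a -EFinD.
have t01 : 0 <= t <= 1 by rewrite (ltW t0) ltW.
have := gU Ux' Ux t01; rewrite g'E -(fineK gx) -/a.
have -> : t *: x' + (1 - t) *: x = x + t *: D.
  by rewrite x'E; apply/rowP => i; rewrite !mxE; ring.
rewrite addrAC subrr add0r enormZ gtr0_norm// dotvZr x'E.
case: (g (x + t *: D)) (gNy (x + t *: D)) => [b _| _ |//]; last by [].
rewrite -!EFinB -!EFinM -!EFinD !lee_fin !sqr_enorm.
rewrite !dotvE (dotvC D x).
have e1 : ep1 * (t * enorm D) <= t * (ep / 2).
  rewrite mulrCA ler_pM2l// /ep1 mulrAC ler_pdivrMr ?ltr_wpDl//.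
  by rewrite ler_pM2l ?lerDl// divr_gt0.
have e2 : s / 2 * (t * (t * dotv D D)) <= t * (ep / 2).
  rewrite mulrCA ler_pM2l// mulrAC ler_pM2r//.
  rewrite (le_trans (ler_norm _))// normrM normrM (gtr0_norm t0).
  rewrite (ger0_norm (dotvv_ge0 D)) -sqr_enorm mulrCA.
  by apply: le_trans (ltW t3); rewrite ler_pM2l// lerDl.
move: e1 e2; set E := ep1 * _; set DD := dotv D D; set xD := dotv x D.
set xx := dotv x x; set q := dotv xs D => e1 e2 h1 h2.
rewrite -(ler_pM2l t0); lra.
Qed.

Lemma convex_subgradient x xs x' : open U -> U x -> U x' -> lsubdiff g x xs ->
  (g x + (dotv xs (x' - x) + s / 2 * enorm (x' - x) ^+ 2)%:E <= g x')%E.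
Proof.
move=> oU Ux Ux' [gx [xk [xsk [cx cg cxs xkP]]]].
case g'E : (g x') => [a'| |]; last 2 first.
- by rewrite leey.
- by have := gNy x'; rewrite g'E.
have Uk : \forall k \near \oo, U (xk k).
  by apply: cx; apply: open_nbhs_nbhs.
rewrite -(fineK gx) -EFinD lee_fin.
have cfg : fine (g (xk k)) @[k --> \oo] --> fine (g x).
  by apply: fine_cvg; rewrite fineK.
have cD : x' - xk k @[k --> \oo] --> x' - x by exact: (cvgB (cvg_cst x') cx).
have cc : fine (g (xk k)) + (dotv (xsk k) (x' - xk k) +
    s / 2 * dotv (x' - xk k) (x' - xk k)) @[k --> \oo] -->
    fine (g x) + (dotv xs (x' - x) + s / 2 * dotv (x' - x) (x' - x)).
  exact: (cvgD cfg (cvgD (cvg_dotv cxs cD) (cvgM (cvg_cst _) (cvg_dotv cD cD)))).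
rewrite sqr_enorm; have := @cvg_near_le R _ _ a' cc; apply.
apply: filterS Uk => k Uk.
have := convex_rsubdiff Uk Ux' (xkP k); have [gk _] := xkP k.
by rewrite g'E -(fineK gk) -EFinD lee_fin sqr_enorm.
Qed.

End strong_subgradient.

Section variational_convexity.
Variables (R : realType) (n : nat) (f : 'rV[R]_n -> \bar R) (xb xbs : 'rV[R]_n) (s : R).

Lemma near_local_gph (U V : set 'rV[R]_n) (rho : R) : f xb \is a fin_num ->
  nbhs xb U -> nbhs xbs V -> (f xb < rho%:E)%E ->
  exists eta, [/\ 0 < eta, eball xb eta `<=` U & forall x xs, local_gph f xb xbs eta x xs ->
    [/\ gph_rho f rho (x, xs), U x & V xs]].
Proof.
move=> fb /nbhs_eballP[a a0 aU] /nbhs_eballP[b b0 bV] frho.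
have rho0 : 0 < rho - fine (f xb) by rewrite subr_gt0 -lte_fin fineK.
pose eta := Num.min a (Num.min b (rho - fine (f xb))).
have ea : eta <= a by rewrite ge_min lexx.
have eb : eta <= b by rewrite !ge_min lexx orbT.
have er : eta <= rho - fine (f xb) by rewrite !ge_min lexx !orbT.
exists eta; split; first by rewrite !lt_min a0 b0.
  by move=> x /(eballW ea)/aU.
move=> x xs [l fx xe xse]; split; last 2 first.
- exact: aU (eballW ea xe).
- exact: bV (eballW eb xse).
split => //; apply: lt_le_trans fx _.
by rewrite -(fineK fb) -EFinD lee_fin /=; lra.
Qed.

(** On the common graph the values agree, so the strong subgradient inequality of [fh] passes to the
    larger function [f]. *)
Lemma var_sconvex_local_minorant : f xb \is a fin_num -> var_sconvex f xb xbs s ->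
  exists2 e, 0 < e & local_minorant f xb xbs e (- s).
Proof.
move=> fb [U [V [fh [rho [[[oU oV] _ [Ux Vx] [fhNy _] frho] [cfh fhf gE fE]]]]]].
have nU : nbhs xb U by apply: open_nbhs_nbhs.
have nV : nbhs xbs V by apply: open_nbhs_nbhs.
have [eta [eta0 etaU etaP]] := near_local_gph fb nU nV frho.
exists eta => // x' x xs x'e gx; have [gr Uxx Vxs] := etaP _ _ gx.
have gh := (gE _ _ Uxx Vxs).1 gr.
rewrite (fE _ _ Uxx Vxs gr gh); apply: le_trans (fhf _ (etaU _ x'e)).
have := convex_subgradient fhNy cfh oU Uxx (etaU _ x'e) gh.
by rewrite !mulNr opprK.
Qed.

End variational_convexity.

Section envelope.
Variables (R : realType) (n : nat) (f : 'rV[R]_n -> \bar R) (xb xbs : 'rV[R]_n) (e s : R).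
Hypotheses (fb : f xb \is a fin_num) (xbE : lsubdiff f xb xbs) (e0 : 0 < e).

Definition quadratic_minorant y ys x : R :=
  fine (f y) + (dotv ys (x - y) + s / 2 * enorm (x - y) ^+ 2).

Definition envelope x : \bar R :=
  ereal_sup [set (quadratic_minorant p.1 p.2 x)%:E | p in
    [set p : 'rV[R]_n * 'rV[R]_n | local_gph f xb xbs e p.1 p.2]].

Lemma envelope_ge y ys x : local_gph f xb xbs e y ys ->
  ((quadratic_minorant y ys x)%:E <= envelope x)%E.
Proof. by move=> g; apply: ereal_sup_ubound; exists (y, ys). Qed.

Lemma envelope_Ny x : envelope x != -oo%E.
Proof.
have := envelope_ge x (local_gph_center e0 xbE fb).
by case: (envelope x).
Qed.

Lemma continuous_quadratic_minorant y ys : continuous (quadratic_minorant y ys).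
Proof.
move=> x; apply: (@cvgD _ _ _ (nbhs x)); first exact: cvg_cst.
apply: (@cvgD _ _ _ (nbhs x)); last exact: continuous_sqr_enormB.
have xy : z - y @[z --> x] --> x - y.
  have idx : z @[z --> x] --> x by exact: cvg_id.
  exact: cvgB idx (cvg_cst y).
by exact: (cvg_dotv (cvg_cst ys) xy).
Qed.

Lemma envelope_lsc : lower_semicontinuous envelope.
Proof.
move=> x a /ereal_sup_gt[_ [[y ys] g <-]]; rewrite lte_fin /= => ax.
exists [set z | a < quadratic_minorant y ys z].
  have : nbhs (quadratic_minorant y ys x) [set z | a < z].
    by apply: open_nbhs_nbhs; split => //; exact: open_gt.
  exact: continuous_quadratic_minorant.
by move=> z /= az; apply: lt_le_trans (envelope_ge z g); rewrite lte_fin.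
Qed.

(** All minorants have the same quadratic part; removing it leaves a supremum of affine
    functions. *)
Lemma envelope_convex U : convex_fun_on U (fun x => envelope x - (s / 2 * enorm x ^+ 2)%:E)%E.
Proof.
move=> a b l _ _ /andP[l0 l1]; rewrite leeBlDr//.
apply: ge_ereal_sup => _ [[y ys] g <-] /=.
rewrite -leeBlDr// -EFinB.
have -> : quadratic_minorant y ys (l *: a + (1 - l) *: b) -
    s / 2 * enorm (l *: a + (1 - l) *: b) ^+ 2 =
    l * (quadratic_minorant y ys a - s / 2 * enorm a ^+ 2) +
    (1 - l) * (quadratic_minorant y ys b - s / 2 * enorm b ^+ 2).
  rewrite /quadratic_minorant !sqr_enorm !dotvE (dotvC b a) (dotvC y b) (dotvC y a).
  by ring.
rewrite EFinD !EFinM !EFinB; apply: leeD; (apply: lee_wpmul2l;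
  first by rewrite lee_fin ?subr_ge0); by rewrite leeD2r// envelope_ge.
Qed.

Hypothesis hm : local_minorant f xb xbs e (- s).

Lemma quadratic_minorant_le y ys x : local_gph f xb xbs e y ys -> eball xb e x ->
  ((quadratic_minorant y ys x)%:E <= f x)%E.
Proof.
move=> g xe; have := hm xe g; have [[fy _] _ _ _] := g.
by rewrite /quadratic_minorant -{1}(fineK fy) -EFinD !mulNr opprK.
Qed.

Lemma envelope_le x : eball xb e x -> (envelope x <= f x)%E.
Proof.
by move=> xe; apply: ge_ereal_sup => _ [[y ys] g <-]; exact: quadratic_minorant_le.
Qed.

Lemma envelope_local_gph x xs : local_gph f xb xbs e x xs -> envelope x = f x.
Proof.
move=> g; have [[fx _] _ xe _] := g; apply/eqP; rewrite eq_le envelope_le//=.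
apply: le_trans (envelope_ge x g).
by rewrite /quadratic_minorant subrr enorm0 dotv0r expr0n /= mulr0 !addr0 fineK.
Qed.

(** The minorant at [(x, xs)] touches the envelope at [x] and has gradient [xs] there. *)
Lemma local_gph_rsubdiff_envelope x xs : local_gph f xb xbs e x xs ->
  rsubdiff envelope x xs.
Proof.
move=> g; have ex := envelope_local_gph g; have [[fx _] _ _ _] := g.
split; first by rewrite ex.
move=> ep ep0; exists (2 * ep / (`|s| + 1)); first by rewrite divr_gt0 ?mulr_gt0// ltr_wpDl.
move=> y; rewrite ltr_pdivlMr ?ltr_wpDl// => yx.
apply: le_trans (envelope_ge y g); rewrite ex -{1}(fineK fx) -EFinD lee_fin.
rewrite /quadratic_minorant !lerD2l; move: yx.
set N := enorm _ => yx; have N0 : 0 <= N := enorm_ge0 _.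
have N2 : 0 <= N ^+ 2 := sqr_ge0 _.
have h1 := ler_wpM2r N0 (ltW yx).
have h2 := ler_wpM2r N2 (ler_norm (- s)); rewrite normrN in h2.
lra.
Qed.

(** The point is that the envelope has no further subgradients nearby: the localized graph of [f]
    already solves [u = x + lam *: xs] for every [u] near the center, and the envelope admits only
    one solution. *)
Lemma local_minorant_var_sconvex : (forall x, f x != -oo%E) -> lower_semicontinuous f ->
  var_sconvex f xb xbs s.
Proof.
move=> fNy fl.
have [lam [lam0 lamr c0]] := small_parameter (- s) s.
have [d d0 dP] := local_gph_resolvent fNy fl fb xbE e0 hm lam0 lamr e0 (lexx e).
pose e' := Num.min e (d / (1 + lam)).
have lam1 : 0 < 1 + lam by rewrite addr_gt0.
have e'0 : 0 < e' by rewrite lt_min e0 divr_gt0.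
have e'e : e' <= e by rewrite ge_min lexx.
have e'd : (1 + lam) * e' <= d by rewrite mulrC -ler_pdivlMr// ge_min lexx orbT.
have l0 : lam != 0 by rewrite gt_eqF.
have gphE x xs : eball xb e' x -> eball xbs e' xs ->
    gph_rho f (fine (f xb) + e) (x, xs) -> local_gph f xb xbs e x xs.
  move=> xe xse [l /= fx]; split => //; [|exact: eballW e'e xe|exact: eballW e'e xse].
  by rewrite -(fineK fb) -EFinD.
exists (eball xb e'), (eball xbs e'), envelope, (fine (f xb) + e); split; split.
- by split; exact: open_eball.
- by split; exact: convex_eball.
- by rewrite /eball /= !subrr !enorm0.
- by split; [exact: envelope_Ny|exact: envelope_lsc].
- by rewrite -{1}(fineK fb) lte_fin ltrDl.
- exact: envelope_convex.
- by move=> x /(eballW e'e); exact: envelope_le.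
- move=> x xs xe xse; split.
    by move=> /(gphE _ _ xe xse) g; apply/rsubdiff_lsubdiff/local_gph_rsubdiff_envelope.
  move=> /= hx; have [fhx _] := hx.
  pose u := x + lam *: xs.
  have ud : eball (xb + lam *: xbs) d u.
    exact: lt_le_trans (eball_point_lam lam0 xe xse) e'd.
  have gy := dP _ ud; set y := resolvent _ _ _ _ _ _ in gy.
  have [[fy _] _ _ _] := gy.
  have h1 := envelope_ge x gy.
  have := convex_subgradient envelope_Ny (@envelope_convex setT) openT I I hx (x' := y).
  move: h1; rewrite (envelope_local_gph gy) -(fineK fhx) -(fineK fy) -EFinD !lee_fin.
  rewrite /quadratic_minorant => h1 h2.
  have xsE : xs = lam^-1 *: (u - x) by rewrite /u addrAC subrr add0r scalerK.
  (* Adding the strong inequalities of the envelope at [x] and [y], whose subgradients differ by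
     [lam^-1 *: (x - y)], gives [(1 + lam * s) * enorm (x - y) ^+ 2 <= 0]. *)
  have xy : x = y.
    apply/eqP; rewrite -subr_eq0; apply/eqP/dotvv_eq0.
    have N0 := dotvv_ge0 (x - y).
    have yx : lam^-1 *: (u - y) = xs + lam^-1 *: (x - y).
      by rewrite [in RHS]xsE -scalerDr addrA subrK.
    move: h1 h2; rewrite yx (enormB y) -(opprB x y) !sqr_enorm dotvDl dotvZl dotvNr.
    set N := dotv (x - y) (x - y) in N0 *; set q := dotv xs _.
    set a := fine _; set b := fine _ => h1 h2.
    apply/eqP; rewrite eq_le N0 andbT -(pmulr_rle0 _ c0).
    have h3 : lam * (lam^-1 * N + s * N) <= 0 by rewrite pmulr_rle0//; lra.
    by move: h3; rewrite mulrDr mulVKf//; lra.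
  have ys : lam^-1 *: (u - y) = xs by rewrite -xy xsE.
  rewrite ys -xy in gy; have [l fx _ _] := gy; split => //=.
  by move: fx; rewrite -(fineK fb).
- by move=> x xs xe xse gr _; rewrite (envelope_local_gph (gphE _ _ xe xse gr)).
Qed.

End envelope.

(** * The chain of second-order conditions *)

Section second_order.
Variables (R : realType) (n : nat) (f : 'rV[R]_n -> \bar R) (xb xbs : 'rV[R]_n) (s : R).
Hypotheses (fNy : forall x, f x != -oo%E) (fl : lower_semicontinuous f).
Hypotheses (fb : f xb \is a fin_num) (xbE : lsubdiff f xb xbs).

Lemma gph_rho_local_gph eta x xs : gph_rho f (fine (f xb) + eta) (x, xs) ->
  eball xb eta x -> eball xbs eta xs -> local_gph f xb xbs eta x xs.
Proof. by move=> [l fx] xe xse; split => //; rewrite -(fineK fb) -EFinD. Qed.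

Lemma nbhs_eball (x : 'rV[R]_n) eta : 0 < eta -> nbhs x (eball x eta).
Proof. by move=> eta0; apply/nbhs_eballP; exists eta. Qed.

Lemma local_gph_near (Q : 'rV[R]_n -> 'rV[R]_n -> Prop) :
  (exists2 eta, 0 < eta & forall x xs, local_gph f xb xbs eta x xs -> Q x xs) ->
  exists (U V : set 'rV[R]_n) (rho : R), [/\ nbhs xb U, nbhs xbs V, (f xb < rho%:E)%E &
    forall x xs, gph_rho f rho (x, xs) -> U x -> V xs -> Q x xs].
Proof.
move=> [eta eta0 h]; exists (eball xb eta), (eball xbs eta), (fine (f xb) + eta); split.
- exact: nbhs_eball.
- exact: nbhs_eball.
- by rewrite -{1}(fineK fb) lte_fin ltrDl.
- by move=> x xs g xe xse; apply/h/gph_rho_local_gph.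
Qed.

(** The tangent cone need not be a subspace, so the normal vector is tested against a single tangent
    vector whose direction is adapted to it. *)
Lemma local_minorant_coderiv_reg (e : R) : 0 < e -> local_minorant f xb xbs e (- s) ->
  exists2 eta, 0 < eta & forall x xs, local_gph f xb xbs eta x xs ->
    forall z zs, coderiv_reg f x xs z zs -> s * enorm z ^+ 2 <= dotv zs z.
Proof.
move=> e0 hm; have [lam [lam0 lamr c0]] := small_parameter (- s) s.
have [d d0 dP] := local_gph_resolvent fNy fl fb xbE e0 hm lam0 lamr e0 (lexx e).
have l0 : lam != 0 by rewrite gt_eqF.
have lam1 : 0 < 1 + lam by rewrite addr_gt0.
pose e' := Num.min e (d / (1 + lam)).
have e'0 : 0 < e' by rewrite lt_min e0 divr_gt0.
have e'e : e' <= e by rewrite ge_min lexx.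
have e'd : (1 + lam) * e' <= d by rewrite mulrC -ler_pdivlMr// ge_min lexx orbT.
exists e' => // x xs gx z zs hz; have [_ _ xe xse] := gx.
have gxe := local_gphW e'e fb gx.
have ud := lt_le_trans (eball_point_lam lam0 xe xse) e'd.
have Pu := resolvent_local_gph hm lam0 lamr gxe.
set c : R := 1 + lam * s in c0; pose y : 'rV[R]_n := lam *: zs + z.
(* The contraction argument of [resolvent_space_polar] for one direction: with [q = w - 2 * c *: a],
   tangency gives [enorm q <= enorm w], normality gives [enorm w ^+ 2 <= dotv y q], hence
   [enorm w <= enorm y], which is the claim. *)
pose w : 'rV[R]_n := y - 2 * c *: z.
have [a] := resolvent_ftangent_exists e0 hm lam0 lamr dP w ud.
rewrite Pu (_ : lam^-1 *: (x + lam *: xs - x) = xs); last first.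
  by rewrite addrAC subrr add0r scalerK.
move=> Ta; have := ftangent_monotone (z := (x, xs)) hm gxe Ta; have := hz _ Ta.
rewrite opprK /dotp /= sqr_enorm !dotvNl !dotvZl dotvZr.
rewrite -(ler_pM2l lam0) => h1; rewrite -(ler_pM2l lam0) mulVKf// dotvDl dotvNl => h2.
have {h1} h1 : dotv y a <= dotv z w.
  by move: h1; rewrite mulr0 mulrBr mulVKf// dotvDr dotvNr /y dotvDl dotvZl; lra.
have {h2} h2 : c * dotv a a <= dotv w a by rewrite /c; lra.
pose q : 'rV[R]_n := w - 2 * c *: a.
have qw : enorm q <= enorm w.
  rewrite le_enorm_dotv /q; move: (w) h2 => w' h2.
  rewrite !dotvE (dotvC a w'); have := ler_wpM2l (ltW c0) h2; lra.
have h3 : enorm w ^+ 2 <= enorm y * enorm w.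
  apply: le_trans (_ : dotv y q <= _); last first.
    by rewrite (le_trans (ler_dotv _ _))// ler_wpM2l ?enorm_ge0.
  rewrite sqr_enorm {1}/w /q dotvDl dotvNl dotvZl dotvDr dotvNr dotvZr.
  by have := ler_wpM2l (ltW c0) h1; lra.
have wy : enorm w <= enorm y.
  have [->|w0] := eqVneq (enorm w) 0; first exact: enorm_ge0.
  by rewrite -(ler_pM2r (x := enorm w)) ?lt_def ?w0 ?enorm_ge0// -expr2.
have : c * (c * dotv z z) <= c * dotv y z.
  move: wy; rewrite le_enorm_dotv /w; move: (y) => y'.
  by rewrite !dotvE (dotvC z y'); lra.
rewrite ler_pM2l// /y dotvDl dotvZl sqr_enorm /c => h; rewrite -(ler_pM2l lam0); lra.
Qed.

Lemma coderiv_reg_lim x xs z zs : gph f (x, xs) -> coderiv_reg f x xs z zs ->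
  coderiv_lim f x xs z zs.
Proof.
move=> g h; exists (fun=> (x, xs)), (fun=> (zs, - z)); split => //.
- exact: fattentive_cst.
- exact: cvg_cst.
- exact: cvg_cst.
Qed.

Lemma coderiv_lim_bound eta :
  (forall x xs, local_gph f xb xbs eta x xs ->
    forall z zs, coderiv_reg f x xs z zs -> s * enorm z ^+ 2 <= dotv zs z) ->
  forall x xs, local_gph f xb xbs eta x xs ->
    forall z zs, coderiv_lim f x xs z zs -> s * enorm z ^+ 2 <= dotv zs z.
Proof.
move=> h x xs g z zs [zk [vk [zkP vkN c1 c2]]]; rewrite /= in c1 c2.
have gk := fattentive_local_gph (z := (x, xs)) g zkP.
have c3 : - (vk k).2 @[k --> \oo] --> z by rewrite -[z]opprK; exact: cvgN.
have cc : dotv (vk k).1 (- (vk k).2) - s * dotv (- (vk k).2) (- (vk k).2) @[k --> \oo] -->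
    dotv zs z - s * dotv z z.
  exact: (cvgB (cvg_dotv c1 c3) (cvgM (cvg_cst s) (cvg_dotv c3 c3))).
rewrite sqr_enorm -subr_ge0; have := @cvg_near_ge R _ _ 0 cc; apply.
apply: filterS gk => k gk; rewrite subr_ge0 -sqr_enorm; apply: (h _ _ gk).
rewrite /coderiv_reg opprK -!surjective_pairing; exact: vkN.
Qed.

(** Prox-regularity gives the tangent subspace the form [resolvent_space A]; elements of its polar
    are regular normals, hence limiting ones, and [resolvent_space_polar] returns to tangents. *)
Lemma ftangent_bound e eta r : local_minorant f xb xbs e r -> eta <= e ->
  (forall x xs, local_gph f xb xbs eta x xs ->
    forall z zs, coderiv_lim f x xs z zs -> s * enorm z ^+ 2 <= dotv zs z) ->
  forall x xs, local_gph f xb xbs eta x xs -> Znn (ftangent f (x, xs)) ->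
    forall z zs, ftangent f (x, xs) (z, zs) -> s * enorm z ^+ 2 <= dotv zs z.
Proof.
move=> hm etae h x xs g ZT z zs Tz.
have [lam [lam0 lamr c0]] := small_parameter r s.
have mono w : ftangent f (x, xs) w -> - r * enorm w.1 ^+ 2 <= dotv w.2 w.1.
  exact: (ftangent_monotone (z := (x, xs)) hm (local_gphW etae fb g)).
have [A TA] := Znn_resolvent_form lam0 lamr ZT mono.
rewrite TA in Tz; apply: (resolvent_space_polar lam0 c0 _ Tz) => v vs hv.
apply: (h _ _ g); apply: coderiv_reg_lim; first by have [] := g.
by rewrite /coderiv_reg /fnormal_reg /= TA.
Qed.

Lemma Sf_bound eta :
  (forall x xs, local_gph f xb xbs eta x xs -> Znn (ftangent f (x, xs)) ->
    forall z zs, ftangent f (x, xs) (z, zs) -> s * enorm z ^+ 2 <= dotv zs z) ->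
  forall x xs, local_gph f xb xbs eta x xs -> forall L, Sf f (x, xs) L ->
    forall z zs, L (z, zs) -> s * enorm z ^+ 2 <= dotv zs z.
Proof.
move=> h x xs g L [ZL [zk [zkO zkP LT]]] z zs Lz.
have ZT k : Znn (ftangent f (zk k)) by have [] := zkO k.
have [wk [wkT c1 c2]] := subdist_approx ZL ZT LT Lz; rewrite /= in c1 c2.
have gk := fattentive_local_gph (z := (x, xs)) g zkP.
have cc : dotv (wk k).2 (wk k).1 - s * dotv (wk k).1 (wk k).1 @[k --> \oo] -->
    dotv zs z - s * dotv z z.
  exact: (cvgB (cvg_dotv c2 c1) (cvgM (cvg_cst s) (cvg_dotv c1 c1))).
rewrite sqr_enorm -subr_ge0; have := @cvg_near_ge R _ _ 0 cc; apply.
apply: filterS gk => k gk; rewrite subr_ge0 -sqr_enorm; apply: (h _ _ gk).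
  by rewrite -surjective_pairing.
by rewrite -!surjective_pairing; exact: wkT.
Qed.

Lemma MPW_bound x xs P W :
  (forall L, Sf f (x, xs) L -> forall z zs, L (z, zs) -> s * enorm z ^+ 2 <= dotv zs z) ->
  MPW f (x, xs) (P, W) -> psd (P *m W *m P - s *: P).
Proof.
move=> h [/= PT WT PP WP SL]; apply/(psd_projection_pair s PT WT PP WP) => p.
by apply: (h _ SL); exists p.
Qed.

End second_order.

Theorem theorem4p3 (R : realType) (n : nat) (f : 'rV[R]_n -> \bar R)
    (xb xbs : 'rV[R]_n) (s : R) :
  (forall x, f x != -oo%E) -> lower_semicontinuous f ->
  f xb \is a fin_num -> lsubdiff f xb xbs ->
  [<-> (* (i) *)
       var_sconvex f xb xbs s;
       (* (ii) *)
       prox_regular f xb xbs /\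
       exists (U V : set 'rV[R]_n) (rho : R),
         [/\ nbhs xb U, nbhs xbs V, (f xb < rho%:E)%E &
             forall x xs z zs, gph_rho f rho (x, xs) -> U x -> V xs ->
               coderiv_reg f x xs z zs -> s * enorm z ^+ 2 <= dotv zs z];
       (* (iii) *)
       prox_regular f xb xbs /\
       exists (U V : set 'rV[R]_n) (rho : R),
         [/\ nbhs xb U, nbhs xbs V, (f xb < rho%:E)%E &
             forall x xs z zs, gph_rho f rho (x, xs) -> U x -> V xs ->
               coderiv_lim f x xs z zs -> s * enorm z ^+ 2 <= dotv zs z];
       (* (iv) *)
       prox_regular f xb xbs /\
       exists (U V : set 'rV[R]_n) (rho : R),
         [/\ nbhs xb U, nbhs xbs V, (f xb < rho%:E)%E &
             forall x xs z zs, Of_set f (x, xs) -> U x -> V xs -> (f x < rho%:E)%E ->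
               ftangent f (x, xs) (z, zs) -> s * enorm z ^+ 2 <= dotv zs z];
       (* (v) *)
       prox_regular f xb xbs /\
       exists (U V : set 'rV[R]_n) (rho : R),
         [/\ nbhs xb U, nbhs xbs V, (f xb < rho%:E)%E &
             forall x xs L z zs, gph_rho f rho (x, xs) -> U x -> V xs ->
               Sf f (x, xs) L -> L (z, zs) -> s * enorm z ^+ 2 <= dotv zs z];
       (* (vi) *)
       prox_regular f xb xbs /\
       exists (U V : set 'rV[R]_n) (rho : R),
         [/\ nbhs xb U, nbhs xbs V, (f xb < rho%:E)%E &
             forall x xs (P W : 'M[R]_n), gph_rho f rho (x, xs) -> U x -> V xs ->
               MPW f (x, xs) (P, W) -> psd (P *m W *m P - s *: P)]].
Proof.
move=> fNy fl fb xbE; tfae.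
- move=> /(var_sconvex_local_minorant fb)[e e0 hm]; split.
    (* [prox_regular] asks for a nonnegative parameter, while [- s] may be negative. *)
    apply/prox_regularP; exists e, (Num.max 0 (- s)); split => //.
      by rewrite le_max lexx.
    by apply: local_minorantW hm => //; rewrite le_max lexx orbT.
  have /(local_gph_near fb)[U [V [rho [nU nV frho h]]]] :=
    local_minorant_coderiv_reg fNy fl fb xbE e0 hm.
  by exists U, V, rho; split => // x xs z zs g Ux Vxs; exact: h.
- move=> [pr [U [V [rho [nU nV frho h]]]]]; split => //.
  have [eta [eta0 _ etaP]] := near_local_gph fb nU nV frho.
  have /(local_gph_near fb)[U' [V' [rho' [nU' nV' frho' h']]]] : exists2 eta, 0 < eta &
      forall x xs, local_gph f xb xbs eta x xs ->
      forall z zs, coderiv_lim f x xs z zs -> s * enorm z ^+ 2 <= dotv zs z.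
    exists eta => //; apply: coderiv_lim_bound => x xs /etaP[g Ux Vxs] z zs; exact: h.
  by exists U', V', rho'; split => // x xs z zs g Ux Vxs; exact: h'.
- move=> [pr [U [V [rho [nU nV frho h]]]]]; split => //.
  have [eta [eta0 _ etaP]] := near_local_gph fb nU nV frho.
  have /prox_regularP[e [r [e0 _ hm]]] := pr.
  have /(local_gph_near fb)[U' [V' [rho' [nU' nV' frho' h']]]] : exists2 eta, 0 < eta &
      forall x xs, local_gph f xb xbs eta x xs -> Znn (ftangent f (x, xs)) ->
      forall z zs, ftangent f (x, xs) (z, zs) -> s * enorm z ^+ 2 <= dotv zs z.
    exists (Num.min e eta); first by rewrite lt_min e0.
    apply: (ftangent_bound fb hm); first by rewrite ge_min lexx.
    move=> x xs g z zs; have ee : Num.min e eta <= eta by rewrite ge_min lexx orbT.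
    by have [g' Ux Vxs] := etaP _ _ (local_gphW ee fb g); exact: h.
  exists U', V', rho'; split => // x xs z zs [g ZT] Ux Vxs fx.
  by apply: h' => //; split.
- move=> [pr [U [V [rho [nU nV frho h]]]]]; split => //.
  have [eta [eta0 _ etaP]] := near_local_gph fb nU nV frho.
  have /(local_gph_near fb)[U' [V' [rho' [nU' nV' frho' h']]]] : exists2 eta, 0 < eta &
      forall x xs, local_gph f xb xbs eta x xs -> forall L, Sf f (x, xs) L ->
      forall z zs, L (z, zs) -> s * enorm z ^+ 2 <= dotv zs z.
    exists eta => //; apply: Sf_bound => x xs /etaP[[l fx] Ux Vxs] ZT z zs.
    by apply: h => //; split.
  by exists U', V', rho'; split => // x xs L z zs g Ux Vxs SL; exact: (h' x xs).
- move=> [pr [U [V [rho [nU nV frho h]]]]]; split => //.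
  exists U, V, rho; split => // x xs P W g Ux Vxs; apply: MPW_bound => L SL z zs.
  exact: (h x xs).
- move=> [/prox_regularP[e [r [e0 _ hm]]] [U [V [rho [nU nV frho h]]]]].
  have [eta [eta0 _ etaP]] := near_local_gph fb nU nV frho.
  have [|e' e'0 hm'] := local_minorant_of_projection_pairs (s := s) fNy fl fb xbE e0 hm eta0.
    by move=> x xs P W /etaP[g Ux Vxs]; exact: h.
  exact: local_minorant_var_sconvex hm' fNy fl.
Qed.
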